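(* Let $n\ge1$, $1/4<t\le1$ and $\kappa_n(t)=\max\{1,(4t-1)^{-n}\}$. For every admissible symbol $g$ on $\mathbb{C}^n$ with $T_g$ bounded, $\|g^{(t)}\|_\infty\le\kappa_n(t)\|T_g\|$. Moreover, $$\sup_{\substack{g\in C_c^\infty(\mathbb{C}^n)\\ T_g\ne0}}\frac{\|g^{(t)}\|_\infty}{\|T_g\|}=\kappa_n(t).$$
   Context: Let $v$ be Lebesgue measure on $\mathbb{C}^n$ and $d\mu(z)=(2\pi)^{-n}e^{-|z|^2/2}\,dv(z)$. The Fock space $F^2$ is the closed subspace of entire functions in $L^2(d\mu)$, and $P:L^2(d\mu)\to F^2$ is the orthogonal projection. For $a\in\mathbb{C}^n$, $k_a(z)=e^{z\cdot\overline a/2-|a|^2/4}$ (with $z\cdot\overline a=\sum_j z_j\overline{a_j}$). A measurable $g:\mathbb{C}^n\to\mathbb{C}$ is admissible if $gk_a\in L^2(d\mu)$ for all $a\in\mathbb{C}^n$. For such $g$, the Toeplitz operator $T_gf=P(gf)$ is defined on the dense set $\mathcal D_g=\{f\in F^2:gf\in L^2(d\mu)\}$; ''$T_g$ bounded'' means it has a bounded extension to $F^2$, also denoted $T_g$, and $\|T_g\|$ is the operator norm. The heat transform is $$g^{(t)}(a)=(4\pi t)^{-n}\int_{\mathbb{C}^n}g(w)e^{-|w-a|^2/(4t)}\,dv(w)$$ whenever the integral converges absolutely. $\|\cdot\|_\infty$ is the supremum norm on $\mathbb{C}^n$, and $C_c^\infty(\mathbb{C}^n)$ is the space of smooth compactly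 supported functions. *)

(* Defs.v *)
From HB Require Import structures.
From mathcomp Require Import all_boot all_order all_algebra.
From mathcomp Require Import all_classical all_reals all_analysis.
From mathcomp Require Import measurable_realfun complex.

Set Implicit Arguments.
Unset Strict Implicit.
Unset Printing Implicit Defensive.

Import Order.TTheory GRing.Theory Num.Theory.
Import numFieldNormedType.Exports.
Import ComplexField.Normc.

Local Open Scope classical_set_scope.
Local Open Scope ring_scope.
Local Open Scope complex_scope.

(* m1 \x m2 under a new head symbol: the canonical sigma-finite structure that
   the library attaches to \x requires subprobabilities. *)
Section prod_measure.
Context d1 d2 (T1 : measurableType d1) (T2 : measurableType d2) (R : realType).
Context (m1 : {sigma_finite_measure set T1 -> \bar R}).
Context (m2 : {sigma_finite_measure set T2 -> \bar R}).

Definition prod_measure : set (T1 * T2) -> \bar R := (m1 \x m2)%E.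

HB.instance Definition _ := Measure.copy prod_measure (m1 \x m2)%E.

Let prod_measure_sigma_finite : sigma_finite setT prod_measure.
Proof.
have /sigma_finiteP[F [TF ndF Foo]] := sigma_finiteT m1.
have /sigma_finiteP[G [TG ndG Goo]] := sigma_finiteT m2.
exists (fun k => F k `*` G k).
  rewrite -setXTT TF TG predeqE => -[x y]; split.
    move=> [/= [k _ Fkx] [l _ Gly]]; exists (maxn k l) => //; split.
    - by move: x Fkx; exact/subsetPset/ndF/leq_maxl.
    - by move: y Gly; exact/subsetPset/ndG/leq_maxr.
  by move=> [k _ []/= ? ?]; split; exists k.
move=> k; have [? ?] := Foo k; have [? ?] := Goo k.
split; first exact: measurableX.
by rewrite /prod_measure product_measure1E// lte_mul_pinfty// ge0_fin_numE.
Qed.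

HB.instance Definition _ := Measure_isSigmaFinite.Build _ _ _ prod_measure
  prod_measure_sigma_finite.

End prod_measure.

Section cons_measure.
Context d (T : measurableType d) (R : realType) (n : nat).

Definition tuple_cons (p : T * n.-tuple T) : n.+1.-tuple T :=
  [tuple of p.1 :: p.2].

Definition tuple_uncons (s : n.+1.-tuple T) : T * n.-tuple T :=
  (thead s, [tuple of behead s]).

Lemma tuple_consK : cancel tuple_cons tuple_uncons.
Proof. by case=> x s; congr pair; apply: val_inj. Qed.

Lemma tuple_unconsK : cancel tuple_uncons tuple_cons.
Proof. by move=> s; rewrite [RHS]tuple_eta. Qed.

Lemma measurable_tuple_cons : measurable_fun setT tuple_cons.
Proof. exact: measurable_cons. Qed.

Lemma measurable_tuple_uncons : measurable_fun setT tuple_uncons.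
Proof.
apply: (measurable_fun_pair (f := fun s : n.+1.-tuple T => thead s)).
- exact: measurable_tnth.
- exact: measurable_behead.
Qed.

Context (m1 : {sigma_finite_measure set T -> \bar R}).
Context (m2 : {sigma_finite_measure set (n.-tuple T) -> \bar R}).

Definition cons_measure : set (n.+1.-tuple T) -> \bar R :=
  pushforward (prod_measure m1 m2) tuple_cons.

Let cons_measure0 : cons_measure set0 = 0%E.
Proof. by rewrite /cons_measure /pushforward preimage_set0 measure0. Qed.

Let cons_measure_ge0 A : (0 <= cons_measure A)%E.
Proof. by rewrite /cons_measure /pushforward measure_ge0. Qed.

Let cons_measure_sigma_additive : semi_sigma_additive cons_measure.
Proof.
move=> F mF tF mUF; rewrite /cons_measure /pushforward preimage_bigcup.
have mpre A : measurable A -> measurable (tuple_cons @^-1` A).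
  by move=> mA; rewrite -[X in measurable X]setTI; exact: measurable_tuple_cons.
apply: measure_semi_sigma_additive.
- by move=> k; exact: mpre.
- apply/trivIsetP => i j _ _ ij; rewrite -preimage_setI.
  by move/trivIsetP : tF => /(_ _ _ _ _ ij) -> //; rewrite preimage_set0.
- by rewrite -preimage_bigcup; exact: mpre.
Qed.

HB.instance Definition _ := isMeasure.Build _ _ _ cons_measure
  cons_measure0 cons_measure_ge0 cons_measure_sigma_additive.

Let cons_measure_sigma_finite : sigma_finite setT cons_measure.
Proof.
have [F FT Foo] := sigma_finiteT (prod_measure m1 m2).
exists (fun k => tuple_uncons @^-1` F k).
  by rewrite -preimage_bigcup -FT preimage_setT.
move=> k; have [mF Fk] := Foo k; split.
  by rewrite -[X in measurable X]setTI; exact: measurable_tuple_uncons.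
suff -> : cons_measure (tuple_uncons @^-1` F k) = prod_measure m1 m2 (F k) by [].
congr (prod_measure _ _ _); apply/funext => p.
by rewrite /preimage /= tuple_consK.
Qed.

HB.instance Definition _ := Measure_isSigmaFinite.Build _ _ _ cons_measure
  cons_measure_sigma_finite.

End cons_measure.

(* The n-fold product measure m \x ... \x m on n-tuples. *)
Fixpoint power_measure d (T : measurableType d) (R : realType)
    (m : {sigma_finite_measure set T -> \bar R}) (n : nat) :
    {sigma_finite_measure set (n.-tuple T) -> \bar R} :=
  if n is k.+1 then cons_measure m (power_measure m k)
  else dirac ([tuple] : 0.-tuple T).

Section Fock.
Context {R : realType} {n : nat}.

Local Notation C := R[i].
Local Notation Cn := 'rV[R[i]]_n.
Local Notation R2 := (measurableTypeR R * measurableTypeR R)%type.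

(* A point of C^n = (R^2)^n is given to the measure theory by its real
   coordinates: the j-th entry (x, y) stands for z_j = x + iy. *)
Definition of_coords (p : n.-tuple R2) : Cn :=
  \row_j ((tnth p j).1 +i* (tnth p j).2).

Definition lebC : {sigma_finite_measure set (n.-tuple R2) -> \bar R} :=
  power_measure (prod_measure (@lebesgue_measure R) (@lebesgue_measure R)) n.

(* Lebesgue (not only Borel) measurability: preimages of Borel sets belong to
   the completion of the product sigma-algebra with respect to lebC. *)
Definition lmeasurable (g : Cn -> C) : Prop :=
  forall Y : set (measurableTypeR R), measurable Y ->
    completed_algebra_gen lebC ((fun p => complex.Re (g (of_coords p))) @^-1` Y) /\
    completed_algebra_gen lebC ((fun p => complex.Im (g (of_coords p))) @^-1` Y).

Definition nnint (u : Cn -> R) : \bar R := (\int[lebC]_p (u (of_coords p))%:E)%E.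

Definition abs_integrable (h : Cn -> C) : Prop :=
  lmeasurable h /\ (nnint (fun z => normc (h z)) < +oo)%E.

(* Meaningful when abs_integrable h. *)
Definition cint (h : Cn -> C) : C :=
  (\int[lebC]_p complex.Re (h (of_coords p))) +i* (\int[lebC]_p complex.Im (h (of_coords p))).

Definition hdot (z w : Cn) : C := \sum_(j < n) z 0 j * conjc (w 0 j).

Definition sqnorm (z : Cn) : R := \sum_(j < n) normc (z 0 j) ^+ 2.

Definition cexp (z : C) : C :=
  (expR (complex.Re z) * cos (complex.Im z)) +i* (expR (complex.Re z) * sin (complex.Im z)).

(* The density of mu with respect to Lebesgue measure. *)
Definition gauss (z : Cn) : R := (2 * pi) ^- n * expR (- sqnorm z / 2).

Definition sqL2norm (f : Cn -> C) : \bar R :=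
  nnint (fun z => normc (f z) ^+ 2 * gauss z).

Definition L2 (f : Cn -> C) : Prop := lmeasurable f /\ (sqL2norm f < +oo)%E.

Definition L2inner (f h : Cn -> C) : C :=
  cint (fun z => f z * conjc (h z) * (gauss z)%:C).

Definition L2norm (f : Cn -> C) : R := Num.sqrt (fine (sqL2norm f)).

(* Frechet differentiability over the field R[i], i.e. holomorphy. *)
Definition entire (f : Cn -> C) : Prop :=
  forall z, differentiable (f : Cn -> C^o) z.

Definition fock (f : Cn -> C) : Prop := entire f /\ L2 f.

(* For h in L2, P h is the element u of F^2 such that h - u is orthogonal to
   F^2. *)
Definition fock_proj (h : Cn -> C) : Cn -> C :=
  xget (fun=> 0) [set u | fock u /\
    forall f, fock f -> L2inner (fun z => h z - u z) f = 0].

Definition kernel_fun (a z : Cn) : C :=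
  cexp (hdot z a / 2%:R - (sqnorm a / 4)%:C).

Definition admissible (g : Cn -> C) : Prop :=
  lmeasurable g /\ forall a, L2 (fun z => g z * kernel_fun a z).

Definition toeplitz_dom (g f : Cn -> C) : Prop :=
  fock f /\ L2 (fun z => g z * f z).

Definition toeplitz_op (g f : Cn -> C) : Cn -> C :=
  fock_proj (fun z => g z * f z).

(* Elements of F^2 are entire functions, so that equality of vectors is
   equality of functions; the values of A outside of F^2 are irrelevant. *)
Definition bounded_operator (A : (Cn -> C) -> (Cn -> C)) : Prop :=
  [/\ forall f, fock f -> fock (A f),
      forall (c : C) f h, fock f -> fock h ->
        A (fun z => c * f z + h z) = (fun z => c * A f z + A h z)
    & exists M : R, forall f, fock f -> L2norm (A f) <= M * L2norm f].

Definition bounded_extension (g : Cn -> C) (A : (Cn -> C) -> (Cn -> C)) : Prop :=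
  bounded_operator A /\ forall f, toeplitz_dom g f -> A f = toeplitz_op g f.

Definition toeplitz_bounded (g : Cn -> C) : Prop :=
  exists A, bounded_extension g A.

(* The bounded extension of the Toeplitz operator to F^2; on F^2 it is uniquely
   determined because the domain is dense for admissible g. *)
Definition toeplitz (g : Cn -> C) : (Cn -> C) -> (Cn -> C) :=
  xget (fun _ _ => 0) (bounded_extension g).

Definition opnorm (A : (Cn -> C) -> (Cn -> C)) : \bar R :=
  ereal_sup [set (L2norm (A f))%:E | f in [set f | fock f /\ L2norm f <= 1]].

Definition heat_integrand (t : R) (g : Cn -> C) (a w : Cn) : C :=
  g w * (expR (- sqnorm (w - a) / (4 * t)))%:C.

Definition heat_converges (t : R) (g : Cn -> C) (a : Cn) : Prop :=
  abs_integrable (heat_integrand t g a).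

Definition heat (t : R) (g : Cn -> C) (a : Cn) : C :=
  ((4 * pi * t) ^- n)%:C * cint (heat_integrand t g a).

Definition supnorm (h : Cn -> C) : \bar R :=
  ereal_sup (range (fun a => (normc (h a))%:E)).

End Fock.

Definition kappa (R : realType) (n : nat) (t : R) : R :=
  Num.max 1 ((4 * t - 1) ^- n).

(* Continuous, with continuous iterated partial derivatives up to order k. *)
Fixpoint Ck (R : realType) (m k : nat) (u : 'rV[R]_m -> R) : Prop :=
  continuous u /\
  if k is k'.+1 then
    forall j : 'I_m, (forall x, derivable u x (delta_mx 0 j)) /\
                     Ck k' (fun x => 'D_(delta_mx 0 j) u x)
  else True.

Definition smooth (R : realType) (m : nat) (u : 'rV[R]_m -> R) : Prop :=
  forall k, Ck k u.

Section test_functions.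
Context {R : realType} {n : nat}.

(* x + iy in C^n, for (x, y) in R^n x R^n = R^2n. *)
Definition of_real (q : 'rV[R]_(n + n)) : 'rV[R[i]]_n :=
  \row_j (lsubmx q 0 j +i* rsubmx q 0 j).

Definition Cc_smooth (g : 'rV[R[i]]_n -> R[i]) : Prop :=
  [/\ smooth (fun q => complex.Re (g (of_real q))),
      smooth (fun q => complex.Im (g (of_real q)))
    & compact (closure [set q | g (of_real q) != 0])].

End test_functions.

(* Main.v *)
(* Upper bound.  The matrix coefficients <g k_a, k_b> are bounded by ||T_g||.  For
   t <> 1/2 put e = sign(2t - 1) and s = 2t / |2t - 1|, so that 1/(2t) = 1 - e/s and
   s > 1.  With u = w - a and <u,b> = hdot u b, the reproducing property of the Gaussian
   weight gives
     e^(-|u|^2/4t) = (s/2pi)^n int_b e^(-|u|^2/2 + (<u,b> + e<b,u>)/2 - s|b|^2/2) db,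
   and up to a unimodular factor the integrand is
     e^(-(s-1)|b|^2/2) k_(a+b)(w) conj(k_(a+eb)(w)) times the density of mu.
   Hence g^(t)(a) is an average of matrix coefficients of T_g of total mass
   (s / (2t(s-1)))^n, which is 1 for t > 1/2 and (4t-1)^-n for t < 1/2; for t = 1/2 one
   has g^(t)(a) = <g k_a, k_a>.

   Sharpness.  If g = sum_k A_k e^(-(1/rho_k - 1)|w|^2/2) and a_k = A_k rho_k^n, then
   T_g f(z) = sum_k a_k f(rho_k z), which multiplies the m-homogeneous part of f by the
   moment sum_k a_k rho_k^m, and g^(t)(0) = sum_k a_k (2t - (2t-1) rho_k)^-n.  For
   t >= 1/2 a single rho close to 1 suffices.  For t < 1/2 one chooses the moments equal
   to (-1)^m for m < N and bounded by 1 afterwards, so that the power series of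
   (1 - x)^-n makes g^(t)(0) approach (4t-1)^-n as N grows.  A smooth cut-off changes
   such a g only by a small amount in sup norm. *)
From HB Require Import structures.
From mathcomp Require Import all_boot all_order all_algebra.
From mathcomp Require Import all_classical all_reals all_analysis.
From mathcomp Require Import measurable_realfun complex ring lra.
Require Import Defs.
Set Implicit Arguments.
Unset Strict Implicit.
Unset Printing Implicit Defensive.
Import Order.TTheory GRing.Theory Num.Theory.
Import numFieldNormedType.Exports.
Import ComplexField.Normc.
Local Open Scope classical_set_scope.
Local Open Scope ring_scope.
Local Open Scope complex_scope.

(** * The complex exponential *)

(** The upper bound is shaped by absolute convergence. Admissibility makes |g|^2 e^(-|w-a|^2/2)
    integrable for every a, so Cauchy-Schwarz alone just misses the weight e^(-|w-a|^2/4), the heat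
    kernel at t = 1; finitely many shifted centres pay for the missing factor. The condition t <= 1
    makes this weight dominate the heat kernel. It also dominates the double integral: for e = 1 the
    modulus of the integrand, integrated over b, costs e^(|u|^2/2s), and t <= 1 means 1/s <= 1/2.
    For t < 1/2 the condition s > 1 says exactly t > 1/4.

    In the sharpness part with t < 1/2 put q = (1-2t)/(2t). Expanding in powers of q gives g^(t)(0)
    = (2t)^-n sum_m c_m (-q)^m gamma_m, with c_m the Taylor coefficients of (1-x)^-n and gamma_m the
    moments. Under |gamma_m| <= 1 the supremum is at gamma_m = (-1)^m, which is the parity operator
    f(z) -> f(-z). That is the dilation by rho = -1, whose formal symbol is unbounded; hence finite
    combinations with rho in (0, 1) that imitate it on polynomials of low degree. *)

Section complex_basics.
Context {R : realType}.
Local Notation C := R[i].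
Implicit Types z w : C.

Lemma normr_normc z : `|z| = (normc z)%:C.
Proof. by []. Qed.

Lemma normc_ge0 z : 0 <= normc z.
Proof. by case: z => a b; exact: sqrtr_ge0. Qed.

Lemma normcD z w : normc (z + w) <= normc z + normc w.
Proof. exact: le_normcD. Qed.

Lemma normc_opp z : normc (- z) = normc z.
Proof. exact: normcN. Qed.

Lemma normcBC z w : normc (z - w) = normc (w - z).
Proof. by rewrite -normc_opp opprB. Qed.

Lemma normcR (x : R) : normc x%:C = `|x|.
Proof. by rewrite /normc /= expr0n addr0 sqrtr_sqr. Qed.

Lemma normc_conj z : normc (conjc z) = normc z.
Proof. by case: z => a b /=; rewrite sqrrN. Qed.

Lemma normc_sqr z : normc z ^+ 2 = complex.Re z ^+ 2 + complex.Im z ^+ 2.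
Proof. by case: z => a b /=; rewrite sqr_sqrtr // addr_ge0 ?sqr_ge0. Qed.

Lemma mul_conj z : z * conjc z = (normc z ^+ 2)%:C.
Proof.
rewrite normc_sqr; case: z => a b.
by apply/eqP; rewrite eq_complex /=; apply/andP; split; apply/eqP; ring.
Qed.

Lemma Re_le_normc z : `|complex.Re z| <= normc z.
Proof.
rewrite -(@ler_pXn2r _ 2) ?nnegrE ?normc_ge0 // normc_sqr real_normK ?num_real //.
by rewrite lerDl sqr_ge0.
Qed.

Lemma Im_le_normc z : `|complex.Im z| <= normc z.
Proof.
rewrite -(@ler_pXn2r _ 2) ?nnegrE ?normc_ge0 // normc_sqr real_normK ?num_real //.
by rewrite lerDr sqr_ge0.
Qed.

Lemma normc_le_ReIm z : normc z <= `|complex.Re z| + `|complex.Im z|.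
Proof.
rewrite -(@ler_pXn2r _ 2) ?nnegrE ?normc_ge0 ?addr_ge0 // normc_sqr sqrrD.
rewrite !real_normK ?num_real // -addrA lerD2l lerDr.
by rewrite mulrn_wge0 // mulr_ge0.
Qed.

Lemma normc_sum (I : Type) (r : seq I) (P : pred I) (F : I -> C) :
  normc (\sum_(i <- r | P i) F i) <= \sum_(i <- r | P i) normc (F i).
Proof.
elim/big_ind2 : _ => //; first by rewrite normc0.
by move=> x1 x2 y1 y2 h1 h2; apply: (le_trans (normcD _ _)); exact: lerD.
Qed.

Lemma normcX z m : normc (z ^+ m) = normc z ^+ m.
Proof. by elim: m => [|m IH]; rewrite ?expr0 ?normc1 // !exprS normcM IH. Qed.

Lemma ReD z w : complex.Re (z + w) = complex.Re z + complex.Re w.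
Proof. by case: z => a b; case: w. Qed.
Lemma ImD z w : complex.Im (z + w) = complex.Im z + complex.Im w.
Proof. by case: z => a b; case: w. Qed.
Lemma ReN z : complex.Re (- z) = - complex.Re z.
Proof. by case: z. Qed.
Lemma ImN z : complex.Im (- z) = - complex.Im z.
Proof. by case: z. Qed.
Lemma ReM z w : complex.Re (z * w) =
  complex.Re z * complex.Re w - complex.Im z * complex.Im w.
Proof. by case: z => a b; case: w. Qed.
Lemma ImM z w : complex.Im (z * w) =
  complex.Re z * complex.Im w + complex.Im z * complex.Re w.
Proof. by case: z => a b; case: w. Qed.
Lemma Re_sum (I : Type) (r : seq I) (P : pred I) (F : I -> C) :
  complex.Re (\sum_(i <- r | P i) F i) = \sum_(i <- r | P i) complex.Re (F i).
Proof. by elim/big_rec2 : _ => // i x y _ <-; rewrite ReD. Qed.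
Lemma complex_eq z w : complex.Re z = complex.Re w -> complex.Im z = complex.Im w ->
  z = w.
Proof. by case: z => a b; case: w => c d /= -> ->. Qed.

Lemma cexpD z w : cexp (z + w) = cexp z * cexp w.
Proof.
apply: complex_eq; rewrite /= ?ReM ?ImM /= ReD ImD expRD ?cosD ?sinD; ring.
Qed.

Lemma cexp0 : cexp 0 = 1 :> C.
Proof. by rewrite /cexp /= expR0 cos0 sin0 mulr1 mulr0. Qed.

Lemma normc_cexp z : normc (cexp z) = expR (complex.Re z).
Proof.
rewrite /cexp /normc !exprMn -mulrDr cos2Dsin2 mulr1 sqrtr_sqr.
by rewrite ger0_norm // expR_ge0.
Qed.

Lemma conj_cexp z : conjc (cexp z) = cexp (conjc z).
Proof. by case: z => a b; rewrite /cexp /= cosN sinN mulrN. Qed.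

Lemma cexpR (x : R) : cexp x%:C = (expR x)%:C.
Proof. by rewrite /cexp /= cos0 sin0 mulr1 mulr0. Qed.

Lemma RcM (x y : R) : (x * y)%:C = x%:C * y%:C.
Proof. by rewrite rmorphM. Qed.

Lemma normc_eq0 z : (normc z == 0) = (z == 0).
Proof.
by apply/eqP/eqP => [/eq0_normc //|->]; rewrite normc0.
Qed.

Lemma normc_gt0 z : (0 < normc z) = (z != 0).
Proof. by rewrite lt_def normc_ge0 andbT normc_eq0. Qed.

Lemma exists_unit_rotation z : exists2 u : C, normc u = 1 & u * z = (normc z)%:C.
Proof.
have [->|z0] := eqVneq z 0; first by exists 1; rewrite ?normc1 // normc0 mulr0.
have nz : normc z != 0 by rewrite normc_eq0.
exists (conjc z * ((normc z)^-1)%:C).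
  by rewrite normcM normc_conj normcR ger0_norm ?invr_ge0 ?normc_ge0 // divff.
by rewrite mulrAC (mulrC (conjc z)) mul_conj -RcM expr2 mulfK.
Qed.

(** Brings a bound on a complex number down to real parts, to which the real mean value theorem
    applies. *)
Lemma normc_le_rotations z (B : R) :
  (forall u : C, normc u = 1 -> complex.Re (u * z) <= B) -> normc z <= B.
Proof. by move=> h; have [u u1 uz] := exists_unit_rotation z; have := h u u1; rewrite uz. Qed.

Lemma ReZl (x : R) z : complex.Re (x%:C * z) = x * complex.Re z.
Proof. by rewrite ReM /= mul0r subr0. Qed.
Lemma ImZl (x : R) z : complex.Im (x%:C * z) = x * complex.Im z.
Proof. by rewrite ImM /= mul0r addr0. Qed.

Definition cexp_sum (M : nat) z : C := \sum_(m < M) z ^+ m * ((m`!%:R)^-1)%:C.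

Lemma is_derive_Re_cexp (w z : C) (t : R) :
  is_derive t 1 (fun s : R => complex.Re (w * cexp (s%:C * z)))
    (complex.Re (w * z * cexp (t%:C * z))).
Proof.
pose a := complex.Re z; pose b := complex.Im z.
rewrite (_ : (fun s : R => _) = (fun s : R =>
  complex.Re w * (expR (s * a) * cos (s * b)) -
  complex.Im w * (expR (s * a) * sin (s * b)))); last first.
  by apply/funext => s; rewrite ReM /= ReZl ImZl.
apply: is_derive_eq.
rewrite ReM ReM ImM /= ReZl ImZl -/a -/b.
by rewrite /GRing.scale /= !mulr0 !add0r !mulr1; ring.
Qed.

Lemma Re_cexp_sum (w z : C) M (s : R) : complex.Re (w * cexp_sum M (s%:C * z)) =
  \sum_(m < M) complex.Re (w * z ^+ m) * ((m`!%:R)^-1 * s ^+ m).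
Proof.
rewrite /cexp_sum mulr_sumr Re_sum; apply: eq_bigr => m _.
rewrite exprMn -rmorphXn /= (_ : w * _ = (s ^+ m / m`!%:R)%:C * (w * z ^+ m)).
  by rewrite ReZl mulrC; congr (_ * _); rewrite mulrC.
by rewrite RcM; ring.
Qed.

Lemma is_derive_monomial (c : R) M (t : R) :
  is_derive t (1 : R) (fun s : R => c * ((M.+1`!%:R)^-1 * s ^+ M.+1))
    (c * ((M`!%:R)^-1 * t ^+ M)).
Proof.
rewrite (_ : (fun s : R => _) = (c * (M.+1`!%:R)^-1) *: ((id : R -> R) ^+ M.+1)); last first.
  by apply/funext => s; rewrite mulrA !fctE.
apply: is_derive_eq; rewrite /GRing.scale /= mulr1.
have f0 : (M`!%:R : R) != 0 by rewrite pnatr_eq0 -lt0n fact_gt0.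
by rewrite factS natrM; field; rewrite f0 -(natrD _ 1 M) pnatr_eq0.
Qed.

Lemma ReB z w : complex.Re (z - w) = complex.Re z - complex.Re w.
Proof. by rewrite ReD ReN. Qed.
Lemma ImB z w : complex.Im (z - w) = complex.Im z - complex.Im w.
Proof. by rewrite ImD ImN. Qed.

Lemma is_derive_Re_cexp_sum (w z : C) M (t : R) :
  is_derive t 1 (fun s : R => complex.Re (w * cexp_sum M.+1 (s%:C * z)))
    (complex.Re (w * z * cexp_sum M (t%:C * z))).
Proof.
rewrite (_ : (fun s : R => _) = (fun s => \sum_(m < M.+1)
   complex.Re (w * z ^+ m) * ((m`!%:R)^-1 * s ^+ m))); last first.
  by apply/funext => s; rewrite Re_cexp_sum.
rewrite Re_cexp_sum; elim: M => [|M IH].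
  rewrite big_ord0 (_ : (fun s : R => _) = cst (complex.Re w)).
    exact: is_derive_cst.
  by apply/funext => s; rewrite big_ord1 /= !expr0 !mulr1 fact0 invr1 mulr1.
rewrite big_ord_recr /= (_ : (fun s : R => _) =
  (fun s => \sum_(m < M.+1) complex.Re (w * z ^+ m) * ((m`!%:R)^-1 * s ^+ m))
  + (fun s => complex.Re (w * z ^+ M.+1) * ((M.+1`!%:R)^-1 * s ^+ M.+1))); last first.
  by apply/funext => s; rewrite big_ord_recr.
rewrite -(mulrA w z) -exprS.
by apply: is_deriveD; exact: is_derive_monomial.
Qed.

(** Induction along the segment from 0 to z: the t-derivative of the remainder after M + 1 terms is
    z times the remainder after M terms. *)
Lemma cexp_remainder_aux (z : C) M (t : R) : 0 <= t <= 1 ->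
  normc (cexp (t%:C * z) - cexp_sum M (t%:C * z)) <=
  expR (normc z) * ((M`!%:R)^-1 * (normc z ^+ M * t ^+ M)).
Proof.
elim: M t => [|M IH] t /andP[t0 t1].
  rewrite /cexp_sum big_ord0 subr0 normc_cexp !expr0 fact0 invr1 !mulr1 ler_expR ReZl.
  rewrite (le_trans (ler_norm _)) // normrM ger0_norm //.
  by rewrite (le_trans _ (Re_le_normc z)) // ler_piMl.
apply: normc_le_rotations => u u1.
(* The bound minus the real part of the rotated remainder: it vanishes at 0, and the induction
   hypothesis makes its derivative nonnegative on [0, 1]. *)
pose phi (s : R) := expR (normc z) * ((M.+1`!%:R)^-1 * (normc z ^+ M.+1 * s ^+ M.+1))
  - (complex.Re (u * cexp (s%:C * z)) - complex.Re (u * cexp_sum M.+1 (s%:C * z))).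
pose dphi (s : R) := expR (normc z) * ((M`!%:R)^-1 * (normc z ^+ M.+1 * s ^+ M))
  - (complex.Re (u * z * cexp (s%:C * z)) - complex.Re (u * z * cexp_sum M (s%:C * z))).
have dphiE (s : R) : is_derive s (1 : R) phi (dphi s).
  have h1 := is_derive_Re_cexp u z s; have h2 := is_derive_Re_cexp_sum u z M s.
  have h3 := is_derive_monomial (expR (normc z) * normc z ^+ M.+1) M s.
  rewrite /phi /dphi.
  rewrite (_ : (fun s => _) =
    (fun s => expR (normc z) * normc z ^+ M.+1 * ((M.+1`!%:R)^-1 * s ^+ M.+1)) -
    ((fun s => complex.Re (u * cexp (s%:C * z))) -
     (fun s => complex.Re (u * cexp_sum M.+1 (s%:C * z))))).
    have h4 := is_deriveB h3 (is_deriveB h1 h2).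
    by apply: (is_derive_eq h4); congr (_ - _); ring.
  by apply/funext => r /=; congr (_ - _); ring.
have phi0 : phi 0 = 0.
  rewrite /phi expr0n /= !mulr0 !mul0r cexp0 sub0r (_ : cexp_sum _ _ = 1) ?subrr ?oppr0 //.
  rewrite /cexp_sum big_ord_recl expr0 fact0 invr1 mul1r big1 ?addr0 // => i _.
  by rewrite expr0n /= mul0r.
have dphi_ge0 s : 0 <= s <= 1 -> 0 <= dphi s.
  move=> /IH h; rewrite /dphi subr_ge0 -ReB -mulrBr (le_trans (ler_norm _)) //.
  rewrite (le_trans (Re_le_normc _)) // !normcM u1 mul1r exprS.
  rewrite (le_trans (ler_wpM2l (normc_ge0 z) h)) // le_eqVlt; apply/orP; left.
  by apply/eqP; ring.
have : 0 <= phi t.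
  have [|c cin] := MVT_segment t0 (f := phi) (df := dphi).
    by apply: derivable_within_continuous => x _; have [] := dphiE x.
  rewrite phi0 !subr0 => ->; rewrite mulr_ge0 // dphi_ge0 //.
  move: cin; rewrite in_itv /= => /andP[-> /le_trans]; exact.
by rewrite subr_ge0 -ReB -mulrBr.
Qed.

Lemma cexp_remainder (z : C) M :
  normc (cexp z - cexp_sum M z) <= expR (normc z) * ((M`!%:R)^-1 * normc z ^+ M).
Proof.
have := @cexp_remainder_aux z M 1; rewrite !mul1r expr1n mulr1; apply.
by rewrite ler01 lexx.
Qed.

(** The second-order estimate behind every differentiability proof for exponentials below: [cexp]
    itself, exponentials of linear forms, and the reproducing kernel in its parameter. *)
Lemma cexp_remainder2 (z : C) :
  normc (cexp z - 1 - z) <= expR (normc z) * normc z ^+ 2.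
Proof.
have := cexp_remainder z 2; rewrite /cexp_sum big_ord_recr big_ord1 /= !expr0 expr1.
rewrite fact0 invr1 !mulr1 opprD addrA => /le_trans; apply.
rewrite ler_wpM2l ?expR_ge0 // ler_piMl ?exprn_ge0 ?normc_ge0 //.
by rewrite invf_le1 // ler1n.
Qed.

End complex_basics.

Arguments normc {R} x : simpl never.
Arguments cexp {R} z : simpl never.

(** * Cauchy theorem on rectangles and the circle mean value *)

Section segment_integral.
Context {R : realType}.
Local Notation C := R[i].
Local Notation mu := (@lebesgue_measure R).
Implicit Types (phi psi : R -> C) (a b c : R).

Definition ccont phi :=
  continuous (fun t => complex.Re (phi t)) /\ continuous (fun t => complex.Im (phi t)).

Definition cint_seg a b phi : C :=
  (\int[mu]_(t in `[a, b]) complex.Re (phi t)) +i*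
  (\int[mu]_(t in `[a, b]) complex.Im (phi t)).

Lemma continuous_integrable_itv (f : R -> R) a b : continuous f ->
  mu.-integrable `[a, b] (EFin \o f).
Proof.
move=> cf; apply: continuous_compact_integrable; first exact: segment_compact.
exact: continuous_subspaceT.
Qed.

Lemma cint_seg_split phi a b c : ccont phi -> a <= c <= b ->
  cint_seg a b phi = cint_seg a c phi + cint_seg c b phi.
Proof.
move=> [cr ci] /andP[ac cb].
have key (f : R -> R) : continuous f -> \int[mu]_(t in `[a, b]) f t =
    \int[mu]_(t in `[a, c]) f t + \int[mu]_(t in `[c, b]) f t.
  move=> cf; have := @Rintegral_itvB R f (BLeft a) (BRight b) c
    (continuous_integrable_itv _ _ cf).
  rewrite !bnd_simp => /(_ ac cb) /eqP; rewrite subr_eq addrC => /eqP ->.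
  rewrite Rintegral_itv_obnd_cbnd //.
  apply: (@integrableS _ _ _ mu `[c, b]) => //; last exact: continuous_integrable_itv.
  by apply: subset_itvr; rewrite bnd_simp.
by apply: complex_eq => /=; rewrite key.
Qed.

Lemma cint_segD phi psi a b : ccont phi -> ccont psi ->
  cint_seg a b (fun t => phi t + psi t) = cint_seg a b phi + cint_seg a b psi.
Proof.
move=> [h1 h2] [h3 h4]; apply: complex_eq => /=; rewrite -RintegralD //;
  try exact: continuous_integrable_itv.
- by apply: eq_Rintegral => t _; rewrite ReD.
- by apply: eq_Rintegral => t _; rewrite ImD.
Qed.

Lemma ccont_cst (c0 : C) : ccont (fun=> c0).
Proof. by split => t; exact: cvg_cst. Qed.

Lemma ccontD phi psi : ccont phi -> ccont psi -> ccont (fun t => phi t + psi t).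
Proof.
move=> [h1 h2] [h3 h4]; split => t.
- rewrite (_ : (fun t => _) = (fun t => complex.Re (phi t)) \+ (fun t => complex.Re (psi t))).
    by apply: cvgD; [exact: h1|exact: h3].
  by apply/funext => s /=; rewrite ReD.
- rewrite (_ : (fun t => _) = (fun t => complex.Im (phi t)) \+ (fun t => complex.Im (psi t))).
    by apply: cvgD; [exact: h2|exact: h4].
  by apply/funext => s /=; rewrite ImD.
Qed.

Lemma ccontN phi : ccont phi -> ccont (fun t => - phi t).
Proof.
move=> [h1 h2]; split => t.
- rewrite (_ : (fun t => _) = \- (fun t => complex.Re (phi t))).
    by apply: cvgN; exact: h1.
  by apply/funext => s /=; rewrite ReN.
- rewrite (_ : (fun t => _) = \- (fun t => complex.Im (phi t))).
    by apply: cvgN; exact: h2.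
  by apply/funext => s /=; rewrite ImN.
Qed.

Lemma ccontB phi psi : ccont phi -> ccont psi -> ccont (fun t => phi t - psi t).
Proof. by move=> h1 h2; apply: ccontD => //; exact: ccontN. Qed.

Lemma cint_seg_cst a b (c0 : C) : a <= b -> cint_seg a b (fun=> c0) = (b - a)%:C * c0.
Proof.
move=> ab; have mI : fine (mu `[a, b]) = b - a.
  by rewrite lebesgue_measure_itv /= lte_fin; case: ltgtP ab => // -> _; rewrite subrr.
by apply: complex_eq; rewrite ?ReZl ?ImZl /= Rintegral_cst // mI mulrC.
Qed.

(** Real and imaginary parts are estimated separately, whence the factor 2; the applications only
    let B tend to 0. *)
Lemma cint_seg_le phi a b (B : R) : ccont phi -> a <= b ->
  (forall t, a <= t <= b -> normc (phi t) <= B) ->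
  normc (cint_seg a b phi) <= 2 * (B * (b - a)).
Proof.
move=> [cr ci] ab hB.
have key (f : R -> R) : continuous f -> (forall t, a <= t <= b -> `|f t| <= B) ->
    `|\int[mu]_(t in `[a, b]) f t| <= B * (b - a).
  move=> cf fB; rewrite (le_trans (le_normr_Rintegral _ _)) //.
    exact: continuous_integrable_itv.
  rewrite (@le_trans _ _ (\int[mu]_(t in `[a, b]) B)) //.
    apply: le_Rintegral => //.
    - apply: (continuous_integrable_itv a b (f := fun t => `|f t|)) => t.
      by apply: cvg_norm; exact: cf.
    - by apply: (continuous_integrable_itv a b (f := cst B)) => t; exact: cvg_cst.
  rewrite Rintegral_cst //= lebesgue_measure_itv /= lte_fin.
  by case: ltgtP ab => // ->; rewrite subrr.
rewrite (le_trans (normc_le_ReIm _)) //= mulr_natl mulr2n lerD //.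
- by apply: key => // t /hB; apply: le_trans; exact: Re_le_normc.
- by apply: key => // t /hB; apply: le_trans; exact: Im_le_normc.
Qed.

Lemma eq_cint_seg phi psi a b : (forall t, a <= t <= b -> phi t = psi t) ->
  cint_seg a b phi = cint_seg a b psi.
Proof.
move=> h; apply: complex_eq => /=; apply: eq_Rintegral => t;
  by rewrite inE /= in_itv /= => /h ->.
Qed.

Lemma cint_segN phi a b : ccont phi -> cint_seg a b (fun t => - phi t) = - cint_seg a b phi.
Proof.
move=> cp; apply/eqP; rewrite -addr_eq0 -cint_segD //; last exact: ccontN.
apply/eqP; rewrite (_ : (fun t => _) = (fun=> 0)); last first.
  by apply/funext => t; rewrite addNr.
by apply: complex_eq; rewrite /= /Rintegral integral0.
Qed.

Lemma cint_segB phi psi a b : ccont phi -> ccont psi ->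
  cint_seg a b (fun t => phi t - psi t) = cint_seg a b phi - cint_seg a b psi.
Proof. by move=> h1 h2; rewrite cint_segD ?cint_segN //; exact: ccontN. Qed.

End segment_integral.

(** * Goursat's theorem for rectangles, by bisection *)

Section goursat.
Context {R : realType}.
Local Notation C := R[i].
Implicit Types (G : C -> C) (p z : C) (x y h k : R).

(** Stated with [normc], so that epsilon and delta are real numbers; the norm of the normed module
    R[i] takes its values in R[i]. *)
Definition cdiff_at G p := exists beta : C, forall e : R, 0 < e ->
  exists2 d : R, 0 < d & forall z, normc (z - p) < d ->
    normc (G z - G p - beta * (z - p)) <= e * normc (z - p).

Lemma cdiff_at_cont G p : cdiff_at G p -> forall e : R, 0 < e ->
  exists2 d : R, 0 < d & forall z, normc (z - p) < d -> normc (G z - G p) < e.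
Proof.
move=> [beta hb] e e0; have [d d0 hd] := hb 1 ltr01.
pose B := 1 + normc beta; have B0 : 0 < B by rewrite ltr_pwDl // normc_ge0.
exists (Num.min d (e / B)); first by rewrite lt_min d0 divr_gt0.
move=> z; rewrite lt_min => /andP[zd ze].
have -> : G z - G p = (G z - G p - beta * (z - p)) + beta * (z - p) by rewrite subrK.
apply: (le_lt_trans (normcD _ _)); rewrite normcM.
apply: (@le_lt_trans _ _ (B * normc (z - p))).
  by rewrite mulrDl lerD2r; exact: hd.
by rewrite mulrC -ltr_pdivlMr.
Qed.

Variable G : C -> C.
Hypothesis Gdiff : forall p, cdiff_at G p.

Lemma ccont_path (gam : R -> C) : (forall s t, normc (gam s - gam t) <= `|s - t|) ->
  ccont (fun t => G (gam t)).
Proof.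
move=> hg.
have key (t e : R) : 0 < e -> \forall s \near t, normc (G (gam s) - G (gam t)) < e.
  move=> e0; have [d d0 hd] := cdiff_at_cont (Gdiff (gam t)) e0.
  near=> s; apply: hd; apply: (le_lt_trans (hg s t)).
  rewrite distrC; near: s; exact: nbhsx_ballx.
split => t; apply/cvgrPdist_lt => e e0; near=> s;
  rewrite distrC -?ReB -?ImB.
- by rewrite (le_lt_trans (Re_le_normc _)) //; near: s; exact: key.
- by rewrite (le_lt_trans (Im_le_normc _)) //; near: s; exact: key.
Unshelve. all: by end_near. Qed.

Lemma ccont_horizontal y : ccont (fun t => G (t +i* y)).
Proof.
apply: ccont_path => s t; rewrite (_ : _ - _ = (s - t)%:C) ?normcR //.
by apply: complex_eq; rewrite /= ?subrr.
Qed.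

Lemma ccont_vertical x : ccont (fun t => G (x +i* t)).
Proof.
apply: ccont_path => s t; rewrite (_ : _ - _ = 0 +i* (s - t)).
  by rewrite /normc expr0n add0r sqrtr_sqr.
by apply: complex_eq; rewrite /= ?subrr.
Qed.

(** The counterclockwise integral of G along the boundary of [x, x + h] x [y, y + k], with opposite
    sides paired. *)
Definition rect_int x y h k : C :=
  cint_seg x (x + h) (fun t => G (t +i* y) - G (t +i* (y + k))) +
  'i * cint_seg y (y + k) (fun t => G ((x + h) +i* t) - G (x +i* t)).

Lemma rect_intDl x y h k : 0 <= h ->
  rect_int x y (h + h) k = rect_int x y h k + rect_int (x + h) y h k.
Proof.
move=> h0; rewrite /rect_int.
have c1 := ccont_horizontal; have c2 := ccont_vertical.
rewrite (@cint_seg_split _ _ x _ (x + h)); last 2 first.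
- exact: ccontB.
- by rewrite lerDl h0 /= lerD2l lerDl.
rewrite !cint_segB // !addrA; ring.
Qed.

Lemma rect_intDr x y h k : 0 <= k ->
  rect_int x y h (k + k) = rect_int x y h k + rect_int x (y + k) h k.
Proof.
move=> h0; rewrite /rect_int.
have c1 := ccont_horizontal; have c2 := ccont_vertical.
rewrite (@cint_seg_split _ _ y _ (y + k)); last 2 first.
- exact: ccontB.
- by rewrite lerDl h0 /= lerD2l lerDl.
rewrite !cint_segB // !addrA; ring.
Qed.

Lemma rect_int_quarters x y h k : 0 <= h -> 0 <= k ->
  rect_int x y (h + h) (k + k) =
    rect_int x y h k + rect_int (x + h) y h k +
    (rect_int x (y + k) h k + rect_int (x + h) (y + k) h k).
Proof. by move=> h0 k0; rewrite rect_intDr // !rect_intDl. Qed.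

Lemma rect_int_small x y h k (p beta : C) (e : R) : 0 <= h -> 0 <= k -> 0 <= e ->
  (forall z, x <= complex.Re z <= x + h -> y <= complex.Im z <= y + k ->
    normc (G z - G p - beta * (z - p)) <= e) ->
  normc (rect_int x y h k) <= 4 * e * (h + k).
Proof.
move=> h0 k0 e0 He.
have c1 := ccont_horizontal; have c2 := ccont_vertical.
(* Affine functions have boundary integral zero: the two inserted constants contribute i h k beta
   and - i h k beta. They turn each pair of opposite sides into a difference of deviations from the
   affine approximation at p. *)
have -> : rect_int x y h k =
  cint_seg x (x + h) (fun t => G (t +i* y) - G (t +i* (y + k)) + beta * (0 +i* k)) +
  'i * cint_seg y (y + k) (fun t => G ((x + h) +i* t) - G (x +i* t) - beta * h%:C).
  rewrite /rect_int (@cint_segD _ (fun t => G (t +i* y) - G (t +i* (y + k))));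
    [|exact: ccontB|exact: ccont_cst].
  rewrite (@cint_segB _ (fun t => G ((x + h) +i* t) - G (x +i* t)));
    [|exact: ccontB|exact: ccont_cst].
  rewrite !cint_seg_cst ?lerDl // (addrC x) (addrC y) !addrK.
  have -> : (0 +i* k : C) = 'i * k%:C.
    by apply: complex_eq => /=; ring.
  ring.
have xh : x <= x + h by rewrite lerDl.
have yk : y <= y + k by rewrite lerDl.
apply: (le_trans (normcD _ _)).
have -> : 4 * e * (h + k) = 2 * (2 * e * (x + h - x)) + 2 * (2 * e * (y + k - y)) by ring.
apply: lerD.
  apply: cint_seg_le => //.
    by apply: ccontD; [exact: ccontB|exact: ccont_cst].
  move=> t ht; rewrite (_ : _ + _ = (G (t +i* y) - G p - beta * ((t +i* y) - p)) -
     (G (t +i* (y + k)) - G p - beta * ((t +i* (y + k)) - p))); last first.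
    have -> : (0 +i* k : C) = (t +i* (y + k)) - (t +i* y).
      by apply: complex_eq; rewrite /= ?subrr // addrAC subrr add0r.
    ring.
  apply: (le_trans (normcD _ _)); rewrite normc_opp mulr_natl mulr2n.
  by apply: lerD; apply: He => //=; rewrite lexx yk.
rewrite normcM (_ : normc 'i = 1) ?mul1r; last first.
  by rewrite /normc expr0n expr1n add0r sqrtr1.
apply: cint_seg_le => //.
  by apply: ccontB; [exact: ccontB|exact: ccont_cst].
move=> t ht; rewrite (_ : _ - _ = (G ((x + h) +i* t) - G p - beta * (((x + h) +i* t) - p)) -
   (G (x +i* t) - G p - beta * ((x +i* t) - p))); last first.
  have -> : (h%:C : C) = ((x + h) +i* t) - (x +i* t).
    by apply: complex_eq; rewrite /= ?subrr // addrAC subrr add0r.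
  ring.
apply: (le_trans (normcD _ _)); rewrite normc_opp mulr_natl mulr2n.
by apply: lerD; apply: He => //=; rewrite lexx xh.
Qed.

Section bisection.
Variables (x0 y0 h k eta : R).
Hypotheses (h0 : 0 <= h) (k0 : 0 <= k).

Let sc m : R := 2 ^- m.
Let bad m (q : R * R) := eta * sc m ^+ 2 <= normc (rect_int q.1 q.2 (h * sc m) (k * sc m)).

Let scS m : sc m = sc m.+1 + sc m.+1.
Proof.
rewrite /sc exprS invfM -mulrDl; have : (2 : R) != 0 by rewrite pnatr_eq0.
by move=> ?; rewrite -{1}(mul1r (_ ^- m)); congr (_ * _); field.
Qed.

Let sc_ge0 m : 0 <= sc m.
Proof. by rewrite /sc invr_ge0 exprn_ge0. Qed.

Let quarter m (q : R * R) (b : bool * bool) : R * R :=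
  (q.1 + (h * sc m.+1) *+ b.1, q.2 + (k * sc m.+1) *+ b.2).

Let bad_quarter m q : bad m q -> exists b, bad m.+1 (quarter m q b).
Proof.
apply: contraPP => /forallNP nb.
have nb' b : normc (rect_int (quarter m q b).1 (quarter m q b).2 (h * sc m.+1) (k * sc m.+1))
    < eta * sc m.+1 ^+ 2 by rewrite ltNge; apply/negP/nb.
apply/negP; rewrite -ltNge scS !mulrDr rect_int_quarters ?mulr_ge0 //.
have := nb' (false, false); have := nb' (true, false).
have := nb' (false, true); have := nb' (true, true).
rewrite /quarter /= !mulr0n !mulr1n !addr0 => b1 b2 b3 b4.
apply: (le_lt_trans (normcD _ _)).
apply: (le_lt_trans (lerD (normcD _ _) (normcD _ _))).
have -> : eta * (sc m.+1 + sc m.+1) ^+ 2 = (eta * sc m.+1 ^+ 2 + eta * sc m.+1 ^+ 2) +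
   (eta * sc m.+1 ^+ 2 + eta * sc m.+1 ^+ 2) by ring.
exact: ltrD (ltrD _ _) (ltrD _ _).
Qed.

Let next m q : R * R := quarter m q (xget (false, false) [set b | bad m.+1 (quarter m q b)]).

Let sq := fix sq m : R * R := if m is m'.+1 then next m' (sq m') else (x0, y0).

(** The four quarters sum to the whole, so a rectangle whose integral is at least its share eta 4^-m
    has a quarter with the same property. The nested rectangles chosen this way have a common point
    p. *)
Lemma rect_int_bisection : bad 0 (x0, y0) ->
  exists p : C, forall m : nat, exists xy : R * R,
   [/\ xy.1 <= complex.Re p <= xy.1 + h * 2 ^- m,
       xy.2 <= complex.Im p <= xy.2 + k * 2 ^- m &
       eta * (2 ^- m) ^+ 2 <= normc (rect_int xy.1 xy.2 (h * 2 ^- m) (k * 2 ^- m))].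
Proof.
move=> b0.
have badsq m : bad m (sq m).
  elim: m => // m IH; rewrite /= /next.
  by have [b hb] := bad_quarter IH; case: xgetP => [b' _ //|/(_ b)].
(* One coordinate at a time: the lower ends increase and the upper ends decrease, so the supremum of
   the lower ends lies in all the intervals. *)
have key (w : R) (u : nat -> R) : 0 <= w ->
    (forall m, exists b : bool, u m.+1 = u m + (w * sc m.+1) *+ b) ->
    exists l, forall m, u m <= l <= u m + w * sc m.
  move=> w0 hu.
  have ws m : 0 <= w * sc m by rewrite mulr_ge0.
  have uS m : u m <= u m.+1 by have [b ->] := hu m; rewrite lerDl mulrn_wge0.
  have nd : nondecreasing_seq u by apply/nondecreasing_seqP.
  have vS m : u m.+1 + w * sc m.+1 <= u m + w * sc m.
    have [b ->] := hu m; rewrite -addrA lerD2l (scS m) mulrDr lerD2r.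
    by case: b; rewrite /= ?mulr1n ?mulr0n.
  have ub m m' : u m' <= u m + w * sc m.
    have [mm|/ltnW mm] := leqP m m'.
      rewrite (@le_trans _ _ (u m' + w * sc m')) ?lerDl //.
      elim: m' mm => [|m' IH]; first by rewrite leqn0 => /eqP ->.
      rewrite leq_eqVlt ltnS => /orP[/eqP -> //|/IH]; exact: le_trans.
    by rewrite (@le_trans _ _ (u m)) ?lerDl //; exact: nd.
  have hub (m : nat) : has_ubound (range u) by exists (u m + w * sc m); move=> _ [m' _ <-].
  exists (sup (range u)) => m; apply/andP; split.
    by apply: ub_le_sup; [exact: (hub 0)|exists m].
  by apply: ge_sup; [exists (u 0); exists 0|move=> _ [m' _ <-]].
have [|l1 hl1] := key h (fun m => (sq m).1) h0; first by move=> m; eexists; reflexivity.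
have [|l2 hl2] := key k (fun m => (sq m).2) k0; first by move=> m; eexists; reflexivity.
exists (l1 +i* l2) => m; exists (sq m); split; [exact: hl1|exact: hl2|exact: badsq].
Qed.

End bisection.

Theorem rect_int_eq0 x y h k : 0 <= h -> 0 <= k -> rect_int x y h k = 0.
Proof.
move=> h0 k0; apply/eqP; apply: contraT => nz.
pose eta := normc (rect_int x y h k).
have eta0 : 0 < eta by rewrite normc_gt0.
have [|p hp] := @rect_int_bisection x y h k eta h0 k0.
  by rewrite /= !expr0 invr1 expr1n !mulr1.
have [beta hb] := Gdiff p.
(* L is positive even for a degenerate rectangle. With tolerance eta / (8 L^2), [rect_int_small]
   bounds the m-th integral by eta s^2 (h + k) / (2 L) for s = 2^-m, strictly less than its share
   eta s^2. *)
pose L := h + k + 1.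
have L0 : 0 < L by rewrite ltr_wpDl ?addr_ge0.
have e0 : 0 < eta / (8 * L ^+ 2) by rewrite divr_gt0 // mulr_gt0 // exprn_gt0.
have [d d0 hd] := hb _ e0.
have [m hm] : exists m : nat, L * 2 ^- m < d.
  have dL : 0 < d / L by rewrite divr_gt0.
  have [m _ hm] := near_infty_natSinv_expn_lt (PosNum dL).
  exists m; have := hm m (leqnn m); rewrite /= ltr_pdivlMr // mulrC.
  by rewrite mul1r => /(le_lt_trans _); apply.
have [[x' y'] [/= hx hy]] := hp m.
set s : R := 2 ^- m in hx hy hm *.
have s0 : 0 < s by rewrite /s invr_gt0 exprn_gt0.
have hk : (h + k) * s <= L * s by rewrite ler_pM2r // lerDl.
rewrite leNgt => /negP; case.
apply: (@le_lt_trans _ _ (4 * (eta / (8 * L ^+ 2) * (L * s)) * (h * s + k * s))).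
  apply: (@rect_int_small _ _ _ _ p beta).
  - exact: mulr_ge0 h0 (ltW s0).
  - exact: mulr_ge0 k0 (ltW s0).
  - exact: mulr_ge0 (ltW e0) (mulr_ge0 (ltW L0) (ltW s0)).
  move=> z hzx hzy.
  have zp : normc (z - p) <= L * s.
    rewrite (le_trans (normc_le_ReIm _)) // (le_trans _ hk) // ReB ImB mulrDl.
    apply: lerD; rewrite ler_norml; apply/andP; lra.
  apply: (le_trans (hd _ _)); first exact: le_lt_trans hm.
  by rewrite ler_pM2l.
rewrite -mulrDl (_ : 4 * _ * _ = eta * s ^+ 2 * ((h + k) / (2 * L))); last first.
  by field; rewrite lt0r_neq0.
rewrite gtr_pMr ?mulr_gt0 ?exprn_gt0 // ltr_pdivrMr ?mul1r ?mulr_gt0 //.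
rewrite /L; lra.
Qed.

End goursat.

(** * The mean value property on the unit circle *)

Section circle_mean.
Context {R : realType}.
Local Notation C := R[i].
Implicit Types (F c : C -> C) (p z : C).

Lemma cdiff_at_comp F c p : cdiff_at c p -> cdiff_at F (c p) ->
  cdiff_at (fun z => F (c z)) p.
Proof.
move=> cp [beta Fp]; have [gam cpg] := cp.
exists (beta * gam) => e e0.
pose e1 := e / (2 * (normc gam + 1)); pose e2 := Num.min 1 (e / (2 * (normc beta + 1))).
have g0 : 0 < normc gam + 1 by rewrite ltr_wpDl // normc_ge0.
have b0 : 0 < normc beta + 1 by rewrite ltr_wpDl // normc_ge0.
have e10 : 0 < e1 by rewrite divr_gt0 // mulr_gt0.
have e20 : 0 < e2 by rewrite lt_min ltr01 divr_gt0 // mulr_gt0.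
have [d1 d10 h1] := Fp _ e10.
have [d2 d20 h2] := cpg _ e20.
have [d3 d30 h3] := cdiff_at_cont cp d10.
exists (Num.min d2 d3); first by rewrite lt_min d20.
move=> z; rewrite lt_min => /andP[z2 z3].
have {}h2 := h2 z z2; have {}h1 := h1 (c z) (h3 z z3).
set n := normc (z - p) in h2 *.
have n0 : 0 <= n by exact: normc_ge0.
have hcz : normc (c z - c p) <= (normc gam + 1) * n.
  rewrite (_ : c z - c p = (c z - c p - gam * (z - p)) + gam * (z - p)); last by rewrite subrK.
  rewrite (le_trans (normcD _ _)) // normcM addrC mulrDl lerD2l (le_trans h2) //.
  by rewrite ler_wpM2r // ge_min lexx.
rewrite (_ : _ - _ = (F (c z) - F (c p) - beta * (c z - c p)) +
   beta * (c z - c p - gam * (z - p))); last by ring.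
rewrite (le_trans (normcD _ _)) // normcM.
have -> : e * n = e1 * ((normc gam + 1) * n) + (normc beta + 1) * (e / (2 * (normc beta + 1)) * n).
  by rewrite /e1; field; rewrite !lt0r_neq0.
apply: lerD; first by rewrite (le_trans h1) // ler_pM2l.
apply: ler_pM; rewrite ?normc_ge0 ?lerDl // (le_trans h2) // ler_wpM2r //.
by rewrite ge_min lexx orbT.
Qed.

Lemma cdiff_at_cexp p : cdiff_at cexp p.
Proof.
exists (cexp p) => e e0.
pose B := normc (cexp p) * expR 1 + 1.
have B0 : 0 < B by rewrite ltr_wpDl // mulr_ge0 ?normc_ge0 ?expR_ge0.
exists (Num.min 1 (e / B)); first by rewrite lt_min ltr01 divr_gt0.
move=> z; rewrite lt_min => /andP[z1 ze].
rewrite (_ : _ - _ = cexp p * (cexp (z - p) - 1 - (z - p))); last first.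
  have hz : cexp z = cexp (z - p) * cexp p by rewrite -cexpD subrK.
  by rewrite hz; ring.
rewrite normcM (le_trans (ler_wpM2l (normc_ge0 _) (cexp_remainder2 _))) //.
set n := normc (z - p) in z1 ze *.
have n0 : 0 <= n by exact: normc_ge0.
rewrite expr2 !mulrA ler_wpM2r //.
rewrite (@le_trans _ _ (B * n)) //; last by rewrite mulrC -ler_pdivlMr // ltW.
rewrite ler_wpM2r // (@le_trans _ _ (normc (cexp p) * expR 1)) ?lerDl //.
by rewrite ler_wpM2l ?normc_ge0 // ler_expR ltW.
Qed.

Lemma cexp_period (x y : R) : cexp (x +i* (y + 2 * pi)) = cexp (x +i* y).
Proof. by rewrite /cexp /= mulr_natl cosD2pi sinD2pi. Qed.

(** The exponential turns circles into vertical segments: F (cexp z) has period 2 pi i, so the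
    horizontal sides of a rectangle of height 2 pi cancel and the integral over a vertical side does
    not depend on its abscissa. As the abscissa goes to minus infinity, the circle shrinks to 0. *)
Theorem circle_mean F : (forall p, cdiff_at F p) ->
  cint_seg 0 (2 * pi) (fun t => F (cexp (0 +i* t))) = (2 * pi)%:C * F 0.
Proof.
move=> Fd; pose G z := F (cexp z).
have Gd p : cdiff_at G p by apply: cdiff_at_comp => //; exact: cdiff_at_cexp.
have pi2 : 0 <= 2 * pi :> R by rewrite mulr_ge0 // pi_ge0.
have cv := ccont_vertical Gd.
have i0 : ('i : C) != 0 by rewrite eq_complex /= oner_eq0 andbF.
have shift_line a : a <= 0 -> cint_seg 0 (2 * pi) (fun t => G (0 +i* t)) =
    cint_seg 0 (2 * pi) (fun t => G (a +i* t)).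
  move=> a0; have := @rect_int_eq0 _ G Gd a 0 (- a) (2 * pi).
  rewrite oppr_ge0 => /(_ a0 pi2); rewrite /rect_int subrr !add0r.
  rewrite (@eq_cint_seg _ _ (fun=> 0)); last first.
    by move=> t _; have := cexp_period t 0; rewrite /G add0r => ->; rewrite subrr.
  rewrite (cint_seg_cst _ a0) mulr0 add0r (cint_segB _ _ (cv 0) (cv a)).
  by move=> /eqP; rewrite mulf_eq0 (negbTE i0) /= subr_eq0 => /eqP.
apply/eqP; rewrite -subr_eq0 -normc_eq0 eq_le normc_ge0 andbT; apply/ler_addgt0Pl => e e0.
rewrite addr0.
pose e1 := e / (2 * (2 * pi)).
have e10 : 0 < e1 by rewrite divr_gt0 // !mulr_gt0 ?pi_gt0.
have [d d0 hd] := cdiff_at_cont (Fd 0) e10.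
(* The circle of radius e^a lies in the disc of radius d around 0, where F is within e1 of F 0. *)
pose a := Num.min 0 (ln d - 1).
rewrite (shift_line a); last by rewrite ge_min lexx.
rewrite -[X in _%:C * F X]/0 (_ : (2 * pi)%:C * F 0 = cint_seg 0 (2 * pi) (fun=> F 0)).
  rewrite -cint_segB //; last exact: ccont_cst.
  rewrite (le_trans (cint_seg_le (B := e1) _ pi2 _)) //.
  - by apply: ccontB => //; exact: ccont_cst.
  - move=> t _; rewrite ltW // hd // subr0 normc_cexp /=.
    rewrite (@le_lt_trans _ _ (expR (ln d - 1))) //.
      by rewrite ler_expR ge_min lexx orbT.
    by rewrite -{2}(lnK (x := d)) ?posrE // ltr_expR ltrBlDr ltrDl.
  - by rewrite subr0 mulrCA /e1 divfK // lt0r_neq0 // !mulr_gt0 ?pi_gt0.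
by rewrite cint_seg_cst // subr0.
Qed.

End circle_mean.

(** * Complex-valued integrals *)

Section complex_measurable.
Context d (T : measurableType d) {R : realType}.
Local Notation C := R[i].
Implicit Types (F G : T -> C).

Definition cmeas F := measurable_fun setT (fun x => complex.Re (F x)) /\
  measurable_fun setT (fun x => complex.Im (F x)).

Lemma cmeas_cst (c : C) : cmeas (fun=> c).
Proof. by split; exact: measurable_cst. Qed.

Lemma cmeasD F G : cmeas F -> cmeas G -> cmeas (fun x => F x + G x).
Proof.
move=> [h1 h2] [h3 h4]; split.
- by under eq_fun do rewrite ReD; exact: measurable_funD.
- by under eq_fun do rewrite ImD; exact: measurable_funD.
Qed.

Lemma cmeasN F : cmeas F -> cmeas (fun x => - F x).
Proof.
move=> [h1 h2]; split.
- by under eq_fun do rewrite ReN; exact: measurableT_comp.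
- by under eq_fun do rewrite ImN; exact: measurableT_comp.
Qed.

Lemma cmeasB F G : cmeas F -> cmeas G -> cmeas (fun x => F x - G x).
Proof. by move=> h1 h2; apply: cmeasD => //; exact: cmeasN. Qed.

Lemma cmeasM F G : cmeas F -> cmeas G -> cmeas (fun x => F x * G x).
Proof.
move=> [h1 h2] [h3 h4]; split.
- under eq_fun do rewrite ReM.
  by apply: measurable_funB; exact: measurable_funM.
- under eq_fun do rewrite ImM.
  by apply: measurable_funD; exact: measurable_funM.
Qed.

Lemma cmeasX F m : cmeas F -> cmeas (fun x => F x ^+ m).
Proof.
move=> h; elim: m => [|m IH]; first by under eq_fun do rewrite expr0; exact: cmeas_cst.
by under eq_fun do rewrite exprS; exact: cmeasM.
Qed.

Lemma cmeas_conj F : cmeas F -> cmeas (fun x => conjc (F x)).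
Proof.
move=> [h1 h2]; split.
- by rewrite (_ : (fun x => _) = fun x => complex.Re (F x)) //; apply/funext => x; case: (F x).
- rewrite (_ : (fun x => _) = fun x => - complex.Im (F x)); last first.
    by apply/funext => x; case: (F x).
  exact: measurableT_comp.
Qed.

Lemma cmeasR (u : T -> R) : measurable_fun setT u -> cmeas (fun x => (u x)%:C).
Proof. by move=> h; split => //; exact: measurable_cst. Qed.

Lemma cmeas_sum (I : Type) (r : seq I) (P : pred I) (F : I -> T -> C) :
  (forall i, cmeas (F i)) -> cmeas (fun x => \sum_(i <- r | P i) F i x).
Proof.
move=> h; elim: r => [|i r IH].
  by under eq_fun do rewrite big_nil; exact: cmeas_cst.
under eq_fun do rewrite big_cons; case: (P i) => //; exact: cmeasD.
Qed.

Lemma cmeas_cexp F : cmeas F -> cmeas (fun x => cexp (F x)).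
Proof.
move=> [h1 h2]; split; rewrite /cexp /=; apply: measurable_funM.
- exact: measurableT_comp.
- by apply: measurableT_comp => //; apply: continuous_measurable_fun; exact: continuous_cos.
- exact: measurableT_comp.
- by apply: measurableT_comp => //; apply: continuous_measurable_fun; exact: continuous_sin.
Qed.

Lemma measurable_normc F : cmeas F -> measurable_fun setT (fun x => normc (F x)).
Proof.
move=> [h1 h2].
rewrite (_ : (fun x => _) = fun x => Num.sqrt (complex.Re (F x) ^+ 2 + complex.Im (F x) ^+ 2)).
  apply: (@measurableT_comp _ _ _ _ _ _ (@Num.sqrt R)).
    by apply: continuous_measurable_fun; exact: sqrt_continuous.
  by apply: measurable_funD; exact: measurable_funX.
by apply/funext => x; rewrite -normc_sqr sqrtr_sqr ger0_norm ?normc_ge0.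
Qed.

Lemma cmeas_lim (F : nat -> T -> C) (G : T -> C) : (forall m, cmeas (F m)) ->
  (forall x, (fun m => complex.Re (F m x)) @ \oo --> complex.Re (G x)) ->
  (forall x, (fun m => complex.Im (F m x)) @ \oo --> complex.Im (G x)) ->
  cmeas G.
Proof.
move=> h hr hi; split.
- apply: (measurable_fun_cvg (h := fun m x => complex.Re (F m x))).
    by move=> m; have [] := h m.
  by move=> x _; exact: hr.
- apply: (measurable_fun_cvg (h := fun m x => complex.Im (F m x))).
    by move=> m; have [] := h m.
  by move=> x _; exact: hi.
Qed.

End complex_measurable.

Lemma cmeas_comp d d' (T : measurableType d) (T' : measurableType d') (R : realType)
    (phi : T -> T') (F : T' -> R[i]) :
  measurable_fun setT phi -> cmeas F -> cmeas (fun x => F (phi x)).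
Proof. by move=> mphi [h1 h2]; split; [exact: (measurableT_comp h1)|exact: (measurableT_comp h2)]. Qed.

Section complex_integral.
Context d (T : measurableType d) {R : realType} (m : {measure set T -> \bar R}).
Local Notation C := R[i].
Implicit Types (F G : T -> C) (u v : T -> R).

Definition cintegral F : C :=
  (\int[m]_x complex.Re (F x)) +i* (\int[m]_x complex.Im (F x)).

Definition fint u := (\int[m]_x (u x)%:E)%E.

Definition cintegrable F := cmeas F /\ (fint (fun x => normc (F x)) < +oo)%E.

Lemma fint_ge0 u : (forall x, 0 <= u x) -> (0 <= fint u)%E.
Proof. by move=> h; apply: integral_ge0 => x _; rewrite lee_fin. Qed.

Lemma le_fint u v : measurable_fun setT u -> measurable_fun setT v ->
  (forall x, 0 <= u x) -> (forall x, u x <= v x) -> (fint u <= fint v)%E.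
Proof.
move=> mu mv u0 uv; apply: ge0_le_integral => //.
- by move=> x _; rewrite lee_fin.
- exact/measurable_EFinP.
- exact/measurable_EFinP.
- by move=> x _; rewrite lee_fin.
Qed.

Lemma fintZl u (c : R) : measurable_fun setT u -> (forall x, 0 <= u x) -> 0 <= c ->
  fint (fun x => c * u x) = (c%:E * fint u)%E.
Proof.
move=> mu u0 c0; rewrite /fint -ge0_integralZl_EFin //.
- by move=> x _; rewrite lee_fin.
- exact/measurable_EFinP.
Qed.

Lemma fintD u v : measurable_fun setT u -> measurable_fun setT v ->
  (forall x, 0 <= u x) -> (forall x, 0 <= v x) ->
  fint (fun x => u x + v x) = (fint u + fint v)%E.
Proof.
move=> mu mv u0 v0; rewrite /fint -ge0_integralD //.
- by move=> x _; rewrite lee_fin.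
- exact/measurable_EFinP.
- by move=> x _; rewrite lee_fin.
- exact/measurable_EFinP.
Qed.

Lemma cintegrable_dom F v : cmeas F -> measurable_fun setT v ->
  (forall x, normc (F x) <= v x) -> (fint v < +oo)%E -> cintegrable F.
Proof.
move=> mF mv Fv voo; split => //; apply: le_lt_trans voo.
by apply: le_fint => //; [exact: measurable_normc|move=> x; exact: normc_ge0].
Qed.

Lemma cintegrable_Re F : cintegrable F -> m.-integrable setT (EFin \o (fun x => complex.Re (F x))).
Proof.
move=> [mF Foo]; apply/integrableP; split; first by apply/measurable_EFinP; have [] := mF.
apply: le_lt_trans Foo; apply: ge0_le_integral => //.
- by apply/measurable_EFinP/measurableT_comp => //; have [] := mF.
- exact/measurable_EFinP/measurable_normc.
- by move=> x _; rewrite lee_fin Re_le_normc.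
Qed.

Lemma cintegrable_Im F : cintegrable F -> m.-integrable setT (EFin \o (fun x => complex.Im (F x))).
Proof.
move=> [mF Foo]; apply/integrableP; split; first by apply/measurable_EFinP; have [] := mF.
apply: le_lt_trans Foo; apply: ge0_le_integral => //.
- by apply/measurable_EFinP/measurableT_comp => //; have [] := mF.
- exact/measurable_EFinP/measurable_normc.
- by move=> x _; rewrite lee_fin Im_le_normc.
Qed.

Lemma eq_cintegral F G : (forall x, F x = G x) -> cintegral F = cintegral G.
Proof. by move=> /funext ->. Qed.

Lemma cintegrableD F G : cintegrable F -> cintegrable G -> cintegrable (fun x => F x + G x).
Proof.
move=> [mF F1] [mG G1].
apply: (@cintegrable_dom _ (fun x => normc (F x) + normc (G x))).
- exact: cmeasD.
- by apply: measurable_funD; exact: measurable_normc.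
- by move=> x; exact: normcD.
- rewrite fintD; try exact: measurable_normc; try (by move=> x; exact: normc_ge0).
  exact: lte_add_pinfty.
Qed.

Lemma cintegrableZl F (c : C) : cintegrable F -> cintegrable (fun x => c * F x).
Proof.
move=> [mF F1]; split; first by apply: cmeasM => //; exact: cmeas_cst.
under eq_fun do rewrite normcM.
rewrite fintZl ?normc_ge0 //; last first.
- by move=> x; exact: normc_ge0.
- exact: measurable_normc.
by rewrite lte_mul_pinfty // lee_fin normc_ge0.
Qed.

Lemma cintegralD F G : cintegrable F -> cintegrable G ->
  cintegral (fun x => F x + G x) = cintegral F + cintegral G.
Proof.
move=> iF iG; apply: complex_eq => /=; rewrite -RintegralD //;
  try exact: cintegrable_Re; try exact: cintegrable_Im.
- by apply: eq_Rintegral => t _; rewrite ReD.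
- by apply: eq_Rintegral => t _; rewrite ImD.
Qed.

Lemma cintegralZl F (c : C) : cintegrable F ->
  cintegral (fun x => c * F x) = c * cintegral F.
Proof.
move=> iF; have ir := cintegrable_Re iF; have ii := cintegrable_Im iF.
have ir' k : m.-integrable setT (EFin \o (fun x => k * complex.Re (F x))).
  rewrite (_ : _ \o _ = (fun x => k%:E * (complex.Re (F x))%:E)%E); last by apply/funext.
  exact: integrableZl.
have ii' k : m.-integrable setT (EFin \o (fun x => k * complex.Im (F x))).
  rewrite (_ : _ \o _ = (fun x => k%:E * (complex.Im (F x))%:E)%E); last by apply/funext.
  exact: integrableZl.
apply: complex_eq; rewrite ?ReM ?ImM /= -!RintegralZl //.
- by rewrite -RintegralB //; apply: eq_Rintegral => t _; rewrite ReM.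
- by rewrite -RintegralD //; apply: eq_Rintegral => t _; rewrite ImM.
Qed.

Lemma cintegrableN F : cintegrable F -> cintegrable (fun x => - F x).
Proof. by move=> /(cintegrableZl (-1)); under eq_fun do rewrite mulN1r. Qed.

Lemma cintegralN F : cintegrable F -> cintegral (fun x => - F x) = - cintegral F.
Proof.
by move=> /(cintegralZl (-1)); rewrite mulN1r => <-; apply: eq_cintegral => x; rewrite mulN1r.
Qed.

Lemma cintegrableB F G : cintegrable F -> cintegrable G -> cintegrable (fun x => F x - G x).
Proof. by move=> h1 h2; apply: cintegrableD => //; exact: cintegrableN. Qed.

Lemma cintegralB F G : cintegrable F -> cintegrable G ->
  cintegral (fun x => F x - G x) = cintegral F - cintegral G.
Proof. by move=> h1 h2; rewrite cintegralD ?cintegralN //; exact: cintegrableN. Qed.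

Lemma cintegral0 : cintegral (fun=> 0) = 0.
Proof. by apply: complex_eq; rewrite /= /Rintegral integral0. Qed.

Lemma cintegrable0 : cintegrable (fun=> 0).
Proof.
split; first exact: cmeas_cst.
by rewrite /fint normc0 integral0.
Qed.

Lemma cintegrable_sum (I : Type) (r : seq I) (F : I -> T -> C) :
  (forall i, cintegrable (F i)) -> cintegrable (fun x => \sum_(i <- r) F i x).
Proof.
move=> h; elim: r => [|i r IH].
  by under eq_fun do rewrite big_nil; exact: cintegrable0.
by under eq_fun do rewrite big_cons; exact: cintegrableD.
Qed.

Lemma cintegral_sum (I : Type) (r : seq I) (F : I -> T -> C) :
  (forall i, cintegrable (F i)) ->
  cintegral (fun x => \sum_(i <- r) F i x) = \sum_(i <- r) cintegral (F i).
Proof.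
move=> h; elim: r => [|i r IH].
  transitivity (cintegral (fun=> 0)); last by rewrite cintegral0 big_nil.
  by apply: eq_cintegral => x; rewrite big_nil.
rewrite big_cons -IH -cintegralD //; last exact: cintegrable_sum.
by apply: eq_cintegral => x; rewrite big_cons.
Qed.

Lemma cintegral_conj F : cintegrable F ->
  cintegral (fun x => conjc (F x)) = conjc (cintegral F).
Proof.
move=> iF; apply: complex_eq => /=.
  by apply: eq_Rintegral => x _; case: (F x).
have := RintegralZl (-1) measurableT (cintegrable_Im iF); rewrite mulN1r => <-.
by apply: eq_Rintegral => x _; rewrite mulN1r; case: (F x).
Qed.

(** A unit factor makes the integral real and nonnegative; then only the real part of the rotated
    integrand counts. *)
Lemma normc_cintegral_le F : cintegrable F ->
  ((normc (cintegral F))%:E <= fint (fun x => normc (F x)))%E.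
Proof.
move=> iF; have [u u1 hu] := exists_unit_rotation (cintegral F).
have iuF := cintegrableZl u iF.
have -> : normc (cintegral F) = complex.Re (cintegral (fun x => u * F x)).
  by rewrite cintegralZl // hu.
rewrite /= /Rintegral fineK; last first.
  by apply: integrable_fin_num => //; exact: (cintegrable_Re iuF).
rewrite (le_trans (lee_abs _)) // (le_trans (le_abse_integral _ _ _)) //.
  by apply/measurable_EFinP; have [[]] := iuF.
apply: ge0_le_integral => //.
- by apply/measurable_EFinP/measurableT_comp => //; have [[]] := iuF.
- by apply/measurable_EFinP/measurable_normc; have [] := iF.
- by move=> x _; rewrite lee_fin (le_trans (Re_le_normc _)) // normcM u1 mul1r.
Qed.

Lemma normc_cintegral_bound F (B : R) : cintegrable F ->
  (fint (fun x => normc (F x)) <= B%:E)%E -> normc (cintegral F) <= B.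
Proof. by move=> iF FB; rewrite -lee_fin (le_trans (normc_cintegral_le iF)). Qed.

Lemma cintegralR (u : T -> R) : (forall x, 0 <= u x) ->
  cintegral (fun x => (u x)%:C) = (fine (fint u))%:C.
Proof. by move=> u0; apply: complex_eq => //=; rewrite /Rintegral integral0. Qed.

End complex_integral.

(** * Fubini's theorem for complex-valued functions *)

Section complex_fubini.
Context d1 d2 (T1 : measurableType d1) (T2 : measurableType d2) (R : realType).
Variables (m1 : {sigma_finite_measure set T1 -> \bar R})
          (m2 : {sigma_finite_measure set T2 -> \bar R}).
Local Notation C := R[i].
Variable F : T1 * T2 -> C.
Hypothesis mF : cmeas F.
Hypothesis F12 : (\int[m1]_x fint m2 (fun y => normc (F (x, y))) < +oo)%E.
Hypothesis F2 : forall x, cintegrable m2 (fun y => F (x, y)).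
Hypothesis F1 : forall y, cintegrable m1 (fun x => F (x, y)).

Let Re_integrable : (m1 \x m2)%E.-integrable setT (EFin \o (fun p => complex.Re (F p))).
Proof.
apply/integrable12ltyP; first by apply/measurable_EFinP; have [] := mF.
apply: le_lt_trans F12; apply: ge0_le_integral => //.
- by move=> x _; apply: integral_ge0.
- apply: (measurable_fun_fubini_tonelli_F (fun p => `|complex.Re (F p)|%:E)) => //.
  by apply/measurable_EFinP/measurableT_comp => //; have [] := mF.
- apply: (measurable_fun_fubini_tonelli_F (fun p => (normc (F p))%:E)).
    exact/measurable_EFinP/measurable_normc.
  by move=> p; rewrite lee_fin normc_ge0.
- move=> x _; apply: ge0_le_integral => //.
  + by apply/measurable_EFinP/measurableT_comp => //; have [[]] := F2 x.
  + by apply/measurable_EFinP/measurable_normc; have [] := F2 x.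
  + by move=> y _; rewrite lee_fin Re_le_normc.
Qed.

Let Im_integrable : (m1 \x m2)%E.-integrable setT (EFin \o (fun p => complex.Im (F p))).
Proof.
apply/integrable12ltyP; first by apply/measurable_EFinP; have [] := mF.
apply: le_lt_trans F12; apply: ge0_le_integral => //.
- by move=> x _; apply: integral_ge0.
- apply: (measurable_fun_fubini_tonelli_F (fun p => `|complex.Im (F p)|%:E)) => //.
  by apply/measurable_EFinP/measurableT_comp => //; have [] := mF.
- apply: (measurable_fun_fubini_tonelli_F (fun p => (normc (F p))%:E)).
    exact/measurable_EFinP/measurable_normc.
  by move=> p; rewrite lee_fin normc_ge0.
- move=> x _; apply: ge0_le_integral => //.
  + by apply/measurable_EFinP/measurableT_comp => //; have [[]] := F2 x.
  + by apply/measurable_EFinP/measurable_normc; have [] := F2 x.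
  + by move=> y _; rewrite lee_fin Im_le_normc.
Qed.

Let fubini_real (f : T1 * T2 -> R) :
  (m1 \x m2)%E.-integrable setT (EFin \o f) ->
  (forall x, m2.-integrable setT (EFin \o (fun y => f (x, y)))) ->
  (forall y, m1.-integrable setT (EFin \o (fun x => f (x, y)))) ->
  \int[m1]_x (\int[m2]_y f (x, y)) = \int[m2]_y (\int[m1]_x f (x, y)).
Proof.
move=> fi i2 i1; have := Fubini fi; rewrite /Rintegral => fub; congr fine.
transitivity (\int[m1]_x \int[m2]_y (f (x, y))%:E)%E.
  by apply: eq_integral => x _; rewrite fineK //; exact: integrable_fin_num (i2 x).
rewrite [LHS]fub; apply: eq_integral => y _; rewrite fineK //.
exact: integrable_fin_num (i1 y).
Qed.

(** Every section, not just almost every one, is integrable. The inner integrals are therefore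
    finite everywhere, and passing from extended to real values inside them loses nothing. *)
Lemma cfubini : cintegral m1 (fun x => cintegral m2 (fun y => F (x, y))) =
  cintegral m2 (fun y => cintegral m1 (fun x => F (x, y))).
Proof.
apply: complex_eq => /=.
- apply: (@fubini_real (fun p => complex.Re (F p))) => //.
  + by move=> x; exact: cintegrable_Re (F2 x).
  + by move=> y; exact: cintegrable_Re (F1 y).
- apply: (@fubini_real (fun p => complex.Im (F p))) => //.
  + by move=> x; exact: cintegrable_Im (F2 x).
  + by move=> y; exact: cintegrable_Im (F1 y).
Qed.

Lemma cintegrable_fubini : cintegrable m1 (fun x => cintegral m2 (fun y => F (x, y))).
Proof.
have key (f : T1 * T2 -> R) : (m1 \x m2)%E.-integrable setT (EFin \o f) ->
  (forall x, m2.-integrable setT (EFin \o (fun y => f (x, y)))) ->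
  measurable_fun setT (fun x => \int[m2]_y f (x, y)).
  move=> fi i2; apply/measurable_EFinP.
  rewrite (_ : _ \o _ = fun x => (\int[m2]_y (f (x, y))%:E)%E).
    exact: (measurable_fubini_F fi).
  apply/funext => x /=; rewrite fineK //; exact: integrable_fin_num (i2 x).
have mc : cmeas (fun x => cintegral m2 (fun y => F (x, y))).
  split => /=.
  - apply: (key (fun p => complex.Re (F p))) => // x; exact: cintegrable_Re (F2 x).
  - apply: (key (fun p => complex.Im (F p))) => // x; exact: cintegrable_Im (F2 x).
split => //; apply: le_lt_trans F12; apply: ge0_le_integral => //.
- by move=> x _; rewrite lee_fin normc_ge0.
- exact/measurable_EFinP/measurable_normc.
- apply: (measurable_fun_fubini_tonelli_F (fun p => (normc (F p))%:E)).
    exact/measurable_EFinP/measurable_normc.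
  by move=> p; rewrite lee_fin normc_ge0.
- by move=> x _; exact: normc_cintegral_le (F2 x).
Qed.

End complex_fubini.

(** * Measure-preserving maps of products *)

Section measure_preserving.
Context {R : realType}.
Local Notation C := R[i].

(** Expressed through integrals of nonnegative functions instead of measures of sets: in this form
    it composes directly and passes to products by Tonelli. *)
Definition mpreserving d (T : measurableType d) (m : {measure set T -> \bar R})
    (phi : T -> T) :=
  measurable_fun setT phi /\ forall u : T -> \bar R, measurable_fun setT u ->
    (forall x, 0 <= u x)%E -> (\int[m]_x u (phi x) = \int[m]_x u x)%E.

Section basics.
Context d (T : measurableType d) (m : {measure set T -> \bar R}).

Lemma mpreserving_comp (phi psi : T -> T) :
  mpreserving m phi -> mpreserving m psi -> mpreserving m (psi \o phi).
Proof.
move=> [m1 h1] [m2 h2]; split; first exact: measurableT_comp.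
move=> u mu u0; rewrite -[RHS]h2 // -[RHS]h1 //.
by apply: measurableT_comp.
Qed.

Lemma mpreserving_fint phi (u : T -> R) : mpreserving m phi -> measurable_fun setT u ->
  (forall x, 0 <= u x) -> fint m (fun x => u (phi x)) = fint m u.
Proof.
move=> [_ h] mu u0; apply: (h (EFin \o u)); first exact/measurable_EFinP.
by move=> x; rewrite lee_fin.
Qed.

Lemma mpreserving_cintegral phi (F : T -> C) : mpreserving m phi -> cmeas F ->
  cintegral m (fun x => F (phi x)) = cintegral m F.
Proof.
move=> [mphi h] [mr mi].
have key (f : T -> R) : measurable_fun setT f -> \int[m]_x f (phi x) = \int[m]_x f x.
  move=> mf; rewrite /Rintegral; congr fine.
  change (\int[m]_x ((EFin \o f) \o phi) x = \int[m]_x (EFin \o f) x)%E.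
  rewrite integralE [RHS]integralE (funepos_comp (EFin \o f)) (funeneg_comp (EFin \o f)).
  congr (_ - _)%E.
  - by apply: h => //; apply: measurable_funepos; exact/measurable_EFinP.
  - by apply: h => //; apply: measurable_funeneg; exact/measurable_EFinP.
by apply: complex_eq; [exact: (key (fun x => complex.Re (F x)))|
  exact: (key (fun x => complex.Im (F x)))].
Qed.

Lemma mpreserving_cintegrable phi (F : T -> C) : mpreserving m phi -> cintegrable m F ->
  cintegrable m (fun x => F (phi x)).
Proof.
move=> hphi [mF F1]; have [mphi _] := hphi; split; first exact: cmeas_comp.
rewrite (@mpreserving_fint phi (fun x => normc (F x))) //; first exact: measurable_normc.
by move=> x; exact: normc_ge0.
Qed.

End basics.

Section product.
Context d1 d2 (T1 : measurableType d1) (T2 : measurableType d2).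
Variables (m1 : {sigma_finite_measure set T1 -> \bar R})
          (m2 : {sigma_finite_measure set T2 -> \bar R}).

Lemma integral_prod_measure1 (u : T1 * T2 -> \bar R) : measurable_fun setT u ->
  (forall p, 0 <= u p)%E ->
  (\int[prod_measure m1 m2]_p u p = \int[m1]_x \int[m2]_y u (x, y))%E.
Proof. by move=> mu u0; rewrite -(fubini_tonelli1 u). Qed.

Lemma integral_prod_measure2 (u : T1 * T2 -> \bar R) : measurable_fun setT u ->
  (forall p, 0 <= u p)%E ->
  (\int[prod_measure m1 m2]_p u p = \int[m2]_y \int[m1]_x u (x, y))%E.
Proof. by move=> mu u0; rewrite -(fubini_tonelli2 u). Qed.

(** By Tonelli, integrate the moved coordinate first with the other one frozen. Shears of the plane
    are the intended case. *)
Lemma mpreserving_skew1 (phi : T1 -> T2 -> T1) :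
  measurable_fun setT (fun p => phi p.1 p.2) -> (forall y, mpreserving m1 (phi^~ y)) ->
  mpreserving (prod_measure m1 m2) (fun p => (phi p.1 p.2, p.2)).
Proof.
move=> mphi h.
have mp : measurable_fun setT (fun p : T1 * T2 => (phi p.1 p.2, p.2)).
  by apply: measurable_fun_pair.
split => // u mu u0; rewrite integral_prod_measure2; [|exact: measurableT_comp|by move=> p].
rewrite [RHS]integral_prod_measure2; [|exact: mu|exact: u0].
apply: eq_integral => y _ /=; have [_ hy] := h y.
by rewrite (hy (fun x => u (x, y))) //; exact: measurable_fun_pair1.
Qed.

Lemma mpreserving_skew2 (phi : T1 -> T2 -> T2) :
  measurable_fun setT (fun p => phi p.1 p.2) -> (forall x, mpreserving m2 (phi x)) ->
  mpreserving (prod_measure m1 m2) (fun p => (p.1, phi p.1 p.2)).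
Proof.
move=> mphi h.
have mp : measurable_fun setT (fun p : T1 * T2 => (p.1, phi p.1 p.2)).
  by apply: measurable_fun_pair.
split => // u mu u0; rewrite integral_prod_measure1; [|exact: measurableT_comp|by move=> p].
rewrite [RHS]integral_prod_measure1; [|exact: mu|exact: u0].
apply: eq_integral => x _ /=; have [_ hx] := h x.
by rewrite (hx (fun y => u (x, y))) //; exact: measurable_fun_pair2.
Qed.

Lemma mpreserving_prod (phi : T1 -> T1) (psi : T2 -> T2) :
  mpreserving m1 phi -> mpreserving m2 psi ->
  mpreserving (prod_measure m1 m2) (fun p => (phi p.1, psi p.2)).
Proof.
move=> h1 h2; have [mphi _] := h1; have [mpsi _] := h2.
apply: (@mpreserving_comp _ _ _ (fun p => (p.1, psi p.2)) (fun p => (phi p.1, p.2))).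
- by apply: (@mpreserving_skew2 (fun _ => psi)) => //; exact: measurableT_comp.
- by apply: (@mpreserving_skew1 (fun x _ => phi x)) => //; exact: measurableT_comp.
Qed.

End product.

Section cons.
Context d (T : measurableType d) (n : nat).
Variables (m1 : {sigma_finite_measure set T -> \bar R})
          (m2 : {sigma_finite_measure set (n.-tuple T) -> \bar R}).

Lemma integral_cons_measure (u : n.+1.-tuple T -> \bar R) : measurable_fun setT u ->
  (forall p, 0 <= u p)%E ->
  (\int[cons_measure m1 m2]_p u p = \int[prod_measure m1 m2]_p u (tuple_cons p))%E.
Proof.
move=> mu u0; rewrite /cons_measure.
have := ge0_integral_pushforward (@measurable_tuple_cons _ T n) (prod_measure m1 m2)
   measurableT mu; rewrite preimage_setT; apply.
by move=> y _; exact: u0.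
Qed.

End cons.

Definition coordmap (T : Type) n (phi : 'I_n -> T -> T) (p : n.-tuple T) : n.-tuple T :=
  [tuple phi i (tnth p i) | i < n].

Lemma mpreserving_coordmap d (T : measurableType d) (m : {sigma_finite_measure set T -> \bar R})
    n (phi : 'I_n -> T -> T) : (forall i, mpreserving m (phi i)) ->
  mpreserving (power_measure m n) (coordmap phi).
Proof.
elim: n phi => [|n IH] phi h.
  have -> : coordmap phi = id by apply/funext => p; rewrite (tuple0 p) (tuple0 (coordmap _ _)).
  by split => //; exact: measurable_id.
have mc : measurable_fun setT (coordmap phi).
  apply/measurable_fun_tnthP => i /=; rewrite (_ : _ \o _ = phi i \o (tnth (T := T))^~ i).
    by apply: measurableT_comp; [have [] := h i|exact: measurable_tnth].
  by apply/funext => p /=; rewrite tnth_mktuple.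
split => // u mu u0 /=; rewrite !integral_cons_measure //; last exact: measurableT_comp.
have hp := mpreserving_prod (h ord0) (IH (fun i => phi (lift ord0 i)) (fun i => h _)).
rewrite -[RHS](hp.2 (fun p => u (tuple_cons p))) //; last first.
  by apply: measurableT_comp => //; exact: measurable_tuple_cons.
apply: eq_integral => -[x s] _; congr u.
apply: eq_from_tnth => i; rewrite tnth_mktuple /=.
case: (unliftP ord0 i) => [j ->|->]; rewrite /tuple_cons /= ?tnth0 // !tnthS.
by rewrite tnth_mktuple.
Qed.

Lemma integral_power_measure_prod d (T : measurableType d)
    (m : {sigma_finite_measure set T -> \bar R}) n (u : 'I_n -> T -> R) (c : 'I_n -> R) :
  (forall i, measurable_fun setT (u i)) -> (forall i x, 0 <= u i x) ->
  (forall i, fint m (u i) = (c i)%:E) ->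
  fint (power_measure m n) (fun p => \prod_(i < n) u i (tnth p i)) = (\prod_(i < n) c i)%:E.
Proof.
have mprod k (v : 'I_k -> T -> R) : (forall i, measurable_fun setT (v i)) ->
    measurable_fun setT (fun p : k.-tuple T => \prod_(i < k) v i (tnth p i)).
  move=> mv; apply: measurable_prod => i _.
  by apply: measurableT_comp => //; exact: measurable_tnth.
have prod0 k (v : 'I_k -> T -> R) : (forall i x, 0 <= v i x) ->
    forall p : k.-tuple T, 0 <= \prod_(i < k) v i (tnth p i).
  by move=> v0 p; apply: prodr_ge0.
elim: n u c => [|n IH] u c mu u0 uc.
  rewrite /fint /= (_ : (fun p => _) = cst 1%E); last first.
    by apply/funext => p; rewrite big_ord0.
  by rewrite integral_dirac // diracT mul1e big_ord0.
rewrite /fint integral_cons_measure; last 2 first.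
- by apply/measurable_EFinP; exact: (mprod _ u mu).
- by move=> p; rewrite lee_fin prod0.
have mt := @measurable_tuple_cons _ T n.
rewrite integral_prod_measure1; last 2 first.
- by apply/measurable_EFinP; apply: (measurableT_comp (mprod _ _ mu) mt).
- by move=> p; rewrite lee_fin prod0.
rewrite big_ord_recl.
transitivity (\int[m]_x ((\prod_(i < n) c (lift ord0 i)) * u ord0 x)%:E)%E.
  apply: eq_integral => x _.
  transitivity (fint (power_measure m n) (fun p => u ord0 x * \prod_(i < n) u (lift ord0 i) (tnth p i))).
    apply: eq_integral => p _; rewrite big_ord_recl /tuple_cons tnth0; congr (_ * _)%:E.
    by apply: eq_bigr => i _; rewrite tnthS.
  rewrite fintZl //; [|exact: (mprod n (fun i => u (lift ord0 i)))|
    exact: (prod0 n (fun i => u (lift ord0 i)))].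
  by rewrite (IH (fun i => u (lift ord0 i)) (fun i => c (lift ord0 i))) // -EFinM mulrC.
have c0 : 0 <= \prod_(i < n) c (lift ord0 i).
  by apply: prodr_ge0 => i _; rewrite -lee_fin -uc; exact: fint_ge0.
by rewrite -/(fint m _) fintZl // uc -EFinM mulrC.
Qed.

End measure_preserving.

(** * Translations and the Gaussian integral on the line *)

Section lebesgue_line.
Context {R : realType}.
Local Notation mu := (@lebesgue_measure R).
Local Notation RT := (measurableTypeR R).

Lemma mpreserving_shift (c : R) : mpreserving mu (fun x : RT => x + c : RT).
Proof.
have ms : measurable_fun setT (fun x : RT => x + c : RT).
  by apply: measurable_funD => //; exact: measurable_cst.
split => // u mu' u0.
pose phi_mixin := isMeasurableFun.Build _ _ _ _ _ ms.
pose phi : {mfun RT >-> RT} := HB.pack (fun x : RT => x + c : RT) phi_mixin.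
have key A : measurable A -> mu A = pushforward mu phi A.
  apply: lebesgue_measure_unique => _ [[a b] _ <-] /=.
  rewrite /pushforward (_ : phi @^-1` _ = `](a - c), (b - c)]%classic).
    rewrite !lebesgue_measure_itv /= !lte_fin ltrD2r; case: ifP => // _.
    by rewrite -!EFinB; congr EFin; ring.
  by apply/seteqP; split => x /=; rewrite !in_itv /= ltrBlDr lerBrDr.
rewrite (@eq_measure_integral _ _ _ _ (pushforward mu phi) mu u); last first.
  by move=> A mA _; exact: key.
have := ge0_integral_pushforward ms mu measurableT mu'.
by rewrite preimage_setT => <-.
Qed.

(** Rescales the total mass 1 of the centred normal density of variance 1 / al. *)
Lemma gauss_line (al : R) : 0 < al ->
  fint mu (fun x => expR (- (al * x ^+ 2 / 2))) = (Num.sqrt (2 * pi / al))%:E.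
Proof.
move=> a0; pose s := Num.sqrt al^-1.
have s0 : s != 0 by rewrite lt0r_neq0 // sqrtr_gt0 invr_gt0.
have s2 : s ^+ 2 = al^-1 by rewrite sqr_sqrtr // invr_ge0 ltW.
have h := integral_normal_pdf 0 s.
have pk : normal_peak s = (Num.sqrt (2 * pi / al))^-1.
  by rewrite /normal_peak s2; congr (Num.sqrt _)^-1; rewrite -mulr_natl; ring.
have q0 : 0 < Num.sqrt (2 * pi / al) :> R.
  by rewrite sqrtr_gt0 divr_gt0 // mulr_gt0 // pi_gt0.
have fE x : expR (- (al * x ^+ 2 / 2)) = Num.sqrt (2 * pi / al) * normal_pdf 0 s x.
  rewrite normal_pdfE // pk [RHS]mulrA divff ?lt0r_neq0 // mul1r /normal_fun; congr expR.
  by rewrite subr0 s2; field; rewrite lt0r_neq0.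
under [in LHS]eq_fun do rewrite fE.
rewrite fintZl //.
- by rewrite /fint h mule1.
- exact: measurable_normal_pdf.
- by move=> x; exact: normal_pdf_ge0.
Qed.

End lebesgue_line.

(** * Translations, rotations and the Gaussian integral in the plane *)

Section lebesgue_plane.
Context {R : realType}.
Local Notation mu := (@lebesgue_measure R).
Local Notation RT := (measurableTypeR R).
Local Notation R2 := (RT * RT)%type.
Local Notation mu2 := (prod_measure mu mu).

Lemma mpreserving_shift2 (a b : R) :
  mpreserving mu2 (fun p : R2 => (p.1 + a, p.2 + b) : R2).
Proof.
exact: (@mpreserving_prod R _ _ RT RT mu mu (fun x => x + a : RT) (fun y => y + b : RT)
  (mpreserving_shift a) (mpreserving_shift b)).
Qed.

Lemma mpreserving_shear1 (a : R) :
  mpreserving mu2 (fun p : R2 => (p.1 + a * p.2, p.2) : R2).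
Proof.
apply: (@mpreserving_skew1 R _ _ RT RT mu mu (fun x y => x + a * y : RT)).
  apply: measurable_funD => //; apply: measurable_funM => //; exact: measurable_cst.
by move=> y; exact: mpreserving_shift.
Qed.

Lemma mpreserving_shear2 (a : R) :
  mpreserving mu2 (fun p : R2 => (p.1, p.2 + a * p.1) : R2).
Proof.
apply: (@mpreserving_skew2 R _ _ RT RT mu mu (fun x y => y + a * x : RT)).
  apply: measurable_funD => //; apply: measurable_funM => //; exact: measurable_cst.
by move=> y; exact: mpreserving_shift.
Qed.

Definition rot2 (c s : R) (p : R2) : R2 := (c * p.1 - s * p.2, s * p.1 + c * p.2).

(* A rotation with c <> -1 is a product of three shears. *)
Lemma mpreserving_rot2 (c s : R) : c ^+ 2 + s ^+ 2 = 1 -> mpreserving mu2 (rot2 c s).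
Proof.
have shears (c' s' : R) : c' ^+ 2 + s' ^+ 2 = 1 -> c' != -1 -> mpreserving mu2 (rot2 c' s').
  move=> cs c1; have c1' : 1 + c' != 0 by rewrite addrC -(opprK 1) subr_eq0.
  (* The tangent of half the angle. *)
  pose t := s' / (1 + c').
  have -> : rot2 c' s' = (fun p : R2 => (p.1 + (- t) * p.2, p.2) : R2) \o
     ((fun p : R2 => (p.1, p.2 + s' * p.1) : R2) \o
      (fun p : R2 => (p.1 + (- t) * p.2, p.2) : R2)).
    apply/funext => -[x y] /=; rewrite /rot2 /=.
    have s2 : s' ^+ 2 = (1 + c') * (1 - c').
      have -> : s' ^+ 2 = 1 - c' ^+ 2 by apply/eqP; rewrite -cs addrAC subrr add0r.
      ring.
    have ts : t * s' = 1 - c'.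
      by rewrite /t mulrAC -expr2 s2 mulrAC divff // mul1r.
    congr pair.
    - transitivity (x * (1 - t * s') - y * (t * (2 - t * s'))); last by ring.
      rewrite ts (_ : t * (2 - (1 - c')) = s'); first by ring.
      by rewrite /t; field.
    - by transitivity (s' * x + y * (1 - t * s')); [rewrite ts; ring|ring].
  apply: mpreserving_comp; last exact: mpreserving_shear1.
  by apply: mpreserving_comp; [exact: mpreserving_shear1|exact: mpreserving_shear2].
move=> cs; have [c1|c1] := eqVneq c (-1); last exact: shears.
have s0 : s = 0.
  move: cs; rewrite c1 sqrrN expr1n => /eqP; rewrite -subr_eq0 addrC addKr.
  by rewrite sqrf_eq0 => /eqP.
(* The half turn, where the tangent of the half angle is infinite, is the square of a quarter
   turn. *)
have -> : rot2 c s = rot2 0 1 \o rot2 0 1.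
  by apply/funext => -[x y]; rewrite /rot2 /= c1 s0; congr pair; ring.
have h : mpreserving mu2 (rot2 0 1).
  apply: shears; first by rewrite expr0n add0r expr1n.
  by rewrite eq_sym oppr_eq0 oner_eq0.
exact: mpreserving_comp.
Qed.

Lemma measurable_gauss_plane (al : R) :
  measurable_fun setT (fun p : R2 => expR (- (al * (p.1 ^+ 2 + p.2 ^+ 2) / 2))).
Proof.
apply: measurableT_comp => //; apply: measurableT_comp => //.
apply: measurable_funM; last exact: measurable_cst.
apply: measurable_funM; first exact: measurable_cst.
by apply: measurable_funD; exact: measurable_funX.
Qed.

Lemma gauss_plane (al : R) : 0 < al ->
  fint mu2 (fun p => expR (- (al * (p.1 ^+ 2 + p.2 ^+ 2) / 2))) = (2 * pi / al)%:E.
Proof.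
move=> a0; have c0 : 0 <= 2 * pi / al by rewrite divr_ge0 ?(ltW a0) // mulr_ge0 // pi_ge0.
pose g (x : R) := expR (- (al * x ^+ 2 / 2)).
have mg : measurable_fun setT (g : RT -> R).
  apply: measurableT_comp => //; apply: measurableT_comp => //.
  apply: measurable_funM; last exact: measurable_cst.
  by apply: measurable_funM; [exact: measurable_cst|exact: measurable_funX].
rewrite /fint integral_prod_measure1; last 2 first.
- by apply/measurable_EFinP; exact: measurable_gauss_plane.
- by move=> p; rewrite lee_fin expR_ge0.
transitivity (\int[mu]_x ((Num.sqrt (2 * pi / al)) * g x)%:E)%E.
  apply: eq_integral => x _.
  transitivity (fint mu (fun y => g x * g y)).
    apply: eq_integral => y _; congr EFin; rewrite /g -expRD; congr expR; rewrite /=; ring.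
  rewrite fintZl ?expR_ge0 //; last by move=> y; exact: expR_ge0.
  by rewrite gauss_line // -EFinM mulrC.
rewrite -/(fint mu _) fintZl ?sqrtr_ge0 //; last by move=> y; exact: expR_ge0.
by rewrite gauss_line // -EFinM -expr2 sqr_sqrtr.
Qed.

End lebesgue_plane.

(** * Entire functions *)

Section differentiability.
Variables (K : numFieldType) (V : normedModType K).

Lemma differentiable_cont_eps (f : V -> K^o) (z : V) : differentiable f z ->
  forall e : K, 0 < e -> exists2 d : K, 0 < d &
    forall w, `|w - z| < d -> `|f w - f z| < e.
Proof.
move=> /differentiable_continuous /cvgrPdist_lt h e e0; have := h e e0.
move=> /nbhs_normP [d /= d0 hd]; exists d => // w wd.
by rewrite distrC; apply: hd; rewrite /= distrC.
Qed.

Lemma differentiable_derivative_eps (p : K) (g : K^o -> K^o) : differentiable g p ->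
  exists beta : K, forall e, 0 < e -> exists2 d, 0 < d &
    forall z, `|z - p| < d -> `|g z - g p - beta * (z - p)| <= e * `|z - p|.
Proof.
move=> /diff_locally h; have /eqaddoP h2 := h.
exists ('d g p 1) => e e0; have := h2 e e0.
move=> /nbhs_normP [d /= d0 hd]; exists d => // z zd.
have /= := hd (z - p); rewrite sub0r normrN => /(_ zd).
rewrite !fctE /= subrK opprD addrA.
rewrite -[X in 'd g p X](mulr1) [_ * 1]/((z - p) *: (1 : K^o)) linearZ /=.
by rewrite /GRing.scale /= mulrC.
Qed.

(** The differential at z is zero. [entire_of_bound] uses this after subtracting the linear part. *)
Lemma differentiable_of_quadratic (f : V -> K^o) (z : V) (B : K) : 0 <= B ->
  (forall v, `|v| < 1 -> `|f (v + z) - f z| <= B * `|v| ^+ 2) ->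
  differentiable f z.
Proof.
move=> B0 h.
have c0 : continuous (\0 : V -> K^o) by move=> x; exact: cvg_cst.
have hL : f \o shift z = cst (f z) + (\0 : V -> K^o) +o_ 0 id.
  have B1 : 0 < B + 1 by rewrite ltr_wpDl.
  apply/eqaddoP => e e0; near=> v.
  rewrite !fctE /= addr0.
  apply: (@le_trans _ _ (B * `|v| ^+ 2)).
    apply: h; near: v; apply/nbhs_normP; exists 1; rewrite /= ?ltr01 // => v.
    by rewrite /= sub0r normrN.
  rewrite expr2 mulrA ler_wpM2r //.
  apply: (@le_trans _ _ ((B + 1) * `|v|)); first by rewrite ler_wpM2r // lerDl ler01.
  rewrite mulrC -ler_pdivlMr //.
  apply: ltW; near: v; apply/nbhs_normP; exists (e / (B + 1)); first exact: divr_gt0.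
  by move=> v; rewrite /= sub0r normrN.
have dE := diff_unique c0 hL.
by apply/diff_locallyP; rewrite dE.
Unshelve. all: by end_near. Qed.

Lemma differentiable_funD (f g : V -> K^o) z : differentiable f z -> differentiable g z ->
  differentiable (fun x => f x + g x : K^o) z.
Proof. exact: differentiableD. Qed.

Lemma differentiable_funM (f g : V -> K^o) z : differentiable f z -> differentiable g z ->
  differentiable (fun x => f x * g x : K^o) z.
Proof. exact: differentiableM. Qed.

End differentiability.

Lemma mx_norm_ltP (K : numFieldType) m n (v : 'M[K]_(m, n)) (d : K) : 0 < d ->
  `|v| < d <-> forall i j, `|v i j| < d.
Proof.
move=> d0; rewrite -[`|v|]/(mx_norm v) mx_normE.
move: d0 (d0) => /ltW/nonnegP[{}d] d0; rewrite num_lt; split.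
- by move=> /bigmax_ltP [_ h] i j; have := h (i, j) isT; rewrite -num_lt.
- move=> h; apply/bigmax_ltP; split; first by rewrite -num_lt.
  by move=> [i j] _; rewrite -num_lt /=; exact: h.
Qed.

Lemma mx_norm_ge_entry (K : numFieldType) m n (v : 'M[K]_(m, n)) i j : `|v i j| <= `|v|.
Proof.
rewrite -[`|v|]/(mx_norm v) mx_normE -[leLHS]nngE num_le.
exact: (le_bigmax _ (fun ij => `|v ij.1 ij.2|%:nng) (i, j)).
Qed.

Lemma differentiable_linear_form (K : numFieldType) n (l : 'I_n -> K)
    (z : ('rV[K]_n : normedModType K)) :
  differentiable ((fun v : 'rV[K]_n => \sum_j v 0 j * l j) :
    ('rV[K]_n : normedModType K) -> K^o) z.
Proof.
rewrite (_ : (fun v => _) = \sum_(j < n) (l j *: ((fun v : 'rV[K]_n => v 0 j) :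
   ('rV[K]_n : normedModType K) -> K^o))).
  apply: differentiable_sum => j; apply: differentiableZ; exact: differentiable_coord.
apply/funext => v; rewrite fct_sumE; apply: eq_bigr => j _.
by rewrite /GRing.scale /= mulrC.
Qed.

Section vectors.
Context {R : realType} {n : nat}.
Local Notation C := R[i].
Local Notation Cn := 'rV[R[i]]_n.
Implicit Types (f : Cn -> C).

(** In the partial order of R[i] positive elements are real. This carries the epsilons and deltas of
    the normed module over R[i] down to R. *)
Lemma posC_Re (d : C) : 0 < d -> exists2 r : R, 0 < r & d = r%:C.
Proof. by case: d => r i; rewrite ltcE /= => /andP[/eqP -> r0]; exists r. Qed.

Lemma entire_cont_eps f (z : Cn) : entire f -> forall e : R, 0 < e ->
  exists2 d : R, 0 < d & forall w : Cn, (forall j, normc (w 0 j - z 0 j) < d) ->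
    normc (f w - f z) < e.
Proof.
move=> fe e e0; have := differentiable_cont_eps (fe z) (e := e%:C).
rewrite ltcR => /(_ e0) [dc /posC_Re [d d0 ->] hd].
exists d => // w wz; rewrite -ltcR; apply: hd.
apply/mx_norm_ltP; first by rewrite ltcR.
by move=> i j; rewrite !mxE ord1 normr_normc ltcR; exact: wz.
Qed.

Lemma differentiable_line (a b : Cn) (p : C^o) :
  differentiable (fun zeta : C^o => a + zeta *: b : 'rV[C]_n) p.
Proof.
apply: differentiableD; first exact: differentiable_cst.
apply: differentiableZl; exact: ex_diff.
Qed.

Lemma entire_line_cdiff f (a b : Cn) p : entire f ->
  cdiff_at (fun zeta => f (a + zeta *: b)) p.
Proof.
move=> fe.
have : differentiable ((f : Cn -> C^o) \o (fun zeta : C^o => a + zeta *: b : 'rV[C]_n)) (p : C^o).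
  by apply: differentiable_comp; [exact: differentiable_line|exact: fe].
move=> /differentiable_derivative_eps [beta hb]; exists beta => e e0.
have := hb e%:C; rewrite ltcR => /(_ e0) [dc /posC_Re [d d0 ->] hd].
exists d => // z zp; have := hd z; rewrite !normr_normc ltcR => /(_ zp).
by rewrite -RcM lecR.
Qed.

(** A criterion for entire functions in which the increment is measured by a real r bounding all
    coordinates, since the norm of a vector is an element of R[i]. The explicit linear form l z is
    the candidate differential. *)
Lemma entire_of_bound f (l : Cn -> 'I_n -> C) (B : Cn -> R) :
  (forall z, 0 <= B z) ->
  (forall (z v : Cn) (r : R), (forall j, normc (v 0 j) <= r) -> 0 <= r <= 1 ->
     normc (f (v + z) - f z - \sum_j v 0 j * l z j) <= B z * r ^+ 2) -> entire f.
Proof.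
move=> B0 h z.
pose g (v : Cn) : C := \sum_j v 0 j * l z j.
have -> : (f : Cn -> C^o) = ((fun v => f v - g v) : Cn -> C^o) + (g : Cn -> C^o).
  by apply/funext => v; rewrite !fctE subrK.
apply: differentiableD; last exact: differentiable_linear_form.
apply: (@differentiable_of_quadratic _ _ _ _ (B z)%:C); first by rewrite lecR.
move=> v v1.
have [r rE] : exists r : R, `|v| = r%:C.
  by case: `|v| (normr_ge0 v) => r i; rewrite lecE /= => /andP[/eqP -> _]; exists r.
rewrite rE -rmorphXn -rmorphM /= normr_normc lecR.
have -> : f (v + z) - g (v + z) - (f z - g z) = f (v + z) - f z - g v.
  rewrite (_ : g (v + z) = g v + g z); first by ring.
  by rewrite /g -big_split /=; apply: eq_bigr => j _; rewrite mxE mulrDl.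
apply: h.
  by move=> j; rewrite -lecR -rE -normr_normc; exact: mx_norm_ge_entry.
apply/andP; split; first by rewrite -lecR -rE normr_ge0.
by rewrite ltW // -ltcR -rE.
Qed.

Lemma entireM f g : entire f -> entire g -> entire (fun z => f z * g z).
Proof. by move=> hf hg z; apply: differentiable_funM; [exact: hf|exact: hg]. Qed.

Lemma entireD f g : entire f -> entire g -> entire (fun z => f z + g z).
Proof. by move=> hf hg z; apply: differentiable_funD; [exact: hf|exact: hg]. Qed.

Lemma entire_cst (c : C) : entire (fun _ : Cn => c).
Proof. move=> z; exact: differentiable_cst. Qed.

Lemma entire_affine f (c : C) (a : Cn) : entire f -> entire (fun z => f (c *: z + a)).
Proof.
move=> hf z.
apply: (@differentiable_comp _ _ _ _ (fun z : (Cn : normedModType C) =>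
  c *: z + a : (Cn : normedModType C)) (f : Cn -> C^o)); last exact: hf.
apply: differentiableD; last exact: differentiable_cst.
by apply: differentiableZ; exact: ex_diff.
Qed.

Lemma entire_cexp_linear (l : 'I_n -> C) (c : C) :
  entire (fun z : Cn => cexp (\sum_j z 0 j * l j + c)).
Proof.
pose M := \sum_j normc (l j).
have M0 : 0 <= M by apply: sumr_ge0 => j _; exact: normc_ge0.
pose e (z : Cn) := cexp (\sum_j z 0 j * l j + c).
apply: (@entire_of_bound _ (fun z j => l j * e z) (fun z => normc (e z) * (expR M * M ^+ 2))).
  by move=> z; rewrite mulr_ge0 ?normc_ge0 // mulr_ge0 ?expR_ge0 // exprn_ge0.
move=> z v r vr /andP[r0 r1].
pose w := \sum_j v 0 j * l j.
have wr : normc w <= M * r.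
  rewrite /w /M mulr_suml (le_trans (normc_sum _ _ _)) //; apply: ler_sum => j _.
  by rewrite normcM mulrC ler_wpM2l ?normc_ge0.
have -> : \sum_j v 0 j * (l j * e z) = w * e z.
  by rewrite /w mulr_suml; apply: eq_bigr => j _; rewrite mulrA.
have -> : cexp (\sum_j (v + z) 0 j * l j + c) = e z * cexp w.
  rewrite -cexpD; congr cexp; rewrite addrAC -big_split /=; congr (_ + _).
  by apply: eq_bigr => j _; rewrite mxE mulrDl addrC.
rewrite -/(e z) (_ : _ - _ = e z * (cexp w - 1 - w)); last by ring.
rewrite normcM -[leRHS]mulrA ler_wpM2l ?normc_ge0 // (le_trans (cexp_remainder2 _)) //.
rewrite -mulrA -exprMn ler_pM ?expR_ge0 ?exprn_ge0 ?normc_ge0 //.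
  by rewrite ler_expR (le_trans wr) // ler_piMr.
by rewrite lerXn2r ?nnegrE ?normc_ge0 ?mulr_ge0.
Qed.

End vectors.

(** * Lebesgue measure on C^n *)

Section hdot_theory.
Context {R : realType} {n : nat}.
Local Notation C := R[i].
Local Notation Cn := 'rV[R[i]]_n.
Implicit Types (z w v a : Cn) (c : C).

Lemma hdotDl z w a : hdot (z + w) a = hdot z a + hdot w a.
Proof. by rewrite /hdot -big_split; apply: eq_bigr => j _; rewrite mxE mulrDl. Qed.

Lemma hdotZl c z a : hdot (c *: z) a = c * hdot z a.
Proof. by rewrite /hdot mulr_sumr; apply: eq_bigr => j _; rewrite mxE mulrA. Qed.

Lemma hdot_conj z w : conjc (hdot z w) = hdot w z.
Proof.
rewrite /hdot rmorph_sum; apply: eq_bigr => j _.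
by rewrite rmorphM /= conjcK mulrC.
Qed.

Lemma hdotDr a z w : hdot a (z + w) = hdot a z + hdot a w.
Proof. by rewrite -!(hdot_conj _ a) hdotDl rmorphD. Qed.

Lemma hdotZr c a z : hdot a (c *: z) = conjc c * hdot a z.
Proof. by rewrite -!(hdot_conj _ a) hdotZl rmorphM. Qed.

Lemma hdotNl z a : hdot (- z) a = - hdot z a.
Proof. by rewrite -scaleN1r hdotZl mulN1r. Qed.

Lemma hdotNr z a : hdot a (- z) = - hdot a z.
Proof. by rewrite -!(hdot_conj _ a) hdotNl rmorphN. Qed.

Lemma hdotBl z w a : hdot (z - w) a = hdot z a - hdot w a.
Proof. by rewrite hdotDl hdotNl. Qed.

Lemma hdotBr a z w : hdot a (z - w) = hdot a z - hdot a w.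
Proof. by rewrite hdotDr hdotNr. Qed.

Lemma hdot0l a : hdot 0 a = 0.
Proof. by rewrite /hdot big1 // => j _; rewrite mxE mul0r. Qed.

Lemma hdot0r a : hdot a 0 = 0.
Proof. by rewrite -hdot_conj hdot0l conjc0. Qed.

Lemma sqnormE z : (sqnorm z)%:C = hdot z z.
Proof.
rewrite /sqnorm /hdot rmorph_sum; apply: eq_bigr => j _.
by rewrite mul_conj.
Qed.

Lemma sqnorm_ge0 z : 0 <= sqnorm z.
Proof. by apply: sumr_ge0 => j _; rewrite exprn_ge0 // normc_ge0. Qed.

Lemma sqnormZ c z : sqnorm (c *: z) = normc c ^+ 2 * sqnorm z.
Proof. by rewrite /sqnorm mulr_sumr; apply: eq_bigr => j _; rewrite mxE normcM exprMn. Qed.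

Lemma sqnorm_sub z w : sqnorm (z - w) = sqnorm z + sqnorm w - 2 * complex.Re (hdot z w).
Proof.
apply: complexI; rewrite sqnormE hdotBl !hdotBr /= !rmorphB !rmorphD /= !sqnormE rmorphM /=.
rewrite -(hdot_conj z w) -[2 in RHS]/(2%:R) (_ : (2%:R : R)%:C = 2%:R :> C); last first.
  by rewrite rmorph_nat.
by rewrite -addcJ; ring.
Qed.

(* Young's inequality in the form used against Gaussian weights. *)
Lemma normc_hdot_le (s : R) z w : 0 < s ->
  2 * normc (hdot z w) <= s * sqnorm z + s^-1 * sqnorm w.
Proof.
move=> s0; rewrite (le_trans (ler_wpM2l _ (normc_sum _ _ _))) //.
rewrite /sqnorm !mulr_sumr -big_split /=; apply: ler_sum => j _.
rewrite normcM normc_conj; set x := normc _; set y := normc _.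
rewrite -subr_ge0 (_ : _ - _ = s * (x - s^-1 * y) ^+ 2); last by field; rewrite lt0r_neq0.
by rewrite mulr_ge0 ?sqr_ge0 // ltW.
Qed.

End hdot_theory.

Section borel.
Context {R : realType} {n : nat}.
Local Notation C := R[i].
Local Notation Cn := 'rV[R[i]]_n.
Local Notation R2 := (measurableTypeR R * measurableTypeR R)%type.
Local Notation Tn := (n.-tuple R2).

(** In contrast to [lmeasurable], this is measurability for the product sigma-algebra itself, to
    which composition and Fubini apply. *)
Definition borel (h : Cn -> C) := cmeas (fun p : Tn => h (of_coords p)).

Definition rborel (u : Cn -> R) := measurable_fun setT (fun p : Tn => u (of_coords p)).

Definition to_coords (z : Cn) : Tn :=
  [tuple (complex.Re (z 0 j), complex.Im (z 0 j)) | j < n].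

Lemma to_coordsK z : of_coords (to_coords z) = z.
Proof. by apply/rowP => j; rewrite mxE tnth_mktuple /=; case: (z 0 j). Qed.

Definition vmeas d (T : measurableType d) (F : T -> Cn) := forall j, cmeas (fun x => F x 0 j).

Lemma vmeas_of_coords : vmeas (fun p : Tn => of_coords p).
Proof.
move=> j; have mt := @measurable_tnth _ R2 n j; split.
- under eq_fun do rewrite mxE /=; exact: (measurableT_comp (@measurable_fst _ _ _ _) mt).
- under eq_fun do rewrite mxE /=; exact: (measurableT_comp (@measurable_snd _ _ _ _) mt).
Qed.

Section vmeas_theory.
Context d (T : measurableType d).
Implicit Types F G : T -> Cn.

Lemma vmeas_cst (a : Cn) : vmeas (fun _ : T => a).
Proof. by move=> j; exact: cmeas_cst. Qed.

Lemma vmeasD F G : vmeas F -> vmeas G -> vmeas (fun x => F x + G x).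
Proof. by move=> h1 h2 j; under eq_fun do rewrite mxE; exact: cmeasD. Qed.

Lemma vmeasB F G : vmeas F -> vmeas G -> vmeas (fun x => F x - G x).
Proof. by move=> h1 h2 j; under eq_fun do rewrite !mxE; exact: cmeasB. Qed.

Lemma vmeasZ (c : T -> C) F : cmeas c -> vmeas F -> vmeas (fun x => c x *: F x).
Proof. by move=> h1 h2 j; under eq_fun do rewrite mxE; exact: cmeasM. Qed.

Lemma cmeas_hdot F G : vmeas F -> vmeas G -> cmeas (fun x => hdot (F x) (G x)).
Proof.
move=> h1 h2; apply: cmeas_sum => j; apply: cmeasM => //; exact: cmeas_conj.
Qed.

Lemma measurable_sqnorm F : vmeas F -> measurable_fun setT (fun x => sqnorm (F x)).
Proof.
move=> h; have [+ _] := cmeas_hdot h h; congr measurable_fun; apply/funext => x.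
by rewrite -sqnormE.
Qed.

Lemma measurable_to_coords F : vmeas F -> measurable_fun setT (fun x => to_coords (F x)).
Proof.
move=> h; apply/measurable_fun_tnthP => j.
rewrite (_ : _ \o _ = fun x => (complex.Re (F x 0 j), complex.Im (F x 0 j)) : R2).
  by have [h1 h2] := h j; apply: measurable_fun_pair.
by apply/funext => x /=; rewrite tnth_mktuple.
Qed.

Lemma borel_comp (h : Cn -> C) F : borel h -> vmeas F -> cmeas (fun x => h (F x)).
Proof.
move=> bh hF; have := cmeas_comp (measurable_to_coords hF) bh.
by under eq_fun do rewrite to_coordsK.
Qed.

Lemma rborel_comp (u : Cn -> R) F : rborel u -> vmeas F -> measurable_fun setT (fun x => u (F x)).
Proof.
move=> bh hF; have := measurableT_comp bh (measurable_to_coords hF).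
by congr measurable_fun; apply/funext => x /=; rewrite to_coordsK.
Qed.

End vmeas_theory.

Lemma borel_normc h : borel h -> rborel (fun z => normc (h z)).
Proof. exact: measurable_normc. Qed.

Lemma measurable_discrete d (T : measurableType d) (U : countType) (phi : T -> U) (g : U -> R) :
  (forall u, measurable (phi @^-1` [set u])) -> measurable_fun setT (fun x => g (phi x)).
Proof.
move=> h _ Y mY; rewrite setTI.
rewrite (_ : _ @^-1` _ = \bigcup_(u in [set u | Y (g u)]) phi @^-1` [set u]).
  rewrite bigcup_mkcond; apply: countable_bigcupT_measurable; first exact: countableP.
  by move=> u; case: ifP.
apply/seteqP; split => x /=; first by move=> hx; exists (phi x).
by move=> [u /= Yu ->].
Qed.

Definition grid_code (k : nat) (p : Tn) : n.-tuple (int * int) :=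
  [tuple (Num.floor (k.+1%:R * (tnth p j).1), Num.floor (k.+1%:R * (tnth p j).2)) | j < n].

Definition grid_point (k : nat) (c : n.-tuple (int * int)) : Cn :=
  \row_j (((tnth c j).1%:~R / k.+1%:R) +i* ((tnth c j).2%:~R / k.+1%:R)).

Lemma measurable_grid_code k u : measurable (grid_code k @^-1` [set u]).
Proof.
have mfl (f : Tn -> R) (m : int) : measurable_fun setT f ->
    measurable [set p | Num.floor (k.+1%:R * f p) = m].
  move=> mf; have mf' : measurable_fun setT (fun p => k.+1%:R * f p).
    by apply: measurable_funM => //; exact: measurable_cst.
  rewrite (_ : mkset _ = (fun p => k.+1%:R * f p) @^-1` `[m%:~R, (m + 1)%:~R[%classic).
    by rewrite -[X in measurable X]setTI; exact: mf'.
  apply/seteqP; split => p /=; rewrite in_itv /=.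
    by move=> <-; rewrite floor_itv.
  by move=> /floor_def.
rewrite (_ : _ @^-1` _ = \bigcap_(j in [set: 'I_n])
  ([set p | Num.floor (k.+1%:R * (tnth p j).1) = (tnth u j).1] `&`
   [set p | Num.floor (k.+1%:R * (tnth p j).2) = (tnth u j).2])).
  apply: fin_bigcap_measurable => // j _; have mt := @measurable_tnth _ R2 n j.
  apply: measurableI; apply: mfl.
  - exact: (measurableT_comp (@measurable_fst _ _ _ _) mt).
  - exact: (measurableT_comp (@measurable_snd _ _ _ _) mt).
apply/seteqP; split => p /=.
  by move=> <- j _; rewrite !tnth_mktuple.
move=> h; apply: eq_from_tnth => j; rewrite tnth_mktuple.
by have [-> ->] := h j I; case: (tnth u j).
Qed.

Lemma grid_point_close k p j :
  normc (grid_point k (grid_code k p) 0 j - of_coords p 0 j) <= 2 / k.+1%:R.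
Proof.
rewrite !mxE tnth_mktuple /=.
have key (x : R) : `|(Num.floor (k.+1%:R * x))%:~R / k.+1%:R - x| <= k.+1%:R^-1.
  have k0 : 0 < k.+1%:R :> R by rewrite ltr0n.
  rewrite -(ler_pM2l k0) -{1}(gtr0_norm k0) -normrM mulrBr mulrCA divff ?lt0r_neq0 // mulr1.
  have := floor_itv (k.+1%:R * x) => /andP[h1 h2].
  rewrite ler_norml; apply/andP; split; move: h1 h2; rewrite intrD; lra.
rewrite (le_trans (normc_le_ReIm _)) //.
have -> : 2 / k.+1%:R = k.+1%:R^-1 + k.+1%:R^-1 :> R by rewrite mulr_natl mulr2n.
by apply: lerD; exact: key.
Qed.

(** f is the pointwise limit of functions constant on the cubes of a grid of mesh 1 / (k + 1). Each
    of them factors through the countable set of cubes, so it is measurable for the product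
    sigma-algebra. *)
Lemma borel_of_continuous (f : Cn -> C) :
  (forall (z : Cn) (e : R), 0 < e -> exists2 d : R, 0 < d &
    forall w : Cn, (forall j, normc (w 0 j - z 0 j) < d) -> normc (f w - f z) < e) ->
  borel f.
Proof.
move=> hf.
have key p (e : R) : 0 < e -> \forall k \near \oo,
    normc (f (grid_point k (grid_code k p)) - f (of_coords p)) < e.
  move=> e0; have [d d0 hd] := hf (of_coords p) e e0.
  have d20 : 0 < d / 2 by rewrite divr_gt0.
  have [N _ hN] := near_infty_natSinv_lt (PosNum d20).
  exists N => // k /= Nk; apply: hd => j.
  rewrite (le_lt_trans (grid_point_close _ _ _)) //.
  by have := hN k Nk; rewrite /= ltr_pdivlMr // mulrC.
apply: (@cmeas_lim _ _ _ (fun k p => f (grid_point k (grid_code k p)))).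
- move=> k; split.
  + apply: (measurable_discrete (phi := grid_code k) (fun c => complex.Re (f (grid_point k c)))).
    exact: measurable_grid_code.
  + apply: (measurable_discrete (phi := grid_code k) (fun c => complex.Im (f (grid_point k c)))).
    exact: measurable_grid_code.
- move=> p; apply/cvgrPdist_lt => e e0; near=> k.
  rewrite distrC -ReB (le_lt_trans (Re_le_normc _)) //; near: k; exact: key.
- move=> p; apply/cvgrPdist_lt => e e0; near=> k.
  rewrite distrC -ImB (le_lt_trans (Im_le_normc _)) //; near: k; exact: key.
Unshelve. all: by end_near. Qed.

Lemma entire_borel (f : Cn -> C) : entire f -> borel f.
Proof. by move=> fe; apply: borel_of_continuous => z e e0; exact: entire_cont_eps. Qed.

End borel.

Section lebesgue_Cn.
Context {R : realType} {n : nat}.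
Local Notation C := R[i].
Local Notation Cn := 'rV[R[i]]_n.
Local Notation R2 := (measurableTypeR R * measurableTypeR R)%type.
Local Notation Tn := (n.-tuple R2).
Local Notation leb := (@lebC R n).

Definition cn_integrable (h : Cn -> C) := cintegrable leb (fun p => h (of_coords p)).

Lemma of_coords_shift (a : Cn) (p : Tn) :
  of_coords (coordmap (fun j (q : R2) =>
    (q.1 + complex.Re (a 0 j), q.2 + complex.Im (a 0 j)) : R2) p) = of_coords p + a.
Proof.
by apply/rowP => j; rewrite !mxE tnth_mktuple /=; case: (a 0 j).
Qed.

Lemma of_coords_rot (u : C) (p : Tn) :
  of_coords (coordmap (fun _ => rot2 (complex.Re u) (complex.Im u)) p) = u *: of_coords p.
Proof.
apply/rowP => j; rewrite !mxE tnth_mktuple; case: u => c s.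
by apply: complex_eq => /=; ring.
Qed.

Lemma mpreserving_shift_coords (a : Cn) : mpreserving leb (coordmap (fun j (q : R2) =>
    (q.1 + complex.Re (a 0 j), q.2 + complex.Im (a 0 j)) : R2)).
Proof. by apply: mpreserving_coordmap => j; exact: mpreserving_shift2. Qed.

Lemma mpreserving_rot_coords (u : C) : normc u = 1 ->
  mpreserving leb (coordmap (fun _ => rot2 (complex.Re u) (complex.Im u))).
Proof.
move=> u1; apply: mpreserving_coordmap => j; apply: mpreserving_rot2.
by rewrite -normc_sqr u1 expr1n.
Qed.

Lemma nnint_shift (u : Cn -> R) (a : Cn) : rborel u -> (forall z, 0 <= u z) ->
  nnint (fun z => u (z + a)) = nnint u.
Proof.
move=> mu u0; rewrite -[RHS](mpreserving_fint (mpreserving_shift_coords a) mu) //.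
by apply: eq_integral => p _; rewrite of_coords_shift.
Qed.

Lemma nnint_rot (u : Cn -> R) (c : C) : normc c = 1 -> rborel u -> (forall z, 0 <= u z) ->
  nnint (fun z => u (c *: z)) = nnint u.
Proof.
move=> c1 mu u0; rewrite -[RHS](mpreserving_fint (mpreserving_rot_coords c1) mu) //.
by apply: eq_integral => p _; rewrite of_coords_rot.
Qed.

Lemma cint_shift (h : Cn -> C) (a : Cn) : borel h -> cint (fun z => h (z + a)) = cint h.
Proof.
move=> bh; rewrite -[RHS](mpreserving_cintegral (mpreserving_shift_coords a) bh).
by apply: eq_cintegral => p; rewrite of_coords_shift.
Qed.

Lemma cint_rot (h : Cn -> C) (c : C) : normc c = 1 -> borel h ->
  cint (fun z => h (c *: z)) = cint h.
Proof.
move=> c1 bh; rewrite -[RHS](mpreserving_cintegral (mpreserving_rot_coords c1) bh).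
by apply: eq_cintegral => p; rewrite of_coords_rot.
Qed.

Lemma cn_integrable_rot (h : Cn -> C) (c : C) : normc c = 1 -> cn_integrable h ->
  cn_integrable (fun z => h (c *: z)).
Proof.
move=> c1 ih; have := mpreserving_cintegrable (mpreserving_rot_coords c1) ih.
by rewrite /cn_integrable; under eq_fun do rewrite of_coords_rot.
Qed.

Lemma rborel_sqnorm : rborel (@sqnorm R n).
Proof. exact: measurable_sqnorm vmeas_of_coords. Qed.

Lemma rborel_gauss (al : R) : rborel (fun z : Cn => expR (- (al * sqnorm z / 2))).
Proof.
apply: measurableT_comp => //; apply: measurableT_comp => //.
apply: measurable_funM; last exact: measurable_cst.
by apply: measurable_funM; [exact: measurable_cst|exact: rborel_sqnorm].
Qed.

Lemma nnint_gauss (al : R) : 0 < al ->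
  nnint (fun z : Cn => expR (- (al * sqnorm z / 2))) = ((2 * pi / al) ^+ n)%:E.
Proof.
move=> a0.
have := @integral_power_measure_prod R _ _ (prod_measure (@lebesgue_measure R) (@lebesgue_measure R))
  n (fun _ (p : R2) => expR (- (al * (p.1 ^+ 2 + p.2 ^+ 2) / 2))) (fun=> 2 * pi / al).
rewrite prodr_const card_ord => <-.
- apply: eq_integral => p _; congr EFin.
  rewrite -(big_morph expR (@expRD R) (@expR0 R)); congr expR.
  rewrite /sqnorm mulr_sumr mulr_suml -sumrN; apply: eq_bigr => j _.
  by rewrite mxE normc_sqr.
- by move=> i; exact: measurable_gauss_plane.
- by move=> i x; exact: expR_ge0.
- by move=> i; exact: gauss_plane.
Qed.

End lebesgue_Cn.

Lemma eq_cintegrable d (T : measurableType d) (R : realType) (m : {measure set T -> \bar R})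
    (F G : T -> R[i]) : (forall x, F x = G x) -> cintegrable m F -> cintegrable m G.
Proof. by move=> /funext ->. Qed.

(** * Mean value and reproducing properties of Gaussian weights *)

Section circle_average.
Context {R : realType}.
Local Notation C := R[i].
Local Notation mu := (@lebesgue_measure R).

Lemma two_pi_gt0 : 0 < 2 * pi :> R.
Proof. by rewrite mulr_gt0 // pi_gt0. Qed.

Definition circ : probability (measurableTypeR R) R := uniform_prob two_pi_gt0.

Definition unit_c (t : R) : C := cexp (0 +i* t).

Lemma normc_unit_c t : normc (unit_c t) = 1.
Proof. by rewrite normc_cexp expR0. Qed.

Lemma fint_circ (u : R -> R) : measurable_fun setT u -> (forall x, 0 <= u x) ->
  fint circ u = ((2 * pi)^-1%:E * \int[mu]_(x in `[0%R, (2 * pi)%R]) (u x)%:E)%E.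
Proof.
move=> mu' u0; rewrite /fint integral_uniform ?subr0 //.
exact/measurable_EFinP.
Qed.

Lemma ccont_cmeas (phi : R -> C) : ccont phi -> cmeas phi.
Proof. by move=> [h1 h2]; split; exact: continuous_measurable_fun. Qed.

Lemma cintegrable_circ (phi : R -> C) : ccont phi -> cintegrable circ phi.
Proof.
move=> cphi; have mphi := ccont_cmeas cphi; split => //.
rewrite fint_circ; [|exact: measurable_normc|by move=> x; exact: normc_ge0].
rewrite lte_mul_pinfty ?lee_fin ?invr_ge0 ?(ltW two_pi_gt0) //.
have cn : continuous (fun x => normc (phi x)).
  rewrite (_ : (fun x => _) = fun x => Num.sqrt (complex.Re (phi x) * complex.Re (phi x) + complex.Im (phi x) * complex.Im (phi x))).
    move=> x; apply: continuous_comp; last exact: sqrt_continuous.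
    have [h1 h2] := cphi.
    apply: cvgD; apply: cvgM; [exact: h1|exact: h1|exact: h2|exact: h2].
  by apply/funext => x; rewrite -!expr2 -normc_sqr sqrtr_sqr ger0_norm ?normc_ge0.
have /integrableP[_] := continuous_integrable_itv 0 (2 * pi) cn.
apply: le_lt_trans; rewrite le_eqVlt; apply/orP; left; apply/eqP.
by apply: eq_integral => x _ /=; rewrite ger0_norm ?normc_ge0.
Qed.

Lemma cintegral_circ (phi : R -> C) : ccont phi ->
  cintegral circ phi = ((2 * pi)^-1)%:C * cint_seg 0 (2 * pi) phi.
Proof.
move=> cphi; have i1 := cintegrable_circ cphi; have [cr ci] := cphi.
have key (f : R -> R) : continuous f -> circ.-integrable setT (EFin \o f) ->
    \int[circ]_x f x = (2 * pi)^-1 * \int[mu]_(x in `[0, 2 * pi]) f x.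
  move=> cf fi; have mf := continuous_measurable_fun cf.
  rewrite -RintegralZl //; last exact: continuous_integrable_itv.
  rewrite /Rintegral integralE [in RHS]integralE; congr fine.
  have mfE : measurable_fun setT (EFin \o f) by exact/measurable_EFinP.
  rewrite !integral_uniform ?subr0 //; try exact: measurable_funepos; try exact: measurable_funeneg.
  have c0 : 0 <= (2 * pi)^-1 :> R by rewrite invr_ge0 (ltW two_pi_gt0).
  rewrite -!ge0_integralZl //; try (apply: measurable_funTS);
    try exact: measurable_funepos; try exact: measurable_funeneg.
  congr (_ - _)%E; apply: eq_integral => x _.
  - by rewrite !funeposE /= -EFin_max -EFinM maxr_pMr // mulr0 EFin_max.
  - by rewrite !funenegE /= -EFin_max -EFinM maxr_pMr // mulr0 mulrN EFin_max.
apply: complex_eq; rewrite ?ReZl ?ImZl /=; apply: key => //.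
- exact: cintegrable_Re i1.
- exact: cintegrable_Im i1.
Qed.

Lemma cintegral_circ_cst (c : C) : cintegral circ (fun=> c) = c.
Proof.
rewrite cintegral_circ; last exact: ccont_cst.
rewrite cint_seg_cst ?(ltW two_pi_gt0) // subr0 mulrA -RcM mulVf ?mul1r //.
by rewrite lt0r_neq0 // two_pi_gt0.
Qed.

Lemma continuous_unit_c : ccont unit_c.
Proof.
rewrite /unit_c; exact: (ccont_vertical (G := cexp) (@cdiff_at_cexp R) 0).
Qed.

End circle_average.

(** * Averages over rotations *)

Section mean_value.
Context {R : realType} {n : nat}.
Local Notation C := R[i].
Local Notation Cn := 'rV[R[i]]_n.
Local Notation R2 := (measurableTypeR R * measurableTypeR R)%type.
Local Notation Tn := (n.-tuple R2).
Local Notation leb := (@lebC R n).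
Local Notation circ := (@circ R).

Definition fin_nnint (u : Cn -> R) : Prop := (nnint u < +oo)%E.

Lemma entire_circle_ccont (f : Cn -> C) z : entire f -> ccont (fun t => f (unit_c t *: z)).
Proof.
move=> fe.
apply: (ccont_vertical (G := fun zeta => f (cexp zeta *: z)) _ 0) => p.
apply: (cdiff_at_comp (c := cexp) (F := fun zeta => f (zeta *: z))).
  exact: cdiff_at_cexp.
have := entire_line_cdiff 0 z (cexp p) fe.
by under eq_fun do rewrite add0r.
Qed.

Lemma entire_circle_mean (f : Cn -> C) z : entire f ->
  cintegral circ (fun t => f (unit_c t *: z)) = f 0.
Proof.
move=> fe; rewrite cintegral_circ; last exact: entire_circle_ccont.
rewrite (circle_mean (F := fun zeta => f (zeta *: z))).
  rewrite scale0r mulrA -RcM mulVf ?mul1r // lt0r_neq0 // two_pi_gt0 //.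
move=> p; have := entire_line_cdiff 0 z p fe.
by under eq_fun do rewrite add0r.
Qed.

Lemma vmeas_rot : vmeas (fun q : R * Tn => unit_c q.1 *: of_coords q.2).
Proof.
apply: vmeasZ.
  apply: (cmeas_comp (phi := fst)) => //; apply: ccont_cmeas; exact: continuous_unit_c.
by move=> j; apply: (@cmeas_comp _ _ _ _ _ (snd : R * Tn -> Tn) (fun p => of_coords p 0 j)) => //;
  exact: vmeas_of_coords.
Qed.

(** Each rotation preserves the integral over C^n, so the integral equals its mean over the circle;
    Tonelli moves this mean inside. *)
Lemma rotation_average (u : Cn -> R) : rborel u -> (forall z, 0 <= u z) ->
  nnint u = (\int[leb]_p fint circ (fun t => u (unit_c t *: of_coords p)))%E.
Proof.
move=> mu u0.
pose U (q : R * Tn) := (u (unit_c q.1 *: of_coords q.2))%:E.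
have mU : measurable_fun setT U.
  by apply/measurable_EFinP; apply: (rborel_comp mu); exact: vmeas_rot.
have U0 q : (0 <= U q)%E by rewrite lee_fin.
have <- := fubini_tonelli (m1 := circ) (m2 := leb) U mU U0.
rewrite (eq_integral (fun=> nnint u)).
  rewrite integral_cst // [X in (_ * X)%E](_ : _ = 1%E) ?mule1 //.
  exact: probability_setT.
by move=> t _; rewrite -[RHS](nnint_rot (normc_unit_c t) mu).
Qed.

(** The weight depends only on |z|. Averaging over rotations and exchanging the integrals replaces f
    by its mean over the circle through each point, which is f 0; the total mass of the weight
    remains. *)
Theorem gauss_mean_value (al : R) (f : Cn -> C) : 0 < al -> entire f ->
  fin_nnint (fun z => normc (f z) * expR (- (al * sqnorm z / 2))) ->
  cint (fun z => f z * (expR (- (al * sqnorm z / 2)))%:C) = ((2 * pi / al) ^+ n)%:C * f 0.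
Proof.
move=> a0 fe foo.
pose W (z : Cn) : R := expR (- (al * sqnorm z / 2)).
have W0 z : 0 <= W z by exact: expR_ge0.
pose h z := f z * (W z)%:C.
have bW : rborel W by exact: rborel_gauss.
have bh : borel h by apply: cmeasM; [exact: entire_borel|exact: cmeasR].
have normh z : normc (h z) = normc (f z) * W z by rewrite normcM normcR ger0_norm.
have ih : cn_integrable h.
  by split => //; apply: le_lt_trans foo; under eq_fun do rewrite normh.
have gW : fint leb (fun p => W (of_coords p)) = ((2 * pi / al) ^+ n)%:E := nnint_gauss a0.
have Wrot t z : W (unit_c t *: z) = W z.
  by rewrite /W sqnormZ normc_unit_c expr1n mul1r.
pose Phi (q : R * Tn) := h (unit_c q.1 *: of_coords q.2).
have mPhi : cmeas Phi by apply: borel_comp => //; exact: vmeas_rot.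
have := @cfubini _ _ _ _ _ circ leb Phi mPhi.
have e1 (t : measurableTypeR R) : cintegral leb (fun p => Phi (t, p)) = cint h.
  by rewrite -[RHS](cint_rot (normc_unit_c t) bh).
have e2 p : cintegral circ (fun t => Phi (t, p)) = f 0 * (W (of_coords p))%:C.
  rewrite -(entire_circle_mean (of_coords p) fe) mulrC -cintegralZl.
    by apply: eq_cintegral => t; rewrite /Phi /h /= Wrot mulrC.
  by apply: cintegrable_circ; exact: entire_circle_ccont.
rewrite (eq_cintegral circ e1) (eq_cintegral leb e2) cintegral_circ_cst => ->.
- rewrite (cintegralZl (F := fun p => (W (of_coords p))%:C)).
    by rewrite (cintegralR leb (fun p => W0 (of_coords p))) gW mulrC.
  split; first exact: cmeasR.
  under eq_fun do rewrite normcR ger0_norm //.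
  by rewrite gW ltry.
- rewrite (eq_integral (fun=> fint leb (fun p => normc (h (of_coords p))))).
    rewrite integral_cst // [X in (_ * X)%E](_ : _ = 1%E) ?mule1 //; last exact: probability_setT.
    by have [] := ih.
  move=> t _; rewrite -[RHS](nnint_rot (normc_unit_c t) (borel_normc bh)) // => z.
  exact: normc_ge0.
- by move=> t; exact: (cn_integrable_rot (normc_unit_c t) ih).
- move=> p; apply: eq_cintegrable (cintegrableZl (W (of_coords p))%:C
    (cintegrable_circ (entire_circle_ccont (of_coords p) fe))) => t.
  by rewrite /Phi /h /= Wrot mulrC.
Qed.

(* The point evaluation at z is the one at 0 of [w |-> f (w + z) e^{-al w.z^*/2}]. *)
Theorem gauss_reproducing (al : R) (f : Cn -> C) (z : Cn) : 0 < al -> entire f ->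
  fin_nnint (fun w => normc (f w * cexp (al%:C * hdot z w / 2)) *
     expR (- (al * sqnorm w / 2))) ->
  cint (fun w => f w * cexp (al%:C * hdot z w / 2) * (expR (- (al * sqnorm w / 2)))%:C) =
  ((2 * pi / al) ^+ n)%:C * f z.
Proof.
move=> a0 fe foo.
pose F w := f (w + z) * cexp (- (al%:C * hdot w z / 2)).
pose h w := f w * cexp (al%:C * hdot z w / 2) * (expR (- (al * sqnorm w / 2)))%:C.
have hF w : F w * (expR (- (al * sqnorm w / 2)))%:C = h (w + z).
  rewrite /F /h -!mulrA; congr (_ * _); rewrite -!cexpR -!cexpD; congr cexp.
  have n2 : (2 : C) != 0 by rewrite pnatr_eq0.
  rewrite !rmorphN !rmorphM /= !fmorphV /= !rmorph_nat !sqnormE !hdotDl !hdotDr.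
  by field.
have FE : entire F.
  apply: entireM.
    by have := entire_affine 1 z fe; under eq_fun do rewrite scale1r.
  have := @entire_cexp_linear R n (fun j => - (al%:C * conjc (z 0 j) / 2)) 0.
  congr entire; apply/funext => w; congr cexp; rewrite addr0 /hdot mulr_sumr mulr_suml -sumrN.
  by apply: eq_bigr => j _; ring.
have bh : borel h.
  apply: cmeasM; last exact: cmeasR (rborel_gauss al).
  apply: cmeasM; first exact: entire_borel.
  apply: cmeas_cexp; apply: cmeasM; last exact: cmeas_cst.
  apply: cmeasM; first exact: cmeas_cst.
  by apply: cmeas_hdot; [exact: vmeas_cst|exact: vmeas_of_coords].
have normh w : normc (h w) = normc (f w * cexp (al%:C * hdot z w / 2)) * expR (- (al * sqnorm w / 2)).
  by rewrite normcM normcR ger0_norm ?expR_ge0.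
have := gauss_mean_value a0 FE.
rewrite /F hdot0l mulr0 mul0r oppr0 cexp0 mulr1 add0r => <-.
- rewrite -(cint_shift z bh); apply: eq_cintegral => p; exact: (esym (hF _)).
- have normF w : normc (F w) * expR (- (al * sqnorm w / 2)) = normc (h (w + z)).
    by rewrite -hF [RHS]normcM normcR ger0_norm ?expR_ge0.
  rewrite (_ : (fun w => _) = fun w => normc (h (w + z))); last exact/funext.
  have E := nnint_shift z (borel_normc bh) (fun w => normc_ge0 _).
  rewrite /fin_nnint [X in (X < _)%E]E.
  have -> : (fun w => normc (h w)) = _ := funext normh.
  exact: foo.
Qed.

End mean_value.

(** * Borel representatives of Lebesgue measurable functions *)

Section integral_off_null.
Context d (T : measurableType d) (R : realType) (mu : {measure set T -> \bar R}).
Import HBNNSimple.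
Local Open Scope ereal_scope.

Let ge0_le_off_null (M : set T) (f g : T -> \bar R) : measurable M -> mu M = 0 ->
  (forall x, ~ M x -> f x = g x) -> (forall x, 0 <= f x) -> (forall x, 0 <= g x) ->
  \int[mu]_x f x <= \int[mu]_x g x.
Proof.
move=> mM M0 fg f0 g0; rewrite !ge0_integralTE //.
have mCM : measurable (~` M) by exact: measurableC.
apply: ge_ereal_sup => _ [h /= hf <-].
(* Cutting the simple function h off on the null set keeps its integral and puts it below g
   everywhere. *)
have -> : sintegral mu h = sintegral mu (proj_nnsfun h mCM).
  rewrite -!integralT_nnsfun; apply: ge0_ae_eq_integral => //.
  - exact/measurable_EFinP.
  - exact/measurable_EFinP.
  - by move=> x _; rewrite lee_fin.
  - by move=> x _; rewrite lee_fin.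
  - exists M; split => // x /= nx; apply: contrapT => Mx; apply: nx => _.
    by rewrite mindicE mem_set // mulr1.
apply: ereal_sup_ubound; exists (proj_nnsfun h mCM) => // x /=.
rewrite mindicE; have [/set_mem Mx|] := boolP (x \in ~` M).
  by rewrite mulr1 -(fg x Mx); exact: hf.
by rewrite mulr0 g0.
Qed.

(* No measurability of f or g is needed: the integral of a nonnegative function is a
   supremum over the simple functions below it. *)
Lemma ge0_eq_integral_off_null (M : set T) (f g : T -> \bar R) : measurable M -> mu M = 0 ->
  (forall x, ~ M x -> f x = g x) -> (forall x, 0 <= f x) -> (forall x, 0 <= g x) ->
  \int[mu]_x f x = \int[mu]_x g x.
Proof.
move=> mM M0 fg f0 g0; apply/eqP; rewrite eq_le; apply/andP; split.
- exact: (ge0_le_off_null mM).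
- by apply: (ge0_le_off_null mM) => // x /fg.
Qed.

Lemma eq_integral_off_null (M : set T) (f g : T -> \bar R) : measurable M -> mu M = 0 ->
  (forall x, ~ M x -> f x = g x) -> \int[mu]_x f x = \int[mu]_x g x.
Proof.
move=> mM M0 fg; rewrite integralE [RHS]integralE.
congr (_ - _); apply: (ge0_eq_integral_off_null mM) => // x Mx.
- by rewrite !funeposE fg.
- by rewrite !funenegE fg.
Qed.

End integral_off_null.

Section borel_version.
Context d (T : measurableType d) (R : realType) (mu : {measure set T -> \bar R}).

(** The hypothesis is applied to the half-lines beyond the rationals q: each preimage is a
    measurable set up to a null part, and M contains all of these countably many null parts. Any
    larger measurable M' may serve as exceptional set, so that real and imaginary parts can share
    one. *)
Lemma measurable_off_null (u : T -> R) :
  (forall Y : set (measurableTypeR R), measurable Y ->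
     completed_algebra_gen mu (u @^-1` Y)) ->
  exists M, [/\ measurable M, mu M = 0%E & forall M', measurable M' -> M `<=` M' ->
    measurable_fun setT (fun x => if x \in M' then 0 else u x)].
Proof.
move=> hu.
have hq (q : rat) : exists AN : set T * set T, [/\ measurable AN.1, mu.-negligible AN.2 &
    [set x | ratr q < u x] = AN.1 `|` AN.2].
  have [|A mA [N nN AN]] := hu `]ratr q, +oo[%classic; first exact: measurable_itv.
  exists (A, N); split => //=; rewrite AN; apply/seteqP; split => x /=;
    by rewrite in_itv /= andbT.
pose AN q := projT1 (cid (hq q)).
have hAN q : [/\ measurable (AN q).1, mu.-negligible (AN q).2 &
    [set x | ratr q < u x] = (AN q).1 `|` (AN q).2] by exact: (projT2 (cid (hq q))).
pose F k := if unpickle k is Some q then (AN q).2 else set0.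
have : mu.-negligible (\bigcup_k F k).
  apply: negligible_bigcup => k; rewrite /F; case: unpickle => [q|]; first by have [] := hAN q.
  exact: negligible_set0.
move=> [M [mM M0 FM]]; exists M; split => // M' mM' MM'.
apply: (measurability _ (RGenOInfty.measurableE R)) => _ [_ [r ->] <-]; rewrite setTI.
rewrite (_ : _ @^-1` _ = (\bigcup_(q in [set q : rat | r < ratr q]) ((AN q).1 `\` M')) `|`
   (if r < 0 then M' else set0)).
  apply: measurableU; last by case: ifP.
  rewrite bigcup_mkcond; apply: countable_bigcupT_measurable; first exact: countableP.
  move=> q; case: ifP => // _; apply: measurableD => //; by have [] := hAN q.
apply/seteqP; split => x /=.
- rewrite in_itv /= andbT; case: ifPn => [/set_mem M'x r0|/negP xM' rx].
    by right; rewrite r0.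
  have [q qin] := rat_in_itvoo rx; move: qin; rewrite in_itv /= => /andP[rq qx].
  left; exists q => //=; have [_ _ hA] := hAN q.
  have : [set x | ratr q < u x] x by [].
  rewrite hA => -[Ax|Nx]; first by split => // M'x; apply: xM'; exact: mem_set.
  exfalso; apply: xM'; apply/mem_set/MM'/FM; exists (pickle q); first exact: I.
  by rewrite /F pickleK.
- rewrite in_itv /= andbT; case=> [[q /= rq [Ax M'x]]|].
    rewrite memNset //; apply: lt_trans rq _; have [_ _ hA] := hAN q.
    by have : [set x | ratr q < u x] x by rewrite hA; left.
  by case: ifP => // r0 M'x; rewrite mem_set.
Qed.

Lemma completed_of_measurable_off_null (u v : T -> R) (M : set T) :
  measurable_fun setT v -> measurable M -> mu M = 0%E -> (forall x, ~ M x -> u x = v x) ->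
  forall Y : set (measurableTypeR R), measurable Y -> completed_algebra_gen mu (u @^-1` Y).
Proof.
move=> mv mM M0 uv Y mY.
exists (v @^-1` Y `\` M).
  by apply: measurableD => //; rewrite -[X in measurable X]setTI; exact: mv.
exists (u @^-1` Y `&` M).
  by exists M; split => // x [].
apply/seteqP; split => x /=.
  by case=> [[vY nM]|[]//]; rewrite uv.
move=> uY; have [Mx|Mx] := pselect (M x); first by right.
by left; rewrite -uv.
Qed.

End borel_version.

Lemma measureU_null d (T : measurableType d) (R : realType) (mu : {measure set T -> \bar R})
    (M N : set T) : measurable M -> measurable N -> mu M = 0%E -> mu N = 0%E ->
  mu (M `|` N) = 0%E.
Proof.
move=> mM mN M0 N0; apply/negligibleP; first exact: measurableU.
by apply: negligibleU; apply/negligibleP.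
Qed.

(** * Equality almost everywhere *)

Section almost_everywhere.
Context {R : realType} {n : nat}.
Local Notation C := R[i].
Local Notation Cn := 'rV[R[i]]_n.
Local Notation R2 := (measurableTypeR R * measurableTypeR R)%type.
Local Notation Tn := (n.-tuple R2).
Local Notation leb := (@lebC R n).
Implicit Types f g h : Cn -> C.

Definition ae_equal f g := exists M : set Tn, [/\ measurable M, leb M = 0%E &
  forall p, ~ M p -> f (of_coords p) = g (of_coords p)].

Lemma of_coordsK (p : Tn) : to_coords (of_coords p) = p.
Proof.
apply: eq_from_tnth => j; rewrite tnth_mktuple mxE /=.
by case: (tnth p j).
Qed.

Lemma ae_equal_refl f : ae_equal f f.
Proof. by exists set0; split. Qed.

Lemma ae_equal_comp2 (op : Cn -> C -> C -> C) f f' g g' : ae_equal f f' -> ae_equal g g' ->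
  ae_equal (fun z => op z (f z) (g z)) (fun z => op z (f' z) (g' z)).
Proof.
move=> [M [h1 h2 h3]] [N [k1 k2 k3]]; exists (M `|` N); split.
- exact: measurableU.
- exact: measureU_null.
- by move=> p hp; rewrite h3 ?k3 // => ?; apply: hp; [right|left].
Qed.

Lemma ae_equal_comp (op : Cn -> C -> C) f f' : ae_equal f f' ->
  ae_equal (fun z => op z (f z)) (fun z => op z (f' z)).
Proof. by move=> h; exact: (ae_equal_comp2 (fun z a _ => op z a) h h). Qed.

(** Every statement about a Lebesgue measurable symbol can thus be proved for a Borel
    representative, since all integrals involved agree. *)
Lemma lmeasurableP f : lmeasurable f <-> exists2 f0, borel f0 & ae_equal f f0.
Proof.
split.
- move=> hf.
  have [M1 [mM1 M10 hM1]] := measurable_off_null (fun Y mY => (hf Y mY).1).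
  have [M2 [mM2 M20 hM2]] := measurable_off_null (fun Y mY => (hf Y mY).2).
  have mM : measurable (M1 `|` M2) by exact: measurableU.
  exists (fun z => if to_coords z \in M1 `|` M2 then 0 else f z).
    split.
    + have := hM1 _ mM (@subsetUl _ M1 M2); congr measurable_fun.
      by apply/funext => p; rewrite of_coordsK; case: ifP.
    + have := hM2 _ mM (@subsetUr _ M1 M2); congr measurable_fun.
      by apply/funext => p; rewrite of_coordsK; case: ifP.
  exists (M1 `|` M2); split => //; first exact: measureU_null.
  by move=> p hp; rewrite of_coordsK memNset.
- move=> [f0 [m1 m2] [M [mM M0 hM]]] Y mY; split.
  + by apply: (completed_of_measurable_off_null m1 mM M0) => // p /hM ->.
  + by apply: (completed_of_measurable_off_null m2 mM M0) => // p /hM ->.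
Qed.

Lemma borel_lmeasurable f : borel f -> lmeasurable f.
Proof. by move=> bf; apply/lmeasurableP; exists f => //; exact: ae_equal_refl. Qed.

Lemma ae_equal_cint f g : ae_equal f g -> cint f = cint g.
Proof.
move=> [M [mM M0 fg]]; apply: complex_eq; rewrite /= /Rintegral; congr fine;
  by apply: (eq_integral_off_null mM M0) => p /fg ->.
Qed.

Lemma ae_equal_nnint (u : Cn -> C -> R) f g : ae_equal f g ->
  nnint (fun z => u z (f z)) = nnint (fun z => u z (g z)).
Proof.
by move=> [M [mM M0 fg]]; apply: (eq_integral_off_null mM M0) => p /fg ->.
Qed.

End almost_everywhere.

(** The best s is sqrt B / sqrt A. This turns a family of Young inequalities, each integrable
    termwise, into Cauchy-Schwarz; it serves both the inner product and the Schur test. *)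
Lemma le_sqrt_mul (R : rcfType) (X A B : R) : 0 <= X -> 0 <= A -> 0 <= B ->
  (forall s, 0 < s -> 2 * X <= s * A + s^-1 * B) -> X <= Num.sqrt A * Num.sqrt B.
Proof.
move=> X0 A0 B0 h.
have [A00|A1] := eqVneq A 0.
  rewrite A00 sqrtr0 mul0r leNgt; apply/negP => X1.
  have B1 : 0 < B + 1 by rewrite ltr_wpDl.
  (* When A vanishes no s is optimal, but a large one already excludes X > 0. *)
  have := h ((B + 1) / X) (divr_gt0 B1 X1).
  rewrite A00 mulr0 add0r invf_div mulrAC ler_pdivlMr //.
  move=> h1; have : 2 * X * (B + 1) > X * B by nra.
  by rewrite ltNge h1.
have [B00|B1] := eqVneq B 0.
  rewrite B00 sqrtr0 mulr0 leNgt; apply/negP => X1.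
  have A2 : 0 < A + 1 by rewrite ltr_wpDl.
  have := h (X / (A + 1)) (divr_gt0 X1 A2).
  rewrite B00 mulr0 addr0 mulrAC ler_pdivlMr // => h1.
  have : 2 * X * (A + 1) > X * A by nra.
  by rewrite ltNge h1.
have a0 : 0 < Num.sqrt A by rewrite sqrtr_gt0 lt_def A1.
have b0 : 0 < Num.sqrt B by rewrite sqrtr_gt0 lt_def B1.
have := h (Num.sqrt B / Num.sqrt A) (divr_gt0 b0 a0).
rewrite (_ : _ + _ = 2 * (Num.sqrt A * Num.sqrt B)) ?ler_pM2l //.
transitivity (Num.sqrt B / Num.sqrt A * Num.sqrt A ^+ 2 +
  (Num.sqrt B / Num.sqrt A)^-1 * Num.sqrt B ^+ 2); first by rewrite !sqr_sqrtr.
by field; rewrite !lt0r_neq0.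
Qed.

Lemma conjcM (R : realType) (z w : R[i]) : conjc (z * w) = conjc z * conjc w.
Proof. by rewrite rmorphM. Qed.

(** * Square integrable functions *)

Section square_integrable.
Context {R : realType} {n : nat}.
Local Notation C := R[i].
Local Notation Cn := 'rV[R[i]]_n.
Local Notation R2 := (measurableTypeR R * measurableTypeR R)%type.
Local Notation Tn := (n.-tuple R2).
Local Notation leb := (@lebC R n).
Implicit Types (f g h : Cn -> C) (z w : Cn).

Lemma gaussE z : gauss z = (2 * pi) ^- n * expR (- (1 * sqnorm z / 2)).
Proof. by rewrite /gauss mul1r mulNr. Qed.

Lemma gauss_norm_gt0 : 0 < (2 * pi) ^- n :> R.
Proof. by rewrite invr_gt0 exprn_gt0 // two_pi_gt0. Qed.

Lemma gauss_ge0 z : 0 <= gauss z.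
Proof. by rewrite mulr_ge0 ?expR_ge0 // ltW // gauss_norm_gt0. Qed.

Lemma rborel_gauss1 : rborel (@gauss R n).
Proof.
rewrite /rborel; under eq_fun do rewrite gaussE.
by apply: measurable_funM; [exact: measurable_cst|exact: rborel_gauss].
Qed.

Lemma nnintZl (u : Cn -> R) (c : R) : rborel u -> (forall z, 0 <= u z) -> 0 <= c ->
  nnint (fun z => c * u z) = (c%:E * nnint u)%E.
Proof. by move=> mu u0 c0; rewrite -(@fintZl _ _ _ leb (fun p => u (of_coords p))). Qed.

Lemma nnintD (u v : Cn -> R) : rborel u -> rborel v ->
  (forall z, 0 <= u z) -> (forall z, 0 <= v z) ->
  nnint (fun z => u z + v z) = (nnint u + nnint v)%E.
Proof.
move=> mu mv u0 v0.
by rewrite -(@fintD _ _ _ leb (fun p => u (of_coords p)) (fun p => v (of_coords p))).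
Qed.

Lemma le_nnint (u v : Cn -> R) : rborel u -> rborel v -> (forall z, 0 <= u z) ->
  (forall z, u z <= v z) -> (nnint u <= nnint v)%E.
Proof.
move=> mu mv u0 uv.
by apply: (@le_fint _ _ _ leb (fun p => u (of_coords p)) (fun p => v (of_coords p))).
Qed.

Lemma nnint_ge0 (u : Cn -> R) : (forall z, 0 <= u z) -> (0 <= nnint u)%E.
Proof. by move=> u0; apply: integral_ge0 => p _; rewrite lee_fin. Qed.

Lemma borelM f g : borel f -> borel g -> borel (fun z => f z * g z).
Proof. exact: cmeasM. Qed.

Lemma borelR (u : Cn -> R) : rborel u -> borel (fun z => (u z)%:C).
Proof. exact: cmeasR. Qed.

Lemma rborel_sq f : borel f -> rborel (fun z => normc (f z) ^+ 2 * gauss z).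
Proof.
move=> bf; apply: measurable_funM; last exact: rborel_gauss1.
by apply: measurable_funX; exact: measurable_normc.
Qed.

Lemma sq_gauss_ge0 f z : 0 <= normc (f z) ^+ 2 * gauss z.
Proof. by rewrite mulr_ge0 ?gauss_ge0 // exprn_ge0 // normc_ge0. Qed.

(* Borel rather than Lebesgue measurability; every element of L2 agrees almost
   everywhere with such a function. *)
Definition bL2 f := borel f /\ (sqL2norm f < +oo)%E.

Lemma sqL2norm_ge0 f : (0 <= sqL2norm f)%E.
Proof. by apply: nnint_ge0 => z; exact: sq_gauss_ge0. Qed.

Lemma ae_equal_sqL2norm f g : ae_equal f g -> sqL2norm f = sqL2norm g.
Proof. by move=> h; exact: (ae_equal_nnint (fun z a => normc a ^+ 2 * gauss z) h). Qed.

Lemma L2P f : L2 f <-> exists2 f0, bL2 f0 & ae_equal f f0.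
Proof.
split.
- move=> [/lmeasurableP [f0 bf0 ff0] foo]; exists f0 => //; split => //.
  by rewrite -(ae_equal_sqL2norm ff0).
- move=> [f0 [bf0 foo] ff0]; split; first by apply/lmeasurableP; exists f0.
  by rewrite (ae_equal_sqL2norm ff0).
Qed.

Lemma bL2_L2 f : bL2 f -> L2 f.
Proof. by move=> bf; apply/L2P; exists f => //; exact: ae_equal_refl. Qed.

Lemma fock_bL2 f : fock f -> bL2 f.
Proof. by move=> [fe [_ foo]]; split => //; exact: entire_borel. Qed.

Lemma fockE f : entire f -> (sqL2norm f < +oo)%E -> fock f.
Proof. by move=> fe foo; split => //; apply: bL2_L2; split => //; exact: entire_borel. Qed.

Lemma L2norm_ge0 f : 0 <= L2norm f.
Proof. exact: sqrtr_ge0. Qed.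

Lemma fine_sqL2norm_ge0 f : 0 <= fine (sqL2norm f).
Proof. by rewrite fine_ge0 // sqL2norm_ge0. Qed.

Lemma L2norm_sq f : L2norm f ^+ 2 = fine (sqL2norm f).
Proof. by rewrite sqr_sqrtr // fine_sqL2norm_ge0. Qed.

Lemma bL2_fineK f : bL2 f -> (fine (sqL2norm f))%:E = sqL2norm f.
Proof. by move=> [_ foo]; rewrite fineK // ge0_fin_numE // sqL2norm_ge0. Qed.

Lemma L2norm_le f (B : R) : bL2 f -> 0 <= B -> (sqL2norm f <= (B ^+ 2)%:E)%E -> L2norm f <= B.
Proof.
move=> bf B0 h; rewrite -(@ler_pXn2r _ 2) ?nnegrE ?L2norm_ge0 // L2norm_sq.
by rewrite -lee_fin bL2_fineK.
Qed.

Lemma bL2_weighted f (u : R) : bL2 f -> 0 <= u ->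
  nnint (fun z => u * (normc (f z) ^+ 2 * gauss z)) = (u * fine (sqL2norm f))%:E.
Proof.
move=> bf u0; rewrite nnintZl ?EFinM ?bL2_fineK //.
- by apply: rborel_sq; have [] := bf.
- by move=> z; exact: sq_gauss_ge0.
Qed.

Lemma inner_young f h z (s : R) : 0 < s ->
  2 * normc (f z * conjc (h z) * (gauss z)%:C) <=
  s * (normc (f z) ^+ 2 * gauss z) + s^-1 * (normc (h z) ^+ 2 * gauss z).
Proof.
move=> s0; rewrite !normcM normcR normc_conj (ger0_norm (gauss_ge0 z)).
rewrite -subr_ge0 (_ : _ - _ = s * (normc (f z) - s^-1 * normc (h z)) ^+ 2 * gauss z).
  by rewrite mulr_ge0 ?gauss_ge0 // mulr_ge0 ?sqr_ge0 // ltW.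
by field; rewrite lt0r_neq0.
Qed.

Lemma borel_inner f h : borel f -> borel h -> borel (fun z => f z * conjc (h z) * (gauss z)%:C).
Proof.
move=> bf bh; apply: borelM; last exact: borelR rborel_gauss1.
by apply: borelM => //; exact: cmeas_conj.
Qed.

Lemma nnint_inner_le f h (s : R) : bL2 f -> bL2 h -> 0 < s ->
  (2%:E * nnint (fun z => (normc (f z * conjc (h z) * (gauss z)%:C))%R) <=
   (s * fine (sqL2norm f) + s^-1 * fine (sqL2norm h))%:E)%E.
Proof.
move=> bf bh s0; have bi := borel_inner bf.1 bh.1; have mi := borel_normc bi.
have s1 : 0 <= s^-1 by rewrite invr_ge0 ltW.
rewrite -nnintZl //; last by move=> z; exact: normc_ge0.
rewrite EFinD -!bL2_weighted // ?(ltW s0) // -nnintD; last 4 first.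
- by apply: measurable_funM; [exact: measurable_cst|exact: rborel_sq bf.1].
- by apply: measurable_funM; [exact: measurable_cst|exact: rborel_sq bh.1].
- by move=> z; rewrite mulr_ge0 ?sq_gauss_ge0 // ltW.
- by move=> z; rewrite mulr_ge0 ?sq_gauss_ge0.
apply: le_nnint.
- by apply: measurable_funM => //; exact: measurable_cst.
- apply: measurable_funD; apply: measurable_funM; try exact: measurable_cst.
  + exact: rborel_sq bf.1.
  + exact: rborel_sq bh.1.
- by move=> z; rewrite mulr_ge0 ?normc_ge0.
- by move=> z; exact: inner_young.
Qed.

Lemma inner_integrable f h : bL2 f -> bL2 h ->
  cn_integrable (fun z => f z * conjc (h z) * (gauss z)%:C).
Proof.
move=> bf bh; split; first exact: borel_inner bf.1 bh.1.
have := nnint_inner_le bf bh ltr01.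
set I := nnint _; rewrite -/I; have I0 : (0 <= I)%E.
  by apply: nnint_ge0 => z; exact: normc_ge0.
move=> hI; suff : (I < +oo)%E by [].
case: I I0 hI => [r| |] //= _; first by rewrite ltry.
by rewrite gt0_muley ?lte_fin.
Qed.

Lemma L2inner_CS f h : bL2 f -> bL2 h -> normc (L2inner f h) <= L2norm f * L2norm h.
Proof.
move=> bf bh; apply: le_sqrt_mul; rewrite ?normc_ge0 ?fine_sqL2norm_ge0 //.
move=> s s0; rewrite -lee_fin (le_trans _ (nnint_inner_le bf bh s0)) //.
rewrite EFinM lee_pmul2l //; exact: normc_cintegral_le (inner_integrable bf bh).
Qed.

Lemma L2inner_conj f h : bL2 f -> bL2 h -> conjc (L2inner f h) = L2inner h f.
Proof.
move=> bf bh; rewrite -(cintegral_conj (inner_integrable bf bh)).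
apply: eq_cintegral => p; rewrite !conjcM conjcK conjc_real; congr (_ * _).
by rewrite mulrC.
Qed.

Lemma L2inner_self f : bL2 f -> L2inner f f = (L2norm f ^+ 2)%:C.
Proof.
move=> bf; rewrite L2norm_sq.
rewrite -(cintegralR leb (u := fun p => normc (f (of_coords p)) ^+ 2 * gauss (of_coords p))).
  by apply: eq_cintegral => p; rewrite mul_conj -RcM.
by move=> p; exact: sq_gauss_ge0.
Qed.

Lemma bL2D f h : bL2 f -> bL2 h -> bL2 (fun z => f z + h z).
Proof.
move=> bf bh; split; first exact: cmeasD bf.1 bh.1.
apply: (@le_lt_trans _ _ (nnint (fun z => (2 * (normc (f z) ^+ 2 * gauss z) +
    2 * (normc (h z) ^+ 2 * gauss z))%R))).
  apply: le_nnint.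
  - exact: rborel_sq (cmeasD bf.1 bh.1).
  - apply: measurable_funD; apply: measurable_funM; try exact: measurable_cst.
    + exact: rborel_sq bf.1.
    + exact: rborel_sq bh.1.
  - exact: (sq_gauss_ge0 (fun z => f z + h z)).
  - move=> z; rewrite -mulrDr -mulrDl mulrA ler_wpM2r ?gauss_ge0 //.
    have h1 := normcD (f z) (h z); have h2 := normc_ge0 (f z + h z).
    rewrite (@le_trans _ _ ((normc (f z) + normc (h z)) ^+ 2)) //.
      by rewrite lerXn2r ?nnegrE ?addr_ge0 ?normc_ge0.
    rewrite -subr_ge0 (_ : _ - _ = (normc (f z) - normc (h z)) ^+ 2) ?sqr_ge0 //; ring.
rewrite nnintD.
- by rewrite !bL2_weighted // -EFinD ltry.
- by apply: measurable_funM; [exact: measurable_cst|exact: rborel_sq bf.1].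
- by apply: measurable_funM; [exact: measurable_cst|exact: rborel_sq bh.1].
- by move=> z; rewrite mulr_ge0 ?sq_gauss_ge0.
- by move=> z; rewrite mulr_ge0 ?sq_gauss_ge0.
Qed.

Lemma sqL2normZ f (c : C) : bL2 f ->
  sqL2norm (fun z => c * f z) = (normc c ^+ 2 * fine (sqL2norm f))%:E.
Proof.
move=> bf; rewrite -bL2_weighted ?exprn_ge0 ?normc_ge0 //.
by apply: eq_integral => p _; rewrite normcM exprMn -mulrA.
Qed.

Lemma bL2Z f (c : C) : bL2 f -> bL2 (fun z => c * f z).
Proof.
move=> bf; split; first by apply: cmeasM; [exact: cmeas_cst|exact: bf.1].
by rewrite sqL2normZ // ltry.
Qed.

Lemma bL2B f h : bL2 f -> bL2 h -> bL2 (fun z => f z - h z).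
Proof.
move=> bf bh; have := bL2D bf (bL2Z (-1) bh).
by congr bL2; apply/funext => z; rewrite mulN1r.
Qed.

Lemma L2innerDl f g h : bL2 f -> bL2 g -> bL2 h ->
  L2inner (fun z => f z + g z) h = L2inner f h + L2inner g h.
Proof.
move=> bf bg bh; rewrite -(cintegralD (inner_integrable bf bh) (inner_integrable bg bh)).
by apply: eq_cintegral => p; rewrite !mulrDl.
Qed.

Lemma L2innerZl f h (c : C) : bL2 f -> bL2 h ->
  L2inner (fun z => c * f z) h = c * L2inner f h.
Proof.
move=> bf bh; rewrite -(cintegralZl c (inner_integrable bf bh)).
by apply: eq_cintegral => p; rewrite !mulrA.
Qed.

Lemma L2innerBl f g h : bL2 f -> bL2 g -> bL2 h ->
  L2inner (fun z => f z - g z) h = L2inner f h - L2inner g h.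
Proof.
move=> bf bg bh; rewrite -(cintegralB (inner_integrable bf bh) (inner_integrable bg bh)).
by apply: eq_cintegral => p; rewrite !mulrBl.
Qed.

Lemma ae_equal_L2inner f g h : ae_equal f g -> L2inner f h = L2inner g h.
Proof.
move=> fg; apply: ae_equal_cint.
exact: (ae_equal_comp (fun z a => a * conjc (h z) * (gauss z)%:C) fg).
Qed.

Lemma fockD f h : fock f -> fock h -> fock (fun z => f z + h z).
Proof.
move=> ff fh; have [b boo] := bL2D (fock_bL2 ff) (fock_bL2 fh).
by apply: fockE boo; exact: entireD ff.1 fh.1.
Qed.

Lemma fockZ f (c : C) : fock f -> fock (fun z => c * f z).
Proof.
move=> ff; have [b boo] := bL2Z c (fock_bL2 ff).
by apply: fockE boo; exact: entireM (entire_cst c) ff.1.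
Qed.

End square_integrable.

Lemma conjcD (R : realType) (z w : R[i]) : conjc (z + w) = conjc z + conjc w.
Proof. by rewrite rmorphD. Qed.

Lemma conjcB (R : realType) (z w : R[i]) : conjc (z - w) = conjc z - conjc w.
Proof. by rewrite rmorphB. Qed.

(** * The reproducing kernel and the projection onto Fock space *)

Section kernels.
Context {R : realType} {n : nat}.
Local Notation C := R[i].
Local Notation Cn := 'rV[R[i]]_n.
Local Notation R2 := (measurableTypeR R * measurableTypeR R)%type.
Local Notation Tn := (n.-tuple R2).
Local Notation leb := (@lebC R n).
Implicit Types (f g h : Cn -> C) (z w v a b : Cn).

Lemma L2innerZr f h (c : C) : bL2 f -> bL2 h ->
  L2inner f (fun z => c * h z) = conjc c * L2inner f h.
Proof.
move=> bf bh; rewrite -(L2inner_conj (bL2Z c bh) bf) L2innerZl // conjcM.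
by rewrite L2inner_conj.
Qed.

Lemma L2innerDr f g h : bL2 f -> bL2 g -> bL2 h ->
  L2inner h (fun z => f z + g z) = L2inner h f + L2inner h g.
Proof.
move=> bf bg bh; rewrite -(L2inner_conj (bL2D bf bg) bh) L2innerDl // conjcD.
by rewrite !L2inner_conj.
Qed.

Lemma L2innerBr f g h : bL2 f -> bL2 g -> bL2 h ->
  L2inner h (fun z => f z - g z) = L2inner h f - L2inner h g.
Proof.
move=> bf bg bh; rewrite -(L2inner_conj (bL2B bf bg) bh) L2innerBl // conjcB.
by rewrite !L2inner_conj.
Qed.

Lemma bL2_0 : bL2 (fun _ : Cn => 0 : C).
Proof.
split; first exact: cmeas_cst.
rewrite /sqL2norm /nnint; under eq_integral do rewrite normc0 expr0n mul0r.
by rewrite integral0.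
Qed.

Lemma bL2_sum (I : Type) (r : seq I) (F : I -> Cn -> C) : (forall i, bL2 (F i)) ->
  bL2 (fun z => \sum_(i <- r) F i z).
Proof.
move=> hF; elim: r => [|i r IH].
  by under eq_fun do rewrite big_nil; exact: bL2_0.
by under eq_fun do rewrite big_cons; exact: bL2D (hF i) IH.
Qed.

Lemma L2inner_sumr (I : Type) (r : seq I) (F : I -> Cn -> C) h : bL2 h ->
  (forall i, bL2 (F i)) ->
  L2inner h (fun z => \sum_(i <- r) F i z) = \sum_(i <- r) L2inner h (F i).
Proof.
move=> bh hF; elim: r => [|i r IH].
  rewrite big_nil; transitivity (L2inner h (fun z => 0 * 0 : C)).
    by congr L2inner; apply/funext => z; rewrite big_nil mul0r.
  by rewrite (L2innerZr 0 bh bL2_0) conjc0 mul0r.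
rewrite big_cons -IH -L2innerDr //; last exact: bL2_sum.
by congr L2inner; apply/funext => z; rewrite big_cons.
Qed.

Lemma sqL2norm_mono f g (c : R) : borel f -> bL2 g -> 0 <= c ->
  (forall z, normc (f z) <= c * normc (g z)) ->
  (sqL2norm f <= (c ^+ 2 * fine (sqL2norm g))%:E)%E.
Proof.
move=> bf bg c0 fg; rewrite -bL2_weighted ?exprn_ge0 //.
apply: le_nnint.
- exact: rborel_sq.
- by apply: measurable_funM; [exact: measurable_cst|exact: rborel_sq bg.1].
- by move=> z; exact: sq_gauss_ge0.
- move=> z; rewrite [leRHS]mulrA -exprMn ler_wpM2r ?gauss_ge0 //.
  by rewrite lerXn2r ?nnegrE ?normc_ge0 // mulr_ge0 ?normc_ge0.
Qed.

Lemma bL2_dom f g (c : R) : borel f -> bL2 g -> 0 <= c ->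
  (forall z, normc (f z) <= c * normc (g z)) -> bL2 f.
Proof.
move=> bf bg c0 fg; split => //.
by rewrite (le_lt_trans (sqL2norm_mono bf bg c0 fg)) // ltry.
Qed.

Lemma L2norm_mono f g (c : R) : borel f -> bL2 g -> 0 <= c ->
  (forall z, normc (f z) <= c * normc (g z)) -> L2norm f <= c * L2norm g.
Proof.
move=> bf bg c0 fg; apply: L2norm_le.
- exact: bL2_dom fg.
- by rewrite mulr_ge0 // L2norm_ge0.
- by rewrite exprMn L2norm_sq; exact: sqL2norm_mono.
Qed.

(** The exponent 1/8 doubles to 1/4 in |f|^2, and against the density of mu this leaves the
    integrable weight e^(-|w|^2/4). *)
Lemma bL2_growth f (B : R) : borel f ->
  (forall w, normc (f w) <= B * expR (sqnorm w / 8)) -> bL2 f.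
Proof.
move=> bf fB; have B0 : 0 <= B.
  have := fB 0; rewrite -(pmulr_lge0 _ (expR_gt0 (sqnorm (0 : Cn) / 8))).
  exact: le_trans (normc_ge0 _).
pose E (w : Cn) : R := expR (- (2^-1 * sqnorm w / 2)).
split => //; apply: (@le_lt_trans _ _ (nnint (fun w => B ^+ 2 * (2 * pi) ^- n * E w)%R)).
  apply: le_nnint.
  - exact: rborel_sq.
  - by apply: measurable_funM; [exact: measurable_cst|exact: rborel_gauss].
  - by move=> z; exact: sq_gauss_ge0.
  - move=> w; rewrite gaussE.
    have -> : B ^+ 2 * (2 * pi) ^- n * E w =
       (B * expR (sqnorm w / 8)) ^+ 2 * ((2 * pi) ^- n * expR (- (1 * sqnorm w / 2))).
      rewrite (exprMn 2 B) -expRM_natl.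
      rewrite (_ : E w = expR (2%:R * (sqnorm w / 8)) * expR (- (1 * sqnorm w / 2))).
        by ring.
      by rewrite -expRD; congr expR; field.
    rewrite ler_wpM2r ?mulr_ge0 ?expR_ge0 ?(ltW (gauss_norm_gt0)) //.
    by rewrite lerXn2r ?nnegrE ?normc_ge0 // mulr_ge0 ?expR_ge0.
rewrite nnintZl.
- by rewrite nnint_gauss ?invr_gt0 // -EFinM ltry.
- exact: rborel_gauss.
- by move=> z; exact: expR_ge0.
- by rewrite mulr_ge0 ?exprn_ge0 // ltW // gauss_norm_gt0.
Qed.

(** The reproducing kernel of F^2 at z; [kernel_fun z] is this vector divided by its norm
    e^(|z|^2/4). *)
Definition kern z w : C := cexp (hdot w z / 2).

Lemma kern_entire z : entire (kern z).
Proof.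
have := @entire_cexp_linear R n (fun j => conjc (z 0 j) / 2) 0.
congr entire; apply/funext => w; rewrite addr0 /kern /hdot mulr_suml; congr cexp.
by apply: eq_bigr => j _; rewrite mulrA.
Qed.

Lemma Re_half (c : C) : complex.Re (c / 2) = complex.Re c / 2.
Proof.
rewrite (_ : c / 2 = (2^-1)%:C * c); first by rewrite ReZl mulrC.
by rewrite mulrC fmorphV /= rmorph_nat.
Qed.

Lemma normc_kern z w : normc (kern z w) = expR (complex.Re (hdot z w) / 2).
Proof.
rewrite normc_cexp Re_half; congr (expR (_ / 2)).
by rewrite -(hdot_conj z w); case: (hdot z w).
Qed.

Lemma Re_hdot_le z w : complex.Re (hdot z w) <= sqnorm w / 8 + 2 * sqnorm z.
Proof.
have := @normc_hdot_le R n 4 z w; rewrite ltr0n => /(_ isT).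
have := Re_le_normc (hdot z w); have := ler_norm (complex.Re (hdot z w)); lra.
Qed.

Definition l1norm w : R := \sum_j normc (w 0 j).

Lemma l1norm_ge0 w : 0 <= l1norm w.
Proof. by apply: sumr_ge0 => j _; exact: normc_ge0. Qed.

Lemma normc_entry_le w j : normc (w 0 j) <= l1norm w.
Proof.
rewrite /l1norm (bigD1 j) //= lerDl; apply: sumr_ge0 => i _; exact: normc_ge0.
Qed.

Lemma l1norm_le w : l1norm w <= sqnorm w / 16 + 4 * n%:R.
Proof.
have -> : 4 * n%:R = \sum_(j < n) (4 : R) by rewrite sumr_const card_ord mulr_natr.
rewrite /l1norm /sqnorm mulr_suml -big_split /=.
apply: ler_sum => j _; rewrite -subr_ge0.
rewrite (_ : _ - _ = (normc (w 0 j) / 4 - 2) ^+ 2); first exact: sqr_ge0.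
by field.
Qed.

Lemma rborel_l1norm : rborel l1norm.
Proof.
apply: measurable_sum => j; apply: measurable_normc; exact: vmeas_of_coords.
Qed.

(** A square integrable majorant that is uniform in small changes of z: e^(l1norm w) absorbs the
    coordinates of w and the change of the exponent when every coordinate of z moves by at most
    1. *)
Definition kern_l1 z w : C := (normc (kern z w) * expR (l1norm w))%:C.

Lemma kern_borel z : borel (kern z).
Proof. exact/entire_borel/kern_entire. Qed.

Lemma kern_l1_bL2 z : bL2 (kern_l1 z).
Proof.
apply: (@bL2_growth _ (expR (sqnorm z + 4 * n%:R))).
  apply: borelR; apply: measurable_funM; first exact: measurable_normc (kern_borel z).
  by apply: measurableT_comp => //; exact: rborel_l1norm.
move=> w; rewrite normcR ger0_norm ?mulr_ge0 ?normc_ge0 ?expR_ge0 // normc_kern -!expRD.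
rewrite ler_expR; have := Re_hdot_le z w; have := l1norm_le w; lra.
Qed.

Lemma normc_kern_l1 z w : normc (kern_l1 z w) = normc (kern z w) * expR (l1norm w).
Proof. by rewrite normcR ger0_norm // mulr_ge0 ?normc_ge0 ?expR_ge0. Qed.

Lemma kern_bL2 z : bL2 (kern z).
Proof.
apply: (@bL2_dom _ (kern_l1 z) 1) => //; [exact: kern_borel|exact: kern_l1_bL2|].
move=> w; rewrite mul1r normc_kern_l1 ler_peMr ?normc_ge0 //.
by rewrite -expR0 ler_expR l1norm_ge0.
Qed.

Lemma kern_fock z : fock (kern z).
Proof. by apply: fockE (kern_bL2 z).2; exact: kern_entire. Qed.

Lemma conjc_kern z w : conjc (kern z w) = kern w z.
Proof.
rewrite /kern conj_cexp conjcM hdot_conj; congr (cexp (_ * _)).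
by rewrite conjc_inv conjc_nat.
Qed.

Lemma fock_reproducing f z : fock f -> f z = L2inner f (kern z).
Proof.
move=> ff; have bf := fock_bL2 ff; have bi := inner_integrable bf (kern_bL2 z).
have c0 : (((2 * pi) ^+ n)%:C : C) != 0.
  by rewrite -normc_eq0 normcR normr_eq0 expf_neq0 // lt0r_neq0 // two_pi_gt0.
pose G w := f w * cexp (1%:C * hdot z w / 2) * (expR (- (1 * sqnorm w / 2)))%:C.
have GE w : G w = ((2 * pi) ^+ n)%:C * (f w * conjc (kern z w) * (gauss w)%:C).
  rewrite /G conjc_kern /kern (_ : 1%:C = 1 :> C) // !mul1r gaussE mul1r RcM fmorphV /=.
  by field.
have iG : cn_integrable G.
  have := cintegrableZl ((2 * pi) ^+ n)%:C bi.
  by congr cintegrable; apply/funext => p; rewrite GE.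
have := @gauss_reproducing R n 1 f z ltr01 ff.1.
rewrite divr1 => h; have {}h : cint G = ((2 * pi) ^+ n)%:C * f z.
  apply: h; have [_] := iG; congr (_ < _)%E; apply: eq_integral => p _.
  by rewrite normcM normcR ger0_norm // expR_ge0.
apply: (mulfI c0); rewrite -h -(cintegralZl ((2 * pi) ^+ n)%:C bi).
by apply: eq_cintegral => p; rewrite GE.
Qed.

Lemma L2norm_kern z : L2norm (kern z) ^+ 2 = expR (sqnorm z / 2).
Proof.
apply: complexI; rewrite -L2inner_self; last exact: kern_bL2.
rewrite -(fock_reproducing z (kern_fock z)) /kern -sqnormE -cexpR; congr cexp.
by rewrite rmorphM fmorphV /= rmorph_nat.
Qed.

Lemma kernel_funE a w : kernel_fun a w = (expR (- (sqnorm a / 4)))%:C * kern a w.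
Proof. by rewrite -cexpR -cexpD rmorphN addrC. Qed.

Lemma kernel_fun_fock a : fock (kernel_fun a).
Proof.
rewrite (_ : kernel_fun a = fun w => (expR (- (sqnorm a / 4)))%:C * kern a w).
  by apply: fockZ; exact: kern_fock.
by apply/funext => w; exact: kernel_funE.
Qed.

Lemma L2norm_kernel_fun a : L2norm (kernel_fun a) = 1.
Proof.
have h : L2norm (kernel_fun a) ^+ 2 = 1.
  apply: complexI; rewrite -L2inner_self; last exact/fock_bL2/kernel_fun_fock.
  rewrite (_ : kernel_fun a = fun w => (expR (- (sqnorm a / 4)))%:C * kern a w); last first.
    by apply/funext => w; exact: kernel_funE.
  rewrite L2innerZl ?L2innerZr; try exact: kern_bL2; last exact/bL2Z/kern_bL2.
  rewrite L2inner_self; last exact: kern_bL2.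
  rewrite L2norm_kern conjc_real -!RcM -!expRD; congr _%:C.
  by rewrite -[RHS]expR0; congr expR; field.
by apply/eqP; rewrite -(@pexpr_eq1 _ _ 2) ?L2norm_ge0 // h.
Qed.

Lemma fock_eq0 f : fock f -> L2norm f = 0 -> forall z, f z = 0.
Proof.
move=> ff f0 z; rewrite (fock_reproducing z ff); apply/eqP; rewrite -normc_eq0 eq_le normc_ge0 andbT.
by have := L2inner_CS (fock_bL2 ff) (kern_bL2 z); rewrite f0 mul0r.
Qed.

(** Taylor's formula for the kernel in its parameter. The majorant does not depend on v, which
    permits differentiation under the integral in [proj_int_entire]. *)
Lemma kern_increment z v w (r : R) : (forall j, normc (v 0 j) <= r) -> 0 <= r <= 1 ->
  normc (kern (v + z) w - kern z w - kern z w * (hdot w v / 2)) <=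
  4 * r ^+ 2 * normc (kern_l1 z w).
Proof.
move=> vr /andP[r0 r1]; pose x := l1norm w / 2.
have x0 : 0 <= x by rewrite divr_ge0 // l1norm_ge0.
have n2 : normc (2^-1 : C) = 2^-1.
  rewrite (_ : 2^-1 = (2^-1)%:C); first by rewrite normcR ger0_norm ?invr_ge0.
  by rewrite fmorphV /= rmorph_nat.
have hx : normc (hdot w v / 2) <= r * x.
  rewrite normcM n2 /x mulrA ler_wpM2r ?invr_ge0 //.
  rewrite /hdot (le_trans (normc_sum _ _ _)) // /l1norm mulr_sumr; apply: ler_sum => j _.
  by rewrite normcM normc_conj mulrC ler_wpM2r ?normc_ge0.
have -> : kern (v + z) w = kern z w * cexp (hdot w v / 2).
  by rewrite /kern hdotDr mulrDl addrC cexpD.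
rewrite (_ : _ - _ = kern z w * (cexp (hdot w v / 2) - 1 - hdot w v / 2)); last by ring.
rewrite normcM normc_kern_l1 mulrCA ler_wpM2l ?normc_ge0 //.
rewrite (le_trans (cexp_remainder2 _)) //.
have -> : expR (l1norm w) = expR x * expR x by rewrite -expRD; congr expR; rewrite /x; field.
have x2 : x ^+ 2 <= 4 * expR x.
  have := @expR_ge1Dx R (x / 2); have e0 := expR_gt0 (x / 2).
  have -> : expR x = expR (x / 2) * expR (x / 2) by rewrite -expRD; congr expR; field.
  move=> h; suff : (1 + x / 2) * (1 + x / 2) <= expR (x / 2) * expR (x / 2) by nra.
  by apply: ler_pM => //; rewrite addr_ge0 // divr_ge0.
have -> : 4 * r ^+ 2 * (expR x * expR x) = expR x * (r ^+ 2 * (4 * expR x)) by ring.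
apply: ler_pM; rewrite ?expR_ge0 ?exprn_ge0 ?normc_ge0 //.
  by rewrite ler_expR (le_trans hx) // ler_piMl.
rewrite (@le_trans _ _ ((r * x) ^+ 2)) //.
  by rewrite lerXn2r ?nnegrE ?normc_ge0 // mulr_ge0.
by rewrite exprMn ler_wpM2l // exprn_ge0.
Qed.

(* The kernel formula for the projection; kern z w = e^{<w,z>/2}. *)
Definition proj_int h z : C := L2inner h (kern z).

Lemma kern_coord_bL2 z (j : 'I_n) : bL2 (fun w => kern z w * (w 0 j / 2)).
Proof.
apply: (@bL2_dom _ (kern_l1 z) 1) => //; last 2 first.
- exact: kern_l1_bL2.
- move=> w; rewrite mul1r normc_kern_l1 normcM ler_wpM2l ?normc_ge0 //.
  rewrite normcM (_ : normc 2^-1 = 2^-1); last first.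
    rewrite (_ : (2^-1 : C) = (2^-1)%:C); first by rewrite normcR ger0_norm ?invr_ge0.
    by rewrite fmorphV /= rmorph_nat.
  have h1 := normc_entry_le w j; have h2 := @expR_ge1Dx R (l1norm w).
  have h3 := normc_ge0 (w 0 j); lra.
apply: cmeasM; first exact: kern_borel.
by apply: cmeasM; [exact: vmeas_of_coords|exact: cmeas_cst].
Qed.

(** Differentiation under the integral sign: pairing h with the linear part of the kernel increment
    gives the differential, and Cauchy-Schwarz with [kern_increment] bounds the rest by r^2. *)
Lemma proj_int_entire h : bL2 h -> entire (proj_int h).
Proof.
move=> bh.
apply: (@entire_of_bound _ _ _ (fun z j => L2inner h (fun w => kern z w * (w 0 j / 2)))
  (fun z => L2norm h * (4 * L2norm (kern_l1 z)))).
  by move=> z; rewrite !mulr_ge0 ?L2norm_ge0.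
move=> z v r vr r01.
pose K w := kern (v + z) w - kern z w - kern z w * (hdot w v / 2).
have bk := kern_bL2 z.
have bG : bL2 (fun w => \sum_j conjc (v 0 j) * (kern z w * (w 0 j / 2))).
  by apply: bL2_sum => j; apply: bL2Z; exact: kern_coord_bL2.
have GE w : kern z w * (hdot w v / 2) = \sum_j conjc (v 0 j) * (kern z w * (w 0 j / 2)).
  rewrite /hdot mulr_suml mulr_sumr; apply: eq_bigr => j _; ring.
have bd := bL2B (kern_bL2 (v + z)) bk.
have KE : K = fun w => (kern (v + z) w - kern z w) - \sum_j conjc (v 0 j) * (kern z w * (w 0 j / 2)).
  by apply/funext => w; rewrite -GE.
have -> : proj_int h (v + z) - proj_int h z -
    \sum_j v 0 j * L2inner h (fun w => kern z w * (w 0 j / 2)) = L2inner h K.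
  rewrite KE (L2innerBr bd bG bh) (L2innerBr (kern_bL2 _) bk bh).
  congr (_ - _); rewrite L2inner_sumr; [|exact: bh|]; last first.
    by move=> j; apply: bL2Z; exact: kern_coord_bL2.
  by apply: eq_bigr => j _; rewrite L2innerZr ?conjcK //; exact: kern_coord_bL2.
have bK : bL2 K by rewrite KE; exact: bL2B.
rewrite (le_trans (L2inner_CS bh bK)) // -mulrA ler_wpM2l ?L2norm_ge0 //.
have r20 : 0 <= 4 * r ^+ 2 by rewrite mulr_ge0 // exprn_ge0 //; case/andP: r01.
rewrite (le_trans (L2norm_mono bK.1 (kern_l1_bL2 z) r20 _)) //.
  by move=> w; exact: kern_increment.
rewrite le_eqVlt; apply/orP; left; apply/eqP; ring.
Qed.

End kernels.

(** * The Schur test and the kernel formula for the projection *)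

Section projection.
Context {R : realType} {n : nat}.
Local Notation C := R[i].
Local Notation Cn := 'rV[R[i]]_n.
Local Notation R2 := (measurableTypeR R * measurableTypeR R)%type.
Local Notation Tn := (n.-tuple R2).
Local Notation leb := (@lebC R n).
Implicit Types (z w : Cn) (f h : Cn -> C) (u k : Cn -> R).

Lemma nnint_reflect u z : rborel u -> (forall w, 0 <= u w) ->
  nnint (fun w => u (z - w)) = nnint u.
Proof.
move=> bu u0; have bN : rborel (fun w => u (- w)).
  apply: (@rborel_comp _ _ _ _ u (fun p : Tn => - of_coords p)) => //.
  have -> : (fun p : Tn => - of_coords p) = (fun p => 0 - of_coords p).
    by apply/funext => p; rewrite sub0r.
  by apply: vmeasB; [exact: vmeas_cst|exact: vmeas_of_coords].
have -> : (fun w => u (z - w)) = (fun w => (fun v => u (- v)) (w + - z)).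
  by apply/funext => w; rewrite opprD opprK addrC.
rewrite (nnint_shift _ bN) //.
rewrite -(@nnint_rot _ _ u (-1)) //; last by rewrite normc_opp normc1.
by congr nnint; apply/funext => w; rewrite scaleN1r.
Qed.

Lemma measurable_conv u k : rborel u -> rborel k ->
  measurable_fun setT (fun p : Tn * Tn => u (of_coords p.2) * k (of_coords p.1 - of_coords p.2)).
Proof.
have v1 : vmeas (fun p : Tn * Tn => of_coords p.1).
  move=> j; apply: (@cmeas_comp _ _ _ _ _ (@fst Tn Tn) (fun q : Tn => of_coords q 0 j)).
    exact: measurable_fst.
  exact: vmeas_of_coords.
have v2 : vmeas (fun p : Tn * Tn => of_coords p.2).
  move=> j; apply: (@cmeas_comp _ _ _ _ _ (@snd Tn Tn) (fun q : Tn => of_coords q 0 j)).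
    exact: measurable_snd.
  exact: vmeas_of_coords.
move=> bu bk; apply: measurable_funM; first exact: rborel_comp.
by apply: rborel_comp => //; exact: vmeasB.
Qed.

Lemma nnint_conv u k (c : R) : rborel u -> rborel k ->
  (forall w, 0 <= u w) -> (forall w, 0 <= k w) -> nnint k = c%:E ->
  (\int[leb]_p nnint (fun w => (u w * k (of_coords p - w))%R) = c%:E * nnint u)%E.
Proof.
move=> bu bk u0 k0 kc; have c0 : 0 <= c by rewrite -lee_fin -kc nnint_ge0.
rewrite /nnint (@fubini_tonelli _ _ _ _ _ leb leb (fun p : Tn * Tn =>
  (u (of_coords p.2) * k (of_coords p.1 - of_coords p.2))%:E)) /=; last 2 first.
- by apply/measurable_EFinP; exact: measurable_conv bu bk.
- by move=> p; rewrite lee_fin mulr_ge0.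
rewrite -[RHS](nnintZl bu u0 c0); apply: eq_integral => q _.
have bs : rborel (fun w => k (w - of_coords q)).
  apply: (@rborel_comp _ _ _ _ k (fun p : Tn => of_coords p - of_coords q)) => //.
  by apply: vmeasB; [exact: vmeas_of_coords|exact: vmeas_cst].
have := nnintZl bs (fun w => k0 _) (u0 (of_coords q)); rewrite /nnint => ->.
have := nnint_shift (- of_coords q) bk k0; rewrite /nnint => ->.
by rewrite -/(nnint k) kc -EFinM mulrC.
Qed.

Definition half_gauss z : R := expR (- (2^-1 * sqnorm z / 2)).

Lemma half_gauss_ge0 z : 0 <= half_gauss z. Proof. exact: expR_ge0. Qed.

Lemma half_gauss_le1 z : half_gauss z <= 1.
Proof. by rewrite -expR0 ler_expR oppr_le0 divr_ge0 // mulr_ge0 ?invr_ge0 // sqnorm_ge0. Qed.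

Lemma rborel_half_gauss : rborel half_gauss. Proof. exact: rborel_gauss. Qed.

Lemma nnint_half_gauss : nnint half_gauss = ((4 * pi) ^+ n)%:E.
Proof. by rewrite nnint_gauss ?invr_gt0 //; congr (_ ^+ _)%:E; field. Qed.

Lemma gauss_half z : gauss z = (2 * pi) ^- n * half_gauss z ^+ 2.
Proof. by rewrite gaussE expr2 -expRD; congr (_ * expR _); field. Qed.

Lemma kern_half_gauss z w : normc (kern z w) * half_gauss w * half_gauss z = half_gauss (z - w).
Proof.
by rewrite normc_kern /half_gauss -!expRD sqnorm_sub; congr expR; field.
Qed.

(* Schur test with weight e^{-|w|^2/4}: conjugated by this weight the kernel becomes
   the convolution kernel e^{-|z - w|^2/4}. *)
Lemma schur_young h z (s : R) w : 0 < s ->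
  2 * (normc (h w * conjc (kern z w) * (gauss w)%:C) * half_gauss z) <=
  s * (normc (h w) ^+ 2 * gauss w * half_gauss (z - w)) +
  s^-1 * ((2 * pi) ^- n * half_gauss (z - w)).
Proof.
move=> s0; rewrite !normcM normc_conj normcR ger0_norm ?gauss_ge0 // gauss_half.
set c := (2 * pi) ^- n; have c0 : 0 <= c by rewrite ltW // gauss_norm_gt0.
set a := normc (h w); set e := half_gauss w.
have -> : 2 * (a * normc (kern z w) * (c * e ^+ 2) * half_gauss z) =
   c * half_gauss (z - w) * (2 * (a * e)) by rewrite -kern_half_gauss -/e; ring.
have -> : s * (a ^+ 2 * (c * e ^+ 2) * half_gauss (z - w)) + s^-1 * (c * half_gauss (z - w)) =
   c * half_gauss (z - w) * (s * (a * e) ^+ 2 + s^-1) by ring.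
rewrite ler_wpM2l ?mulr_ge0 ?half_gauss_ge0 //.
have := sqr_ge0 (s * (a * e) - 1); set y := a * e => h0.
rewrite -(ler_pM2l s0) mulrDr divff ?lt0r_neq0 //; nra.
Qed.

Definition schur_mass h z : \bar R := nnint (fun w => (normc (h w) ^+ 2 * gauss w * half_gauss (z - w))%R).

Lemma rborel_half_gauss_sub z : rborel (fun w => half_gauss (z - w)).
Proof.
apply: (@rborel_comp _ _ _ _ half_gauss (fun p : Tn => z - of_coords p)).
  exact: rborel_half_gauss.
by apply: vmeasB; [exact: vmeas_cst|exact: vmeas_of_coords].
Qed.

(** [schur_young] is integrated in w and then optimised in s by [le_sqrt_mul]. The second term
    contributes 2^n, the total mass of (2 pi)^-n e^(-|w|^2/4). *)
Lemma schur_bound h z : bL2 h ->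
  ((normc (proj_int h z) ^+ 2 * gauss z)%:E <= (4 ^+ n * (4 * pi) ^- n)%:E * schur_mass h z)%E.
Proof.
move=> bh; pose Q w := normc (h w) ^+ 2 * gauss w.
have bQ : rborel Q by exact: rborel_sq bh.1.
have Q0 w : 0 <= Q w by exact: sq_gauss_ge0.
have bE := rborel_half_gauss_sub z.
have bQE : rborel (fun w => Q w * half_gauss (z - w)) by apply: measurable_funM.
have QE0 w : 0 <= Q w * half_gauss (z - w) by rewrite mulr_ge0 ?half_gauss_ge0.
have mf : schur_mass h z \is a fin_num.
  rewrite ge0_fin_numE ?nnint_ge0 // (le_lt_trans _ bh.2) // le_nnint // => w.
  by rewrite ler_piMr ?half_gauss_le1 ?sq_gauss_ge0.
set A := fine (schur_mass h z).
have A0 : 0 <= A by rewrite fine_ge0 // nnint_ge0.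
set X := normc (proj_int h z) * half_gauss z.
have X0 : 0 <= X by rewrite mulr_ge0 ?normc_ge0 ?half_gauss_ge0.
have ii := inner_integrable bh (kern_bL2 z).
pose J w := normc (h w * conjc (kern z w) * (gauss w)%:C).
have bJ : rborel J by apply: borel_normc; exact: ii.1.
have J0 w : 0 <= J w by exact: normc_ge0.
have XJ : (X%:E <= (half_gauss z)%:E * nnint J)%E.
  rewrite /X mulrC EFinM lee_pmul2l ?lte_fin ?expR_gt0 //.
  exact: normc_cintegral_le.
have young s : 0 < s -> 2 * X <= s * A + s^-1 * (2 ^+ n).
  move=> s0; rewrite -lee_fin EFinM (@le_trans _ _ (2%:E * ((half_gauss z)%:E * nnint J))%E) //.
    by rewrite lee_pmul2l.
  rewrite -nnintZl ?half_gauss_ge0 // -nnintZl //; last 2 first.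
    - by apply: measurable_funM => //; exact: measurable_cst.
    - by move=> w; rewrite mulr_ge0 ?half_gauss_ge0.
  have c0 : 0 <= (2 * pi) ^- n :> R by rewrite ltW // gauss_norm_gt0.
  have s1 : 0 <= s^-1 by rewrite invr_ge0 ltW.
  have bcE : rborel (fun w => (2 * pi) ^- n * half_gauss (z - w)).
    by apply: measurable_funM => //; exact: measurable_cst.
  have cE0 w : 0 <= (2 * pi) ^- n * half_gauss (z - w) by rewrite mulr_ge0 ?half_gauss_ge0.
  apply: (@le_trans _ _ (nnint (fun w => s * (Q w * half_gauss (z - w)) +
      s^-1 * ((2 * pi) ^- n * half_gauss (z - w))))).
    apply: le_nnint.
    - by do 2 (apply: measurable_funM; first exact: measurable_cst).
    - by apply: measurable_funD; apply: measurable_funM => //; exact: measurable_cst.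
    - by move=> w; rewrite !mulr_ge0 ?half_gauss_ge0.
    - by move=> w; rewrite mulrA -mulrA (mulrC (half_gauss z)); exact: schur_young.
  rewrite nnintD; last 4 first.
  - by apply: measurable_funM => //; exact: measurable_cst.
  - by apply: measurable_funM => //; exact: measurable_cst.
  - by move=> w; rewrite mulr_ge0 // ltW.
  - by move=> w; rewrite mulr_ge0.
  rewrite (nnintZl bQE QE0 (ltW s0)) (nnintZl bcE cE0 s1).
  rewrite (nnintZl bE (fun w => half_gauss_ge0 _) c0).
  rewrite (nnint_reflect _ rborel_half_gauss half_gauss_ge0) nnint_half_gauss.
  rewrite -[nnint _]/(schur_mass h z) -(fineK mf) -!EFinM -EFinD lee_fin lerD2l ler_wpM2l //.
  rewrite -exprVn -exprMn (_ : (2 * pi)^-1 * (4 * pi) = 2) //.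
  have : pi != 0 :> R := lt0r_neq0 (pi_gt0 R).
  by move: (pi : R) => x x0; field.
have := le_sqrt_mul X0 A0 (exprn_ge0 n (ler0n R 2)) young => XAB.
have {XAB} X2 : X ^+ 2 <= A * 2 ^+ n.
  rewrite (le_trans (lerXn2r 2 _ _ XAB)) //.
    by rewrite nnegrE mulr_ge0 // sqrtr_ge0.
  by rewrite exprMn !sqr_sqrtr // exprn_ge0.
rewrite -(fineK mf) -/A -EFinM lee_fin.
have -> : normc (proj_int h z) ^+ 2 * gauss z = (2 * pi) ^- n * X ^+ 2.
  by rewrite gauss_half /X; ring.
rewrite (le_trans (ler_wpM2l _ X2)) ?(ltW gauss_norm_gt0) //.
rewrite le_eqVlt; apply/orP; left; apply/eqP.
rewrite mulrCA mulrC; congr (_ * _).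
rewrite -!exprVn -!exprMn; congr (_ ^+ _).
have : pi != 0 :> R := lt0r_neq0 (pi_gt0 R).
by move: (pi : R) => x x0; field.
Qed.

(** Integrating [schur_bound] in z bounds the norm by 2^n times that of h. Only finiteness is kept;
    the constant 1 comes later from orthogonality. *)
Lemma proj_int_bL2 h : bL2 h -> bL2 (proj_int h).
Proof.
move=> bh; have be := proj_int_entire bh; split; first exact: entire_borel.
set c : R := (4 ^+ n * (4 * pi) ^- n).
have c0 : 0 <= c by rewrite mulr_ge0 ?invr_ge0 ?exprn_ge0 // mulr_ge0 ?pi_ge0.
have mm : measurable_fun setT (fun p : Tn => schur_mass h (of_coords p)).
  apply: (@measurable_fun_fubini_tonelli_F _ _ _ _ _ leb (fun p : Tn * Tn =>
    (normc (h (of_coords p.2)) ^+ 2 * gauss (of_coords p.2) *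
      half_gauss (of_coords p.1 - of_coords p.2))%:E)).
    apply/measurable_EFinP.
    apply: (@measurable_conv (fun w => normc (h w) ^+ 2 * gauss w) half_gauss).
      exact: rborel_sq bh.1.
    exact: rborel_half_gauss.
  by move=> p; rewrite lee_fin mulr_ge0 ?half_gauss_ge0 ?sq_gauss_ge0.
apply: (@le_lt_trans _ _ (\int[leb]_p (c%:E * schur_mass h (of_coords p)))%E).
  apply: ge0_le_integral => //.
  - by move=> p _; rewrite lee_fin sq_gauss_ge0.
  - by apply/measurable_EFinP; apply: rborel_sq; exact: entire_borel.
  - by apply: measurable_funeM.
  - by move=> p _; exact: schur_bound.
rewrite ge0_integralZl //; last first.
  by move=> p _; rewrite nnint_ge0 // => w; rewrite mulr_ge0 ?half_gauss_ge0 ?sq_gauss_ge0.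
rewrite (@nnint_conv (fun w => normc (h w) ^+ 2 * gauss w) half_gauss _ _ _ _ _ nnint_half_gauss).
- by rewrite -[nnint _]/(sqL2norm h) -(bL2_fineK bh) -!EFinM ltry.
- exact: rborel_sq bh.1.
- exact: rborel_half_gauss.
- by move=> w; exact: sq_gauss_ge0.
- exact: half_gauss_ge0.
Qed.

(** The symmetric form of the Schur test: 2xy <= x^2 + y^2 majorises the double integrand of <P h,
    f> by two integrable convolutions, as Fubini requires. *)
Lemma schur_kernel h f z w :
  2 * normc (h w * conjc (kern z w) * (gauss w)%:C * (conjc (f z) * (gauss z)%:C)) <=
  (2 * pi) ^- n * (normc (h w) ^+ 2 * gauss w * half_gauss (z - w)) +
  (2 * pi) ^- n * (normc (f z) ^+ 2 * gauss z * half_gauss (z - w)).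
Proof.
rewrite !normcM !normc_conj !normcR !ger0_norm ?gauss_ge0 // !gauss_half.
set c := (2 * pi) ^- n; have c0 : 0 <= c by rewrite ltW // gauss_norm_gt0.
set a := normc (h w); set b := normc (f z); rewrite -kern_half_gauss.
set k := normc (kern z w); set e := half_gauss w; set d := half_gauss z.
have -> : 2 * (a * k * (c * e ^+ 2) * (b * (c * d ^+ 2))) =
  c ^+ 2 * (k * e * d) * (2 * (a * e) * (b * d)) by ring.
have -> : c * (a ^+ 2 * (c * e ^+ 2) * (k * e * d)) + c * (b ^+ 2 * (c * d ^+ 2) * (k * e * d)) =
  c ^+ 2 * (k * e * d) * ((a * e) ^+ 2 + (b * d) ^+ 2) by ring.
rewrite ler_wpM2l ?mulr_ge0 ?exprn_ge0 ?half_gauss_ge0 ?normc_ge0 //.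
by have := sqr_ge0 (a * e - b * d); nra.
Qed.

Lemma schur_double_fin h f : bL2 h -> bL2 f ->
  (\int[leb]_p nnint (fun w => ((2 * pi) ^- n * (normc (h w) ^+ 2 * gauss w * half_gauss (of_coords p - w)) +
  (2 * pi) ^- n * (normc (f (of_coords p)) ^+ 2 * gauss (of_coords p) * half_gauss (of_coords p - w)))%R)
   < +oo)%E.
Proof.
move=> bh bf.
have c0 : 0 <= (2 * pi) ^- n :> R by rewrite ltW // gauss_norm_gt0.
set c := _ ^- n in c0 *.
have bQ := rborel_sq bh.1.
have mm : measurable_fun setT (fun p : Tn => schur_mass h (of_coords p)).
  apply: (@measurable_fun_fubini_tonelli_F _ _ _ _ _ leb (fun p : Tn * Tn =>
    (normc (h (of_coords p.2)) ^+ 2 * gauss (of_coords p.2) *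
      half_gauss (of_coords p.1 - of_coords p.2))%:E)).
    apply/measurable_EFinP.
    exact: (@measurable_conv (fun w => normc (h w) ^+ 2 * gauss w) half_gauss bQ rborel_half_gauss).
  by move=> p; rewrite lee_fin mulr_ge0 ?half_gauss_ge0 ?sq_gauss_ge0.
have E (p : Tn) : nnint (fun w => c * (normc (h w) ^+ 2 * gauss w * half_gauss (of_coords p - w)) +
  c * (normc (f (of_coords p)) ^+ 2 * gauss (of_coords p) * half_gauss (of_coords p - w))) =
  (c%:E * schur_mass h (of_coords p) +
   (c * (4 * pi) ^+ n * (normc (f (of_coords p)) ^+ 2 * gauss (of_coords p)))%:E)%E.
  have bE := rborel_half_gauss_sub (of_coords p).
  have b1 : rborel (fun w => normc (h w) ^+ 2 * gauss w * half_gauss (of_coords p - w)).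
    exact: measurable_funM.
  have p1 w : 0 <= normc (h w) ^+ 2 * gauss w * half_gauss (of_coords p - w).
    by rewrite mulr_ge0 ?half_gauss_ge0 ?sq_gauss_ge0.
  have b2 : rborel (fun w => normc (f (of_coords p)) ^+ 2 * gauss (of_coords p) * half_gauss (of_coords p - w)).
    by apply: measurable_funM => //; exact: measurable_cst.
  have p2 w : 0 <= normc (f (of_coords p)) ^+ 2 * gauss (of_coords p) * half_gauss (of_coords p - w).
    by rewrite mulr_ge0 ?half_gauss_ge0 ?sq_gauss_ge0.
  rewrite nnintD; last 4 first.
  - by apply: measurable_funM => //; exact: measurable_cst.
  - by apply: measurable_funM => //; exact: measurable_cst.
  - by move=> w; rewrite mulr_ge0.
  - by move=> w; rewrite mulr_ge0.
  rewrite (nnintZl b1 p1 c0) (nnintZl b2 p2 c0); congr (_ + _)%E.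
  rewrite (nnintZl bE (fun w => half_gauss_ge0 _) (sq_gauss_ge0 f _)).
  rewrite (nnint_reflect _ rborel_half_gauss half_gauss_ge0) nnint_half_gauss -!EFinM.
  by congr EFin; ring.
under eq_integral do rewrite E.
have s0 z : (0 <= schur_mass h z)%E.
  by rewrite nnint_ge0 // => w; rewrite mulr_ge0 ?half_gauss_ge0 ?sq_gauss_ge0.
have d0 : 0 <= c * (4 * pi) ^+ n by rewrite mulr_ge0 // exprn_ge0 // mulr_ge0 // pi_ge0.
rewrite ge0_integralD //; last 4 first.
- by move=> p _; rewrite mule_ge0.
- exact: measurable_funeM.
- by move=> p _; rewrite lee_fin mulr_ge0 // sq_gauss_ge0.
- by apply/measurable_EFinP; apply: measurable_funM; [exact: measurable_cst|exact: rborel_sq bf.1].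
rewrite ge0_integralZl //.
rewrite (@nnint_conv (fun w => normc (h w) ^+ 2 * gauss w) half_gauss _ _ _ _ _ nnint_half_gauss);
  [|exact: bQ|exact: rborel_half_gauss|by move=> w; exact: sq_gauss_ge0|exact: half_gauss_ge0].
have := nnintZl (rborel_sq bf.1) (sq_gauss_ge0 f) d0; rewrite /nnint => ->.
rewrite -[X in (_ * (_ * X) + _)%E]/(sqL2norm h) -[X in (_ + _ * X)%E]/(sqL2norm f).
by rewrite -(bL2_fineK bh) -(bL2_fineK bf) -!EFinM -EFinD ltry.
Qed.

(** After the exchange of integrals the kernel acts on f, which it reproduces. It follows that h
    minus [proj_int h] is orthogonal to F^2. *)
Lemma proj_int_adjoint h f : bL2 h -> fock f -> L2inner (proj_int h) f = L2inner h f.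
Proof.
move=> bh ff; have bf := fock_bL2 ff.
pose F (p : Tn * Tn) := h (of_coords p.2) * conjc (kern (of_coords p.1) (of_coords p.2)) *
  (gauss (of_coords p.2))%:C * (conjc (f (of_coords p.1)) * (gauss (of_coords p.1))%:C).
have v1 : vmeas (fun p : Tn * Tn => of_coords p.1).
  move=> j; apply: (@cmeas_comp _ _ _ _ _ (@fst Tn Tn) (fun q : Tn => of_coords q 0 j)).
    exact: measurable_fst.
  exact: vmeas_of_coords.
have v2 : vmeas (fun p : Tn * Tn => of_coords p.2).
  move=> j; apply: (@cmeas_comp _ _ _ _ _ (@snd Tn Tn) (fun q : Tn => of_coords q 0 j)).
    exact: measurable_snd.
  exact: vmeas_of_coords.
have mF : cmeas F.
  apply: cmeasM.
    apply: cmeasM; last by apply: cmeasR; exact: (rborel_comp rborel_gauss1 v2).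
    apply: cmeasM; first exact: (borel_comp bh.1 v2).
    apply: cmeas_conj; apply: cmeas_cexp; apply: cmeasM; last exact: cmeas_cst.
    exact: cmeas_hdot.
  apply: cmeasM; first by apply: cmeas_conj; exact: (borel_comp bf.1 v1).
  by apply: cmeasR; exact: (rborel_comp rborel_gauss1 v1).
have F2 p : cintegrable leb (fun q => F (p, q)).
  have := cintegrableZl (conjc (f (of_coords p)) * (gauss (of_coords p))%:C)
    (inner_integrable bh (kern_bL2 (of_coords p))).
  by apply: eq_cintegrable => q; rewrite mulrC.
have F1 q : cintegrable leb (fun p => F (p, q)).
  have := cintegrableZl (h (of_coords q) * (gauss (of_coords q))%:C)
    (inner_integrable (kern_bL2 (of_coords q)) bf).
  by apply: eq_cintegrable => p; rewrite -conjc_kern /F /=; ring.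
pose B (p : Tn * Tn) := (2 * pi) ^- n * (normc (h (of_coords p.2)) ^+ 2 * gauss (of_coords p.2) *
    half_gauss (of_coords p.1 - of_coords p.2)) +
  (2 * pi) ^- n * (normc (f (of_coords p.1)) ^+ 2 * gauss (of_coords p.1) *
    half_gauss (of_coords p.1 - of_coords p.2)).
have B0 p : 0 <= B p.
  have c0 : 0 <= (2 * pi) ^- n :> R by rewrite ltW // gauss_norm_gt0.
  by rewrite /B addr_ge0 // (mulr_ge0 c0) // mulr_ge0 ?half_gauss_ge0 // sq_gauss_ge0.
have mB : measurable_fun setT B.
  have mE : measurable_fun setT (fun p : Tn * Tn => half_gauss (of_coords p.1 - of_coords p.2)).
    by apply: (rborel_comp rborel_half_gauss); exact: vmeasB.
  apply: measurable_funD; apply: measurable_funM; try exact: measurable_cst;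
    apply: measurable_funM => //.
    exact: (rborel_comp (rborel_sq bh.1) v2).
  exact: (rborel_comp (rborel_sq bf.1) v1).
have F12 : (\int[leb]_p fint leb (fun q => normc (F (p, q))) < +oo)%E.
  apply: le_lt_trans (schur_double_fin bh bf); apply: ge0_le_integral => //.
  - by move=> p _; apply: integral_ge0 => q _; rewrite lee_fin normc_ge0.
  - apply: (@measurable_fun_fubini_tonelli_F _ _ _ _ _ leb (fun p : Tn * Tn => (normc (F p))%:E)) => //.
      by apply/measurable_EFinP; exact: measurable_normc.
    by move=> p; rewrite lee_fin normc_ge0.
  - apply: (@measurable_fun_fubini_tonelli_F _ _ _ _ _ leb (fun p : Tn * Tn => (B p)%:E)) => //.
    exact/measurable_EFinP.
  - move=> p _; apply: le_fint.
    + exact: measurable_normc (F2 p).1.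
    + exact: (measurable_fun_pair2 p mB).
    + by move=> q; exact: normc_ge0.
    + move=> q; rewrite (le_trans _ (schur_kernel h f (of_coords p) (of_coords q))) //.
      by rewrite ler_peMl ?normc_ge0 // ler1n.
transitivity (cintegral leb (fun p => cintegral leb (fun q => F (p, q)))).
  apply: eq_cintegral => p; rewrite -mulrA.
  rewrite /proj_int /L2inner -[cint _]/(cintegral leb _).
  rewrite mulrC -cintegralZl; last exact: inner_integrable bh (kern_bL2 _).
  by apply: eq_cintegral => q; rewrite mulrC.
rewrite (cfubini mF F12 F2 F1); apply: eq_cintegral => q.
rewrite (fock_reproducing (of_coords q) ff) (L2inner_conj bf (kern_bL2 _)).
rewrite [RHS]mulrAC /L2inner -[cint _]/(cintegral leb _).
rewrite -cintegralZl; last exact: inner_integrable (kern_bL2 _) bf.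
by apply: eq_cintegral => p; rewrite -[in RHS]conjc_kern /F /=; ring.
Qed.

(** The set from which [fock_proj] chooses is inhabited: the kernel formula, applied to a Borel
    representative of h, gives an element of it. *)
Lemma fock_proj_spec h : L2 h -> fock (fock_proj h) /\
  forall f, fock f -> L2inner (fun z => h z - fock_proj h z) f = 0.
Proof.
move=> /L2P[h0 bh0 hh0]; rewrite /fock_proj; set A := [set u | _].
suff : A (xget (fun=> 0) A) by [].
apply: (@xgetPex _ _ A); exists (proj_int h0); split.
  by apply: fockE (proj_int_bL2 bh0).2; exact: proj_int_entire.
move=> f ff; rewrite (ae_equal_L2inner _ (ae_equal_comp (fun z c => c - proj_int h0 z) hh0)).
rewrite L2innerBl ?proj_int_adjoint ?subrr //; [exact: proj_int_bL2|exact: fock_bL2].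
Qed.

Lemma L2inner_fock_proj h f : L2 h -> fock f -> L2inner (fock_proj h) f = L2inner h f.
Proof.
move=> Lh ff; have [fP /(_ _ ff)] := fock_proj_spec Lh; have [h0 bh0 hh0] := (L2P _).1 Lh.
rewrite (ae_equal_L2inner _ (ae_equal_comp (fun z c => c - fock_proj h z) hh0)).
rewrite L2innerBl ?(ae_equal_L2inner _ hh0); try exact: fock_bL2; last by [].
by move/eqP; rewrite subr_eq0 => /eqP.
Qed.

Lemma fock_projE h z : L2 h -> fock_proj h z = L2inner h (kern z).
Proof.
move=> Lh; rewrite (fock_reproducing z (fock_proj_spec Lh).1).
by apply: L2inner_fock_proj => //; exact: kern_fock.
Qed.

Lemma L2inner_L2_CS h f : L2 h -> bL2 f -> normc (L2inner h f) <= L2norm h * L2norm f.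
Proof.
move=> /L2P[h0 bh0 hh0] bf; rewrite (ae_equal_L2inner _ hh0).
by rewrite /L2norm (ae_equal_sqL2norm hh0); exact: L2inner_CS.
Qed.

(** From <P h, P h> = <h, P h> and Cauchy-Schwarz. This yields the constant 1, which the Schur test
    does not. *)
Lemma L2norm_fock_proj h : L2 h -> L2norm (fock_proj h) <= L2norm h.
Proof.
move=> Lh; have fP := (fock_proj_spec Lh).1; have bP := fock_bL2 fP.
have := L2inner_L2_CS Lh bP; rewrite -L2inner_fock_proj // L2inner_self //.
rewrite normcR ger0_norm ?exprn_ge0 ?L2norm_ge0 // expr2.
have [->|P0] := eqVneq (L2norm (fock_proj h)) 0; first by rewrite L2norm_ge0.
by rewrite ler_pM2r // lt0r P0 L2norm_ge0.
Qed.

End projection.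

(** * The upper bound *)

Section lorentz.
Context {R : realType}.
Local Notation mu := (@lebesgue_measure R).
Local Notation RT := (measurableTypeR R).
Local Notation R2 := (RT * RT)%type.
Local Notation mu2 := (prod_measure mu mu).

(** An integrable weight whose inverse grows only polynomially, hence is controlled by exponentials
    of linear forms; such exponentials merely shift the centre of a Gaussian. *)
Definition lorentz (x : R) : R := (1 + x ^+ 2)^-1.

Lemma lorentz_gt0 x : 0 < lorentz x.
Proof. by rewrite invr_gt0 (lt_le_trans ltr01) // oneDsqr_ge1. Qed.

Lemma measurable_lorentz : measurable_fun setT (lorentz : RT -> R).
Proof. exact: continuous_measurable_fun (@continuous_oneDsqrV R). Qed.

Lemma lorentz_line : fint mu lorentz = pi%:E.
Proof.
rewrite /fint ge0_symfun_integralT.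
- have := @integral0y_oneDsqr R; rewrite set_itvcy => ->.
  by rewrite -EFinM mulrC divfK.
- by move=> x; rewrite ltW // lorentz_gt0.
- exact: continuous_oneDsqrV.
- by move=> x; rewrite /lorentz /= sqrrN.
Qed.

Lemma lorentz_plane : fint mu2 (fun p => lorentz p.1 * lorentz p.2) = (pi ^+ 2)%:E.
Proof.
have l0 x : 0 <= lorentz x by rewrite ltW // lorentz_gt0.
rewrite /fint integral_prod_measure1; last 2 first.
- apply/measurable_EFinP; apply: measurable_funM.
    by apply: (measurableT_comp measurable_lorentz); exact: measurable_fst.
  by apply: (measurableT_comp measurable_lorentz); exact: measurable_snd.
- by move=> p; rewrite lee_fin mulr_ge0.
transitivity (\int[mu]_x (pi * lorentz x)%:E)%E.
  apply: eq_integral => x _.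
  have := fintZl mu measurable_lorentz l0 (l0 x); rewrite /fint => ->.
  by rewrite -/(fint mu _) lorentz_line -EFinM mulrC.
have := fintZl mu measurable_lorentz l0 (pi_ge0 R); rewrite /fint => ->.
by rewrite -/(fint mu _) lorentz_line -EFinM.
Qed.

Lemma lorentz_le_cosh (x : R) : (lorentz x)^-1 <= 4 * (expR x + expR (- x)).
Proof.
rewrite /lorentz invrK.
wlog x0 : x / 0 <= x => [h|].
  have [x0|x0] := leP 0 x; first exact: h.
  by have := h (- x); rewrite sqrrN opprK (addrC (expR (- x))) oppr_ge0 ltW //; exact.
have h : 1 + x / 2 <= expR (x / 2) by exact: expR_ge1Dx.
have -> : expR x = expR (x / 2) * expR (x / 2) by rewrite -expRD; congr expR; field.
have h2 : (1 + x / 2) * (1 + x / 2) <= expR (x / 2) * expR (x / 2).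
  by apply: ler_pM => //; rewrite addr_ge0 // divr_ge0.
have := expR_gt0 (- x); nra.
Qed.

End lorentz.

(** * Absolute convergence of the heat transform *)

Section heat_convergence.
Context {R : realType} {n : nat}.
Local Notation C := R[i].
Local Notation Cn := 'rV[R[i]]_n.
Local Notation R2 := (measurableTypeR R * measurableTypeR R)%type.
Local Notation Tn := (n.-tuple R2).
Local Notation leb := (@lebC R n).
Implicit Types (a b z w : Cn) (f g h : Cn -> C).

Definition lorentz_weight w : R :=
  \prod_(j < n) (lorentz (complex.Re (w 0 j)) * lorentz (complex.Im (w 0 j))).

Lemma lorentz_weight_gt0 w : 0 < lorentz_weight w.
Proof. by apply: prodr_gt0 => j _; rewrite mulr_gt0 // lorentz_gt0. Qed.

Lemma rborel_lorentz_weight : rborel lorentz_weight.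
Proof.
apply: measurable_prod => j _ /=; have [h1 h2] := @vmeas_of_coords R n j.
by apply: measurable_funM; exact: (measurableT_comp measurable_lorentz).
Qed.

Lemma nnint_lorentz_weight : nnint lorentz_weight = ((pi ^+ 2) ^+ n)%:E.
Proof.
have := @integral_power_measure_prod R _ _ (prod_measure (@lebesgue_measure R) (@lebesgue_measure R))
  n (fun _ (p : R2) => lorentz p.1 * lorentz p.2) (fun=> pi ^+ 2).
rewrite prodr_const card_ord => <-.
- apply: eq_integral => p _; congr EFin; apply: eq_bigr => j _; by rewrite mxE.
- move=> i; apply: measurable_funM.
    by apply: (measurableT_comp measurable_lorentz); exact: measurable_fst.
  by apply: (measurableT_comp measurable_lorentz); exact: measurable_snd.
- by move=> i x; rewrite mulr_ge0 // ltW // lorentz_gt0.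
- by move=> i; exact: lorentz_plane.
Qed.

(** The 4^n points with all coordinates of the form +-1 +- i. Summed over them, e^(Re <w, corner s>)
    factors into (e^x + e^-x)(e^y + e^-y) over the coordinates x + iy of w. *)
Definition corner (s : {ffun 'I_n -> bool * bool}) : Cn :=
  \row_j (((-1) ^+ (s j).1) +i* ((-1) ^+ (s j).2)).

Lemma Re_hdot_corner w s : complex.Re (hdot w (corner s)) = \sum_(j < n)
  ((-1) ^+ (s j).1 * complex.Re (w 0 j) + (-1) ^+ (s j).2 * complex.Im (w 0 j)).
Proof.
rewrite /hdot Re_sum; apply: eq_bigr => j _; rewrite mxE ReM /=; ring.
Qed.

Lemma lorentz_weight_inv_le w : (lorentz_weight w)^-1 <=
  16 ^+ n * \sum_(s : {ffun 'I_n -> bool * bool}) expR (complex.Re (hdot w (corner s))).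
Proof.
pose e (j : 'I_n) (s : bool * bool) :=
  expR ((-1) ^+ s.1 * complex.Re (w 0 j) + (-1) ^+ s.2 * complex.Im (w 0 j)).
have -> : \sum_(s : {ffun 'I_n -> bool * bool}) expR (complex.Re (hdot w (corner s))) =
   \prod_(j < n) \sum_s e j s.
  rewrite bigA_distr_bigA; apply: eq_bigr => s _.
  by rewrite Re_hdot_corner (big_morph expR (@expRD R) (@expR0 R)).
have -> : 16 ^+ n = \prod_(j < n) (16 : R) by rewrite prodr_const card_ord.
rewrite /lorentz_weight -prodfV -big_split /=; apply: ler_prod => j _.
rewrite invr_ge0 mulr_ge0 /= ?(ltW (lorentz_gt0 _)) //.
set x := complex.Re _; set y := complex.Im _.
have -> : \sum_s e j s = (expR x + expR (- x)) * (expR y + expR (- y)).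
  rewrite /e -(pair_bigA _ (fun a b : bool => expR ((-1) ^+ a * x + (-1) ^+ b * y))) /=.
  rewrite !big_bool /= !expr1 !expr0 !mulN1r !mul1r !expRD; ring.
rewrite invfM (_ : 16 * _ = (4 * (expR x + expR (- x))) * (4 * (expR y + expR (- y)))); last by ring.
by apply: ler_pM; rewrite ?lorentz_le_cosh // invr_ge0 ltW // lorentz_gt0.
Qed.

Lemma normc_kernel_fun a w :
  normc (kernel_fun a w) ^+ 2 = expR (complex.Re (hdot w a) - sqnorm a / 2).
Proof. by rewrite normc_cexp ReB Re_half /= expr2 -expRD; congr expR; field. Qed.

(** Completing the square: the factor e^(Re <w,b>) moves the centre of the Gaussian from a to a + b,
    and the Gaussian centred there is, up to a constant, |k_(a+b)|^2 times the density of mu. *)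
Lemma shifted_weightE g a b w :
  normc (g w) ^+ 2 * expR (- (sqnorm (w - a) / 2)) * expR (complex.Re (hdot w b)) =
  (2 * pi) ^+ n * expR (sqnorm (a + b) / 2 - sqnorm a / 2) *
  (normc (g w * kernel_fun (a + b) w) ^+ 2 * gauss w).
Proof.
rewrite normcM [(normc (g w) * _) ^+ 2]exprMn normc_kernel_fun gaussE.
have p0 : (2 * pi) ^+ n * (2 * pi) ^- n = 1 :> R.
  by rewrite divff // expf_neq0 // lt0r_neq0 // two_pi_gt0.
transitivity ((2 * pi) ^+ n * (2 * pi) ^- n * (normc (g w) ^+ 2 *
  (expR (sqnorm (a + b) / 2 - sqnorm a / 2) *
  (expR (complex.Re (hdot w (a + b)) - sqnorm (a + b) / 2) * expR (- (1 * sqnorm w / 2))))));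
  last by ring.
rewrite p0 mul1r -mulrA -!expRD; congr (_ * expR _).
by rewrite sqnorm_sub hdotDr ReD; field.
Qed.

(** The unnormalised heat kernel at t = 1. It dominates those for t <= 1, and it is the square root
    of the weight e^(-|w-a|^2/2) that admissibility controls. *)
Definition heat1_weight a w : R := expR (- (sqnorm (w - a) / 4)).

Lemma rborel_shifted_gauss (c : R) a : rborel (fun w => expR (- (sqnorm (w - a) / c))).
Proof.
apply: measurableT_comp => //; apply: measurableT_comp => //.
apply: measurable_funM; last exact: measurable_cst.
by apply: measurable_sqnorm; apply: vmeasB; [exact: vmeas_of_coords|exact: vmeas_cst].
Qed.

(* Finitely many kernels k_(a + corner s) dominate e^{sum_j |x_j| + |y_j|}, hence the
   inverse of an integrable weight; Cauchy-Schwarz then gives absolute convergence. *)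
Lemma heat1_young g a w : normc (g w) * heat1_weight a w <=
  lorentz_weight w + 16 ^+ n * \sum_(s : {ffun 'I_n -> bool * bool})
    (2 * pi) ^+ n * expR (sqnorm (a + corner s) / 2 - sqnorm a / 2) *
    (normc (g w * kernel_fun (a + corner s) w) ^+ 2 * gauss w).
Proof.
under eq_bigr do rewrite -shifted_weightE.
rewrite -mulr_sumr mulrCA.
set X := normc (g w); set W := lorentz_weight w.
have -> : expR (- (sqnorm (w - a) / 2)) = heat1_weight a w ^+ 2.
  by rewrite expr2 -expRD; congr expR; field.
have W0 : 0 < W by exact: lorentz_weight_gt0.
set e := heat1_weight a w; have e0 : 0 <= e by exact: expR_ge0.
have X0 : 0 <= X by exact: normc_ge0.
apply: (@le_trans _ _ (W + X ^+ 2 * e ^+ 2 * W^-1)).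
  rewrite -exprMn -(ler_pM2r W0) mulrDl mulfVK ?lt0r_neq0 //.
  have := mulr_ge0 X0 e0; have := sqr_ge0 (X * e - W); nra.
by rewrite lerD2l ler_wpM2l ?lorentz_weight_inv_le // mulr_ge0 // exprn_ge0.
Qed.

Lemma heat1_finite g a : borel g -> (forall b, bL2 (fun w => g w * kernel_fun b w)) ->
  (nnint (fun w => (normc (g w) * heat1_weight a w)%R) < +oo)%E.
Proof.
move=> bg gk.
pose S (s : {ffun 'I_n -> bool * bool}) w :=
   (2 * pi) ^+ n * expR (sqnorm (a + corner s) / 2 - sqnorm a / 2) *
    (normc (g w * kernel_fun (a + corner s) w) ^+ 2 * gauss w).
have S0 s w : 0 <= S s w.
  rewrite mulr_ge0 ?(sq_gauss_ge0 (fun w => g w * kernel_fun _ w)) // mulr_ge0 ?expR_ge0 //.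
  by rewrite exprn_ge0 // ltW // two_pi_gt0.
have bS s : rborel (S s).
  by apply: measurable_funM; [exact: measurable_cst|exact: rborel_sq (gk _).1].
have bsum : rborel (fun w => \sum_s S s w) by apply: measurable_sum => s; exact: bS.
have sum0 w : 0 <= \sum_s S s w by apply: sumr_ge0.
have c0 : 0 <= 16 ^+ n :> R by rewrite exprn_ge0.
have bl := rborel_lorentz_weight; have l0 w := ltW (lorentz_weight_gt0 w).
apply: (@le_lt_trans _ _ (nnint (fun w => lorentz_weight w + 16 ^+ n * \sum_s S s w))).
  apply: le_nnint.
  - apply: measurable_funM; first exact: borel_normc.
    exact: rborel_shifted_gauss.
  - by apply: measurable_funD => //; apply: measurable_funM => //; exact: measurable_cst.
  - by move=> w; rewrite mulr_ge0 ?normc_ge0 // expR_ge0.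
  - by move=> w; exact: heat1_young.
rewrite nnintD //; last 2 first.
- by apply: measurable_funM => //; exact: measurable_cst.
- by move=> w; rewrite mulr_ge0.
rewrite nnint_lorentz_weight nnintZl // lte_add_pinfty ?ltry // lte_mul_pinfty //.
rewrite /nnint; under eq_integral do rewrite -sumEFin.
rewrite ge0_integral_sum //; last 2 first.
- by move=> s; apply/measurable_EFinP; exact: bS.
- by move=> s p _; rewrite lee_fin.
apply: lte_sum_pinfty => s _.
have cs : 0 <= (2 * pi) ^+ n * expR (sqnorm (a + corner s) / 2 - sqnorm a / 2).
  by rewrite mulr_ge0 ?expR_ge0 // exprn_ge0 // ltW // two_pi_gt0.
have := bL2_weighted (gk (a + corner s)) cs; rewrite /nnint => ->.
exact: ltry.
Qed.

End heat_convergence.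

(** * The heat transform as an average of matrix coefficients *)

Section heat_bound.
Context {R : realType} {n : nat}.
Local Notation C := R[i].
Local Notation Cn := 'rV[R[i]]_n.
Local Notation R2 := (measurableTypeR R * measurableTypeR R)%type.
Local Notation Tn := (n.-tuple R2).
Local Notation leb := (@lebC R n).
Implicit Types (a b z w u : Cn) (f g h : Cn -> C).

Definition phase (e : R) a b : C := cexp (((1 - e) / 4)%:C * (hdot a b - hdot b a)).

Lemma normc_phase e a b : normc (phase e a b) = 1.
Proof.
rewrite normc_cexp ReZl ReB -(hdot_conj a b).
by case: (hdot a b) => x y /=; rewrite subrr mulr0 expR0.
Qed.

Lemma RcV2 (x : R) (m : nat) : (x / m%:R)%:C = x%:C / m%:R :> C.
Proof. by rewrite rmorphM fmorphV /= rmorph_nat. Qed.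

(* This turns the weight of the heat kernel at w into matrix coefficients: for u = w - a,
   e^{-|u|^2/2 - |b|^2/2 + (<u,b> + e<b,u>)/2} is up to a phase a product of two kernels. *)
Lemma kernel_product e a b w : e = 1 \/ e = -1 ->
  kernel_fun (a + b) w * conjc (kernel_fun (a + e%:C *: b) w) * (gauss w)%:C =
  ((2 * pi) ^- n)%:C * phase e a b * (expR (- (sqnorm b / 2)))%:C *
  ((expR (- (sqnorm (w - a) / 2)))%:C * cexp ((hdot (w - a) b + e%:C * hdot b (w - a)) / 2)).
Proof.
move=> e1; rewrite gaussE RcM /kernel_fun conj_cexp.
rewrite [in LHS]mulrCA -[RHS]mulrA -[RHS]mulrA; congr (_ * _).
rewrite -!cexpR /phase -!cexpD; congr cexp.
rewrite conjcB conjcM hdot_conj conjc_inv conjc_nat conjc_real mul1r.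
rewrite !rmorphN /= !RcV2 !sqnormE !rmorphB /=.
rewrite !(hdotBl, hdotBr, hdotDl, hdotDr, hdotZl, hdotZr) !conjc_real.
by case: e1 => ->; rewrite ?rmorph1 ?rmorphN ?rmorph1 /=; field.
Qed.

Section weighted_kernel.
Variables (s e : R).
Hypothesis s_gt0 : 0 < s.
Hypothesis e_sign : e = 1 \/ e = -1.

(** The real part of <u,b> + e<b,u> is 2 th Re <u,b>: th is 1 for e = 1, and 0 for e = -1, where the
    exponent is purely imaginary. *)
Let th := (1 + e) / 2.

Definition wkernel u b : C :=
  cexp ((hdot u b + e%:C * hdot b u) / 2) * (expR (- (s * sqnorm b / 2)))%:C.

Lemma normc_wkernel u b : normc (wkernel u b) =
  expR (th * sqnorm u / (2 * s)) * expR (- (s * sqnorm (b + (- (th / s))%:C *: u) / 2)).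
Proof.
rewrite normcM normcR (ger0_norm (expR_ge0 _)) normc_cexp Re_half ReD ReZl.
rewrite -(hdot_conj u b) (_ : complex.Re (conjc (hdot u b)) = complex.Re (hdot u b)); last first.
  by case: (hdot u b).
rewrite -!expRD; congr expR.
rewrite rmorphN /= scaleNr sqnorm_sub sqnormZ normcR real_normK ?num_real // hdotZr conjc_real ReZl.
rewrite -(hdot_conj u b) (_ : complex.Re (conjc (hdot u b)) = complex.Re (hdot u b)); last first.
  by case: (hdot u b).
by rewrite /th; case: e_sign => ->; field; rewrite lt0r_neq0.
Qed.

Lemma borel_wkernel u : borel (wkernel u).
Proof.
apply: cmeasM; last by apply: cmeasR; exact: rborel_gauss.
apply: cmeas_cexp; apply: cmeasM; last exact: cmeas_cst.
apply: cmeasD.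
  by apply: cmeas_hdot; [exact: vmeas_cst|exact: vmeas_of_coords].
apply: cmeasM; first exact: cmeas_cst.
by apply: cmeas_hdot; [exact: vmeas_of_coords|exact: vmeas_cst].
Qed.

Lemma nnint_normc_wkernel u : nnint (fun b => normc (wkernel u b)) =
  (expR (th * sqnorm u / (2 * s)) * (2 * pi / s) ^+ n)%:E.
Proof.
pose G b : R := expR (- (s * sqnorm b / 2)).
have bG : rborel G by exact: rborel_gauss.
have G0 b : 0 <= G b by exact: expR_ge0.
have -> : (fun b => normc (wkernel u b)) =
    (fun b => expR (th * sqnorm u / (2 * s)) * G (b + (- (th / s))%:C *: u)).
  by apply/funext => b; exact: normc_wkernel.
rewrite nnintZl ?expR_ge0 //.
- by rewrite nnint_shift // nnint_gauss // EFinM.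
- apply: (@rborel_comp _ _ _ _ G (fun p : Tn => of_coords p + (- (th / s))%:C *: u)) => //.
  by apply: vmeasD; [exact: vmeas_of_coords|exact: vmeas_cst].
Qed.

Lemma wkernel_integrable u : cn_integrable (wkernel u).
Proof.
split; first exact: borel_wkernel.
have := nnint_normc_wkernel u; rewrite /nnint /fint => ->; exact: ltry.
Qed.

(** [gauss_reproducing] with parameter s, for the entire function b -> e^(e<b,u>/2) evaluated at
    u/s. The factor e^(<u,b>/2) plays the part of the kernel at that point. *)
Lemma cint_wkernel u : cint (wkernel u) =
  ((2 * pi / s) ^+ n)%:C * (expR (e * sqnorm u / (2 * s)))%:C.
Proof.
pose f b : C := cexp (e%:C * hdot b u / 2).
have ef : entire f.
  have := @entire_cexp_linear R n (fun j => e%:C * conjc (u 0 j) / 2) 0.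
  congr entire; apply/funext => b; rewrite /f; congr cexp.
  by rewrite addr0 /hdot mulr_sumr mulr_suml; apply: eq_bigr => j _; ring.
have sC : s%:C != 0 :> C by rewrite -normc_eq0 normcR normr_eq0 lt0r_neq0.
have E b : f b * cexp (s%:C * hdot ((s^-1)%:C *: u) b / 2) =
    cexp ((hdot u b + e%:C * hdot b u) / 2).
  by rewrite /f -cexpD hdotZl fmorphV /=; congr cexp; field.
have := @gauss_reproducing R n s f ((s^-1)%:C *: u) s_gt0 ef.
have -> : (fun w => f w * cexp (s%:C * hdot ((s^-1)%:C *: u) w / 2) *
    (expR (- (s * sqnorm w / 2)))%:C) = wkernel u.
  by apply/funext => w; rewrite E.
have -> : (fun w => normc (f w * cexp (s%:C * hdot ((s^-1)%:C *: u) w / 2)) *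
    expR (- (s * sqnorm w / 2))) = (fun w => normc (wkernel u w)).
  by apply/funext => w; rewrite E /wkernel normcM normcR ger0_norm ?expR_ge0.
move=> ->; last by rewrite /fin_nnint nnint_normc_wkernel ltry.
rewrite /f -cexpR hdotZl; congr (_ * cexp _).
rewrite -sqnormE -!RcM -[2 : C](rmorph_nat (real_complex R)) -fmorphV -RcM; congr _%:C.
by field; rewrite lt0r_neq0.
Qed.

End weighted_kernel.

Lemma heat_integrandE t g a w : 0 < t -> t <= 1 ->
  normc (heat_integrand t g a w) <= normc (g w) * heat1_weight a w.
Proof.
move=> t0 t1; rewrite normcM normcR (ger0_norm (expR_ge0 _)) ler_wpM2l ?normc_ge0 //.
rewrite ler_expR mulNr lerN2 ler_wpM2l ?sqnorm_ge0 // lef_pV2 ?posrE ?mulr_gt0 //; lra.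
Qed.

Lemma heat_integrable t g a : 0 < t -> t <= 1 -> borel g ->
  (forall b, bL2 (fun w => g w * kernel_fun b w)) -> cn_integrable (heat_integrand t g a).
Proof.
move=> t0 t1 bg gk.
apply: (@cintegrable_dom _ _ _ _ _ (fun p : Tn => normc (g (of_coords p)) * heat1_weight a (of_coords p))).
- apply: cmeasM => //; apply: cmeasR.
  have := rborel_shifted_gauss (4 * t) a; rewrite /rborel.
  by under eq_fun do rewrite -mulNr.
- by apply: measurable_funM; [exact: borel_normc|exact: rborel_shifted_gauss].
- by move=> p; exact: heat_integrandE.
- exact: heat1_finite.
Qed.

Lemma heat_bound_aux g (s e t N : R) a : borel g ->
  (forall b, bL2 (fun w => g w * kernel_fun b w)) ->
  (forall b c, normc (L2inner (fun w => g w * kernel_fun b w) (kernel_fun c)) <= N) ->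
  1 < s -> e = 1 \/ e = -1 -> 0 < t -> t <= 1 -> (2 * t)^-1 = 1 - e / s ->
  normc (heat t g a) <= (s / (2 * t * (s - 1))) ^+ n * N.
Proof.
move=> bg gk gN s1 e1 t0 t1 tse; have s0 : 0 < s by rewrite (lt_trans ltr01).
(* For e = 1 this is the condition t <= 1. It keeps the growth e^((1+e)|u|^2/4s) from integrating
   the modulus over b within e^(|u|^2/4), so that e^(-|u|^2/2) still leaves [heat1_weight]. *)
have es : (1 + e) / s <= 1.
  case: e1 tse => ->; last by rewrite subrr mul0r.
  rewrite !mul1r => tse; have : 2^-1 <= (2 * t)^-1 by rewrite lef_pV2 ?posrE ?mulr_gt0 //; lra.
  by rewrite tse mulrDl mul1r; lra.
have sm0 : 0 < s - 1 by rewrite subr_gt0.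
have N0 : 0 <= N by rewrite (le_trans _ (gN 0 0)) // normc_ge0.
pose F (p : Tn * Tn) := g (of_coords p.1) * (expR (- (sqnorm (of_coords p.1 - a) / 2)))%:C *
  wkernel s e (of_coords p.1 - a) (of_coords p.2).
have v1 : vmeas (fun p : Tn * Tn => of_coords p.1).
  move=> j; apply: (@cmeas_comp _ _ _ _ _ (@fst Tn Tn) (fun q : Tn => of_coords q 0 j)).
    exact: measurable_fst.
  exact: vmeas_of_coords.
have v2 : vmeas (fun p : Tn * Tn => of_coords p.2).
  move=> j; apply: (@cmeas_comp _ _ _ _ _ (@snd Tn Tn) (fun q : Tn => of_coords q 0 j)).
    exact: measurable_snd.
  exact: vmeas_of_coords.
have v3 : vmeas (fun p : Tn * Tn => of_coords p.1 - a) by apply: vmeasB => //; exact: vmeas_cst.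
have mF : cmeas F.
  apply: cmeasM.
    apply: cmeasM; first exact: (borel_comp bg v1).
    by apply: cmeasR; exact: (rborel_comp (rborel_shifted_gauss 2 a) v1).
  apply: cmeasM; last by apply: cmeasR; exact: (rborel_comp (rborel_gauss s) v2).
  apply: cmeas_cexp; apply: cmeasM; last exact: cmeas_cst.
  apply: cmeasD; first exact: cmeas_hdot.
  by apply: cmeasM; [exact: cmeas_cst|exact: cmeas_hdot].
have F2 p : cintegrable leb (fun q => F (p, q)).
  exact: (cintegrableZl (g (of_coords p) * (expR (- (sqnorm (of_coords p - a) / 2)))%:C)
    (wkernel_integrable s0 e1 (of_coords p - a))).
pose cst b : C := ((2 * pi) ^+ n * expR (- ((s - 1) * sqnorm b / 2)))%:C * conjc (phase e a b).
(* For fixed b the integrand is that of a matrix coefficient, times a number of modulus (2 pi)^n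
   e^(-(s-1)|b|^2/2): the normalisations of the two kernels consume one factor e^(-|b|^2/2) of the
   weight. *)
have FE w b : g w * (expR (- (sqnorm (w - a) / 2)))%:C * wkernel s e (w - a) b =
  cst b * (g w * kernel_fun (a + b) w * conjc (kernel_fun (a + e%:C *: b) w) * (gauss w)%:C).
  rewrite (_ : g w * kernel_fun (a + b) w * _ * _ = g w * (kernel_fun (a + b) w *
    conjc (kernel_fun (a + e%:C *: b) w) * (gauss w)%:C)); last by rewrite !mulrA.
  rewrite kernel_product // /wkernel /cst.
  have p1 : conjc (phase e a b) * phase e a b = 1 by rewrite mulrC mul_conj normc_phase expr1n.
  have p2 : ((2 * pi) ^+ n)%:C * ((2 * pi) ^- n)%:C = 1 :> C.
    by rewrite -RcM divff // expf_neq0 // lt0r_neq0 // two_pi_gt0.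
  have p3 : (expR (- (s * sqnorm b / 2)))%:C =
      (expR (- ((s - 1) * sqnorm b / 2)))%:C * (expR (- (sqnorm b / 2)))%:C.
    by rewrite -RcM -expRD; congr (expR _)%:C; field.
  rewrite p3 RcM; set X := cexp _.
  set A := (expR (- (sqnorm (w - a) / 2)))%:C; set B1 := (expR _)%:C; set B2 := (expR _)%:C.
  transitivity (((2 * pi) ^+ n)%:C * ((2 * pi) ^- n)%:C *
    (conjc (phase e a b) * phase e a b) * (g w * A * (X * (B1 * B2)))).
    by rewrite p1 p2 !mul1r.
  by ring.
have F1 q : cintegrable leb (fun p => F (p, q)).
  have := cintegrableZl (cst (of_coords q)) (inner_integrable (gk (a + of_coords q))
    (fock_bL2 (kernel_fun_fock (a + e%:C *: of_coords q)))).
  by apply: eq_cintegrable => p; rewrite /F FE.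
have c0 : 0 <= (2 * pi / s) ^+ n by rewrite exprn_ge0 // divr_ge0 ?(ltW s0) // ltW // two_pi_gt0.
have bw : rborel (fun w => normc (g w) * heat1_weight a w).
  by apply: measurable_funM; [exact: borel_normc|exact: rborel_shifted_gauss].
have w0 w : 0 <= normc (g w) * heat1_weight a w by rewrite mulr_ge0 ?normc_ge0 ?expR_ge0.
have hF w : ((\int[leb]_q (normc (g w * (expR (- (sqnorm (w - a) / 2)))%:C *
     wkernel s e (w - a) (of_coords q)))%:E)%E <=
   ((2 * pi / s) ^+ n * (normc (g w) * heat1_weight a w))%:E)%E.
  have := nnintZl (borel_normc (borel_wkernel s e (w - a))) (fun b => normc_ge0 _)
    (normc_ge0 (g w * (expR (- (sqnorm (w - a) / 2)))%:C)).
  rewrite nnint_normc_wkernel // -EFinM => h.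
  rewrite (_ : (\int[leb]_q _)%E = nnint (fun b => normc (g w * (expR (- (sqnorm (w - a) / 2)))%:C) * normc (wkernel s e (w - a) b))); last first.
    by apply: eq_integral => q _; rewrite normcM.
  rewrite h lee_fin normcM normcR (ger0_norm (expR_ge0 _)).
  set q := sqnorm _; set K := (2 * pi / s) ^+ n in c0 *.
  have -> : normc (g w) * expR (- (q / 2)) * (expR ((1 + e) / 2 * q / (2 * s)) * K) =
     K * (normc (g w) * (expR (- (q / 2)) * expR ((1 + e) / 2 * q / (2 * s)))) by ring.
  rewrite ler_wpM2l // ler_wpM2l ?normc_ge0 // -expRD ler_expR -/q.
  have -> : (1 + e) / 2 * q / (2 * s) = q / 4 * ((1 + e) / s) by field; rewrite lt0r_neq0.
  have q0 : 0 <= q by exact: sqnorm_ge0.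
  have : q / 4 * ((1 + e) / s) <= q / 4 * 1 by rewrite ler_wpM2l // divr_ge0.
  lra.
have F12 : (\int[leb]_p fint leb (fun q => normc (F (p, q))) < +oo)%E.
  apply: (@le_lt_trans _ _ (nnint (fun w => (2 * pi / s) ^+ n * (normc (g w) * heat1_weight a w)))).
    apply: ge0_le_integral => //.
    - by move=> p _; apply: integral_ge0 => q _; rewrite lee_fin normc_ge0.
    - apply: (@measurable_fun_fubini_tonelli_F _ _ _ _ _ leb (fun p : Tn * Tn => (normc (F p))%:E)) => //.
        by apply/measurable_EFinP; exact: measurable_normc.
      by move=> p; rewrite lee_fin normc_ge0.
    - by apply/measurable_EFinP; apply: measurable_funM => //; exact: measurable_cst.
    - by move=> p _; rewrite /fint /F /=; exact: (hF (of_coords p)).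
  by rewrite nnintZl // lte_mul_pinfty // heat1_finite.
have ih := heat_integrable a t0 t1 bg gk.
have cfE : cintegral leb (fun p => cintegral leb (fun q => F (p, q))) =
   ((2 * pi / s) ^+ n)%:C * cint (heat_integrand t g a).
  rewrite -[cint _]/(cintegral leb _) -(cintegralZl _ ih); apply: eq_cintegral => p.
  rewrite [LHS](cintegralZl (g (of_coords p) * (expR (- (sqnorm (of_coords p - a) / 2)))%:C)
    (wkernel_integrable s0 e1 (of_coords p - a))).
  rewrite -[cintegral _ _]/(cint (wkernel s e (of_coords p - a))) cint_wkernel //.
  rewrite /heat_integrand mulrCA -!mulrA; congr (_ * (_ * _)).
  rewrite -RcM -expRD; congr (expR _)%:C.
  rewrite (_ : (4 * t)^-1 = 2^-1 * (1 - e / s)).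
    by field; rewrite lt0r_neq0.
  by rewrite -tse -invfM; congr (_^-1); ring.
have mF' : cmeas (fun p : Tn * Tn => F (p.2, p.1)).
  exact: (cmeas_comp (@measurable_swap _ _ Tn Tn) mF).
have iF : cintegrable leb (fun q => cintegral leb (fun p => F (p, q))).
  apply: (cintegrable_fubini mF' _ F1).
  have := @fubini_tonelli _ _ _ _ _ leb leb (fun p : Tn * Tn => (normc (F p))%:E).
  rewrite /fint /= => <- //; first by apply/measurable_EFinP; exact: measurable_normc.
  by move=> p; rewrite lee_fin normc_ge0.
have fub := cfubini mF F12 F2 F1.
have cK0 : 0 <= (2 * pi) ^+ n * N := mulr_ge0 (exprn_ge0 n (ltW two_pi_gt0)) N0.
have bound : ((2 * pi / s) ^+ n) * normc (cint (heat_integrand t g a)) <=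
    (2 * pi) ^+ n * N * (2 * pi / (s - 1)) ^+ n.
  rewrite -[X in X * _ <= _](ger0_norm c0) -normcR -normcM -cfE fub.
  apply: (normc_cintegral_bound iF).
  rewrite EFinM -(@nnint_gauss _ n _ sm0).
  rewrite -(nnintZl (rborel_gauss (s - 1)) (fun b => expR_ge0 _) cK0).
  apply: le_fint.
  - exact: measurable_normc iF.1.
  - by apply: measurable_funM; [exact: measurable_cst|exact: rborel_gauss].
  - by move=> q; exact: normc_ge0.
  - move=> q.
    rewrite (eq_cintegral leb (fun p => FE (of_coords p) (of_coords q))).
    rewrite (cintegralZl _ (inner_integrable (gk _) (fock_bL2 (kernel_fun_fock _)))).
    rewrite normcM normcM normc_conj normc_phase mulr1 normcR ger0_norm; last first.
      exact: (mulr_ge0 (exprn_ge0 n (ltW two_pi_gt0)) (expR_ge0 _)).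
    rewrite mulrAC; apply: (ler_wpM2r (expR_ge0 _)).
    by apply: (ler_wpM2l (exprn_ge0 n (ltW two_pi_gt0))); exact: gN.
rewrite /heat normcM normcR; move: (normc (cint _)) bound => X bound.
clear - s0 sm0 t0 N0 bound; rewrite ger0_norm; last first.
  by rewrite invr_ge0 exprn_ge0 // !mulr_ge0 ?pi_ge0 // ltW.
have K0 : 0 < (2 * pi / s) ^+ n by rewrite exprn_gt0 // divr_gt0 // two_pi_gt0.
rewrite -(ler_pM2l K0) mulrCA.
have i0 : 0 <= (4 * pi * t) ^- n.
  by rewrite invr_ge0 exprn_ge0 // !mulr_ge0 ?pi_ge0 // ltW.
apply: le_trans (ler_wpM2l i0 bound) _.
rewrite le_eqVlt; apply/orP; left; apply/eqP.
rewrite [RHS]mulrA -exprMn [(2 * pi) ^+ n * N * _]mulrAC -exprMn mulrA -exprVn -exprMn.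
congr (_ ^+ _ * _).
have : pi != 0 :> R := lt0r_neq0 (pi_gt0 R).
move: (pi : R) => x x0; field.
by rewrite x0 (lt0r_neq0 t0) (lt0r_neq0 s0) (lt0r_neq0 sm0).
Qed.

Lemma heat_half_bound g (N : R) a : borel g ->
  (forall b, bL2 (fun w => g w * kernel_fun b w)) ->
  (forall b c, normc (L2inner (fun w => g w * kernel_fun b w) (kernel_fun c)) <= N) ->
  normc (heat 2^-1 g a) <= N.
Proof.
move=> bg gk gN; suff -> : heat 2^-1 g a = L2inner (fun w => g w * kernel_fun a w) (kernel_fun a).
  exact: gN.
have p0 : (2 * pi) ^+ n != 0 :> R by rewrite expf_neq0 // lt0r_neq0 // two_pi_gt0.
have E w : g w * kernel_fun a w * conjc (kernel_fun a w) * (gauss w)%:C =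
   ((2 * pi) ^- n)%:C * heat_integrand 2^-1 g a w.
  have := @kernel_product 1 a 0 w (or_introl erefl).
  rewrite scaler0 addr0 hdot0l hdot0r mulr0 addr0 mul0r cexp0 mulr1.
  rewrite (_ : sqnorm 0 = 0); last by rewrite /sqnorm big1 // => j _; rewrite mxE normc0 expr0n.
  rewrite mul0r oppr0 expR0 mulr1 /phase subrr mul0r mul0r cexp0 mulr1 => h.
  rewrite [LHS](_ : _ = g w * (kernel_fun a w * conjc (kernel_fun a w) * (gauss w)%:C)); last first.
    by rewrite !mulrA.
  rewrite h mulrCA; congr (_ * (_ * (expR _)%:C)).
  by rewrite mulNr; field.
have h1 : 2^-1 <= 1 :> R by lra.
have h0 : 0 < 2^-1 :> R by rewrite invr_gt0.
transitivity (cintegral leb (fun p => ((2 * pi) ^- n)%:C * heat_integrand 2^-1 g a (of_coords p)));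
  last by apply/esym; apply: eq_cintegral => p; exact: E.
rewrite (cintegralZl _ (heat_integrable a h0 h1 bg gk)) /heat.
by rewrite (_ : 4 * pi * 2^-1 = 2 * pi) //; move: (pi : R) => x; field.
Qed.

Lemma heat_bound g (t N : R) a : 1 / 4 < t -> t <= 1 -> borel g ->
  (forall b, bL2 (fun w => g w * kernel_fun b w)) ->
  (forall b c, normc (L2inner (fun w => g w * kernel_fun b w) (kernel_fun c)) <= N) ->
  normc (heat t g a) <= kappa n t * N.
Proof.
move=> t4 t1 bg gk gN; have t0 : 0 < t by lra.
have N0 : 0 <= N by rewrite (le_trans _ (gN 0 0)) // normc_ge0.
case: (ltgtP t 2^-1) => t2.
(* Here s = 2t / (1 - 2t), and s > 1 is the condition t > 1/4. *)
- have d0 : 0 < 1 - 2 * t by lra.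
  apply: (@le_trans _ _ ((4 * t - 1) ^- n * N)); last first.
    by rewrite ler_wpM2r // /kappa le_max lexx orbT.
  have := @heat_bound_aux g (2 * t / (1 - 2 * t)) (-1) t N a bg gk gN.
  rewrite (_ : 2 * t / (1 - 2 * t) / (2 * t * (2 * t / (1 - 2 * t) - 1)) = (4 * t - 1)^-1); last first.
    by field; apply/and3P; split; rewrite ?lt0r_neq0 //; lra.
  rewrite exprVn; apply => //.
  - by rewrite ltr_pdivlMr //; lra.
  - by right.
  - by field; rewrite !lt0r_neq0.
- have d0 : 0 < 2 * t - 1 by lra.
  apply: (@le_trans _ _ (1 * N)); last by rewrite ler_wpM2r // /kappa le_max lexx.
  have := @heat_bound_aux g (2 * t / (2 * t - 1)) 1 t N a bg gk gN.
  rewrite (_ : 2 * t / (2 * t - 1) / (2 * t * (2 * t / (2 * t - 1) - 1)) = 1); last first.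
    by field; rewrite !lt0r_neq0 //; lra.
  rewrite expr1n; apply => //.
  - by rewrite ltr_pdivlMr //; lra.
  - by left.
  - by field; rewrite !lt0r_neq0.
- apply: (@le_trans _ _ (1 * N)); last by rewrite ler_wpM2r // /kappa le_max lexx.
  by rewrite mul1r t2; exact: heat_half_bound.
Qed.


Lemma toeplitz_spec g : toeplitz_bounded g -> bounded_extension g (toeplitz g).
Proof. by move=> [A gA]; apply: (@xgetPex _ _ (bounded_extension g)); exists A. Qed.

Lemma opnorm_ge (A : (Cn -> C) -> Cn -> C) f : fock f -> L2norm f <= 1 ->
  ((L2norm (A f))%:E <= opnorm A)%E.
Proof. by move=> ff f1; apply: ereal_sup_ubound; exists f. Qed.

Lemma opnorm_ge0 (A : (Cn -> C) -> Cn -> C) : (0 <= opnorm A)%E.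
Proof.
apply: le_trans (opnorm_ge A (kernel_fun_fock 0) _); last by rewrite L2norm_kernel_fun.
by rewrite lee_fin L2norm_ge0.
Qed.

Lemma kernel_matrix_le g a b : admissible g -> toeplitz_bounded g ->
  ((normc (L2inner (fun w => (g w * kernel_fun a w)%R) (kernel_fun b)))%:E <= opnorm (toeplitz g))%E.
Proof.
move=> [_ ag] tg; have [[A1 _ _] A2] := toeplitz_spec tg.
apply: le_trans (opnorm_ge (toeplitz g) (kernel_fun_fock a) _); last by rewrite L2norm_kernel_fun.
have fk := kernel_fun_fock a.
rewrite lee_fin (A2 _ (conj fk (ag a))) /toeplitz_op -(L2inner_fock_proj (ag a) (kernel_fun_fock b)).
have := L2inner_CS (fock_bL2 (fock_proj_spec (ag a)).1) (fock_bL2 (kernel_fun_fock b)).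
by rewrite L2norm_kernel_fun mulr1.
Qed.

Lemma heat_toeplitz_bound g (t : R) : 1 / 4 < t -> t <= 1 -> admissible g -> toeplitz_bounded g ->
  (forall a, heat_converges t g a) /\
  (supnorm (heat t g) <= (kappa n t)%:E * opnorm (toeplitz g))%E.
Proof.
move=> t4 t1 ag tg; have t0 : 0 < t by lra.
have [g0 bg gg] := (lmeasurableP g).1 ag.1.
have ggk b : ae_equal (fun w => g w * kernel_fun b w) (fun w => g0 w * kernel_fun b w).
  exact: (ae_equal_comp (fun w c => c * kernel_fun b w) gg).
have gh a : ae_equal (heat_integrand t g a) (heat_integrand t g0 a).
  exact: (ae_equal_comp (fun w c => c * (expR (- sqnorm (w - a) / (4 * t)))%:C) gg).
have gk b : bL2 (fun w => g0 w * kernel_fun b w).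
  split; last by rewrite -(ae_equal_sqL2norm (ggk b)); exact: (ag.2 b).2.
  by apply: borelM bg _; exact: (fock_bL2 (kernel_fun_fock b)).1.
have hi a := heat_integrable a t0 t1 bg gk.
have k1 : 1 <= kappa n t by rewrite /kappa le_max lexx.
split.
  move=> a; split.
    by apply/lmeasurableP; exists (heat_integrand t g0 a) => //; exact: (hi a).1.
  by rewrite (ae_equal_nnint (fun _ => normc) (gh a)); exact: (hi a).2.
have := opnorm_ge0 (toeplitz g); have := kernel_matrix_le _ _ ag tg.
(* The norm is an extended real. An infinite value makes the right-hand side infinite, because the
   factor [kappa n t] is positive. *)
case: (opnorm (toeplitz g)) => [N|_ _|_] //; last first.
  by rewrite gt0_muley ?leey // lte_fin (lt_le_trans ltr01).
move=> gN _; apply: ge_ereal_sup => _ [a _ <-]; rewrite -EFinM lee_fin.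
have -> : heat t g a = heat t g0 a by rewrite /heat (ae_equal_cint (gh a)).
apply: heat_bound => // b c.
by rewrite -(ae_equal_L2inner _ (ggk b)) -lee_fin; exact: gN.
Qed.

End heat_bound.

(** * Bounded and Gaussian symbols *)

Section bounded_symbols.
Context {R : realType} {n : nat}.
Local Notation C := R[i].
Local Notation Cn := 'rV[R[i]]_n.
Local Notation R2 := (measurableTypeR R * measurableTypeR R)%type.
Local Notation Tn := (n.-tuple R2).
Local Notation leb := (@lebC R n).
Implicit Types (a b z w u : Cn) (f g h : Cn -> C).

Lemma L2norm_triangle f h : bL2 f -> bL2 h -> L2norm (fun z => f z + h z) <= L2norm f + L2norm h.
Proof.
move=> bf bh; have bs := bL2D bf bh.
have f0 := L2norm_ge0 f; have h0 := L2norm_ge0 h; have s0 := L2norm_ge0 (fun z => f z + h z).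
have [->|sn0] := eqVneq (L2norm (fun z => f z + h z)) 0; first by rewrite addr_ge0.
rewrite -(ler_pM2r (x := L2norm (fun z => f z + h z))) ?lt0r ?sn0 //.
rewrite -expr2 -[X in X <= _]ger0_norm ?exprn_ge0 // -normcR -L2inner_self // L2innerDl //.
by rewrite (le_trans (normcD _ _)) // mulrDl lerD // L2inner_CS.
Qed.

Lemma L2normZ f (c : C) : bL2 f -> L2norm (fun z => c * f z) = normc c * L2norm f.
Proof.
move=> bf; rewrite /L2norm sqL2normZ //= sqrtrM ?exprn_ge0 ?normc_ge0 //.
by rewrite sqrtr_sqr ger0_norm // normc_ge0.
Qed.

Variables (g : Cn -> C) (B : R).
Hypotheses (bg : borel g) (B_ge0 : 0 <= B) (gB : forall z, normc (g z) <= B).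

Lemma bL2_bounded_mul f : bL2 f -> bL2 (fun z => g z * f z).
Proof.
move=> bf; apply: (bL2_dom _ bf B_ge0); first exact: borelM bg bf.1.
by move=> z; rewrite normcM ler_wpM2r ?normc_ge0.
Qed.

Lemma bounded_admissible : admissible g.
Proof.
split; first exact: borel_lmeasurable.
by move=> a; apply: bL2_L2; apply: bL2_bounded_mul; exact/fock_bL2/kernel_fun_fock.
Qed.

Lemma bounded_dom f : fock f -> toeplitz_dom g f.
Proof. by move=> ff; split => //; apply: bL2_L2; exact/bL2_bounded_mul/fock_bL2. Qed.

Lemma toeplitz_op_bound f : fock f -> L2norm (toeplitz_op g f) <= B * L2norm f.
Proof.
move=> ff; have [_ Lf] := bounded_dom ff.
apply: le_trans (L2norm_fock_proj Lf) _.
apply: (L2norm_mono _ (fock_bL2 ff) B_ge0); first exact: borelM bg (fock_bL2 ff).1.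
by move=> z; rewrite normcM ler_wpM2r ?normc_ge0.
Qed.

Lemma toeplitz_opE f z : fock f -> toeplitz_op g f z = L2inner (fun w => g w * f w) (kern z).
Proof. by move=> ff; rewrite /toeplitz_op fock_projE //; exact: (bounded_dom ff).2. Qed.

Lemma toeplitz_op_fock f : fock f -> fock (toeplitz_op g f).
Proof. by move=> ff; exact: (fock_proj_spec (bounded_dom ff).2).1. Qed.

Lemma toeplitz_op_linear (c : C) f h : fock f -> fock h ->
  toeplitz_op g (fun z => c * f z + h z) = (fun z => c * toeplitz_op g f z + toeplitz_op g h z).
Proof.
move=> ff fh; have fc := fockZ c ff; have fs := fockD fc fh.
apply/funext => z; rewrite !toeplitz_opE //.
have bf := bL2_bounded_mul (fock_bL2 ff); have bh := bL2_bounded_mul (fock_bL2 fh).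
have bk := kern_bL2 z.
have -> : (fun w => g w * (c * f w + h w)) = (fun w => c * (g w * f w) + g w * h w).
  by apply/funext => w; ring.
by rewrite (L2innerDl (bL2Z c bf) bh bk) (L2innerZl c bf bk).
Qed.

Lemma bounded_extension_op : bounded_extension g (toeplitz_op g).
Proof.
split => //; split.
- exact: toeplitz_op_fock.
- by move=> c f h; exact: toeplitz_op_linear.
- by exists B => f; exact: toeplitz_op_bound.
Qed.

Lemma bounded_toeplitz_bounded : toeplitz_bounded g.
Proof. by exists (toeplitz_op g); exact: bounded_extension_op. Qed.

Lemma toeplitzE f : fock f -> toeplitz g f = toeplitz_op g f.
Proof.
by move=> ff; rewrite (toeplitz_spec bounded_toeplitz_bounded).2 //; exact: bounded_dom.
Qed.

Lemma opnorm_le (N : R) : (forall f, fock f -> L2norm (toeplitz_op g f) <= N * L2norm f) ->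
  0 <= N -> (opnorm (toeplitz g) <= N%:E)%E.
Proof.
move=> gN N0; apply: ge_ereal_sup => _ [f [ff f1] <-]; rewrite lee_fin toeplitzE //.
by rewrite (le_trans (gN f ff)) // ler_piMr.
Qed.

Lemma opnorm_gt0 f : fock f -> toeplitz g f <> (fun=> 0) -> (0 < opnorm (toeplitz g))%E.
Proof.
move=> ff gf; have [[A1 A2 [M AM]] _] := toeplitz_spec bounded_toeplitz_bounded.
have fAf := A1 _ ff.
have Af0 : 0 < L2norm (toeplitz g f).
  rewrite lt0r L2norm_ge0 andbT; apply/eqP => h; apply: gf; apply/funext => z.
  exact: fock_eq0.
have f0 : 0 < L2norm f.
  rewrite lt0r L2norm_ge0 andbT; apply/eqP => h.
  by have := AM _ ff; rewrite h mulr0 leNgt Af0.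
pose c : C := ((L2norm f)^-1)%:C.
have nc : normc c = (L2norm f)^-1 by rewrite normcR ger0_norm // invr_ge0 ltW.
have fc := fockZ c ff.
have := @opnorm_ge _ _ (toeplitz g) _ fc; rewrite L2normZ ?nc; last exact: fock_bL2.
rewrite mulVf ?lt0r_neq0 // => /(_ (lexx _)); apply: lt_le_trans; rewrite lte_fin.
have f00 : fock (fun _ : Cn => 0 : C) 
  by move: (fockZ 0 ff); congr fock; apply/funext => z; rewrite mul0r.
(* Linearity is given for combinations c f + h only, so the multiple is completed by h = 0. That the
   operator sends 0 to 0 is the case c = -1, f = h = 0. *)
have -> : (fun z => c * f z) = (fun z => c * f z + (fun=> 0) z) by apply/funext => z; rewrite addr0.
rewrite A2 // (_ : toeplitz g (fun=> 0) = fun=> 0).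
  rewrite (_ : (fun z => _) = (fun z => c * toeplitz g f z)); last by apply/funext => z; rewrite addr0.
  by rewrite L2normZ ?nc ?mulr_gt0 ?invr_gt0 //; exact: fock_bL2.
have := A2 (-1) _ _ f00 f00.
rewrite (_ : (fun z => -1 * 0 + 0) = (fun=> 0)); last by apply/funext => z; rewrite mulr0 addr0.
by move=> h; apply/funext => z; rewrite h mulN1r addNr.
Qed.

End bounded_symbols.

(** * Gaussian symbols act as sums of dilations *)

Section gaussian_symbols.
Context {R : realType} {n : nat}.
Local Notation C := R[i].
Local Notation Cn := 'rV[R[i]]_n.
Local Notation R2 := (measurableTypeR R * measurableTypeR R)%type.
Local Notation Tn := (n.-tuple R2).
Local Notation leb := (@lebC R n).
Implicit Types (a b z w u : Cn) (f g h : Cn -> C).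

Lemma toeplitz_opD g h B B' f : borel g -> borel h -> 0 <= B -> 0 <= B' ->
  (forall z, normc (g z) <= B) -> (forall z, normc (h z) <= B') -> fock f ->
  toeplitz_op (fun z => g z + h z) f = (fun z => toeplitz_op g f z + toeplitz_op h f z).
Proof.
move=> bg bh B0 B0' gB hB ff; apply/funext => z.
have b1 := bL2_bounded_mul bg B0 gB (fock_bL2 ff).
have b2 := bL2_bounded_mul bh B0' hB (fock_bL2 ff).
rewrite (@toeplitz_opE _ _ (fun z => g z + h z) (B + B')) //; last 3 first.
- exact: cmeasD.
- exact: addr_ge0.
- by move=> w; rewrite (le_trans (normcD _ _)) // lerD.
rewrite (toeplitz_opE bg B0 gB) // (toeplitz_opE bh B0' hB) //.
have -> : (fun w => (g w + h w) * f w) = (fun w => g w * f w + h w * f w).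
  by apply/funext => w; rewrite mulrDl.
exact: L2innerDl b1 b2 (kern_bL2 z).
Qed.

Lemma L2inner_suml (I : Type) (r : seq I) (F : I -> Cn -> C) h : bL2 h ->
  (forall i, bL2 (F i)) ->
  L2inner (fun z => \sum_(i <- r) F i z) h = \sum_(i <- r) L2inner (F i) h.
Proof.
move=> bh bF.
transitivity (cintegral leb (fun p => \sum_(i <- r)
    F i (of_coords p) * conjc (h (of_coords p)) * (gauss (of_coords p))%:C)).
  by apply: eq_cintegral => p; rewrite -!mulr_suml.
rewrite (@cintegral_sum _ _ _ leb _ r (fun i p =>
    F i (of_coords p) * conjc (h (of_coords p)) * (gauss (of_coords p))%:C)) //.
by move=> i; exact: inner_integrable.
Qed.

Definition gfactor (r : R) w : R := expR (- ((r^-1 - 1) * sqnorm w / 2)).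

Lemma rborel_gfactor r : rborel (gfactor r). Proof. exact: rborel_gauss. Qed.

(** Times the density of mu, the symbol gives a Gaussian of parameter 1/r. For that weight [kern z]
    is the reproducing kernel at r z, so the projection of the product is a dilation of f. *)
Lemma L2inner_gfactor (r : R) f z : 0 < r -> fock f ->
  bL2 (fun w => (gfactor r w)%:C * f w) ->
  L2inner (fun w => (gfactor r w)%:C * f w) (kern z) = (r ^+ n)%:C * f (r%:C *: z).
Proof.
move=> r0 ff bf; have bi := inner_integrable bf (kern_bL2 z).
have c0 : (((2 * pi) ^+ n)%:C : C) != 0.
  by rewrite -normc_eq0 normcR normr_eq0 expf_neq0 // lt0r_neq0 // two_pi_gt0.
have rC : r%:C != 0 :> C by rewrite -normc_eq0 normcR normr_eq0 lt0r_neq0.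
pose G w := f w * cexp ((r^-1)%:C * hdot (r%:C *: z) w / 2) * (expR (- (r^-1 * sqnorm w / 2)))%:C.
have GE w : G w = ((2 * pi) ^+ n)%:C * ((gfactor r w)%:C * f w * conjc (kern z w) * (gauss w)%:C).
  rewrite /G; have -> : expR (- (r^-1 * sqnorm w / 2)) = gfactor r w * expR (- (1 * sqnorm w / 2)).
    by rewrite -expRD; congr expR; field; rewrite lt0r_neq0.
  rewrite conjc_kern /kern hdotZl mulrA fmorphV /= mulVf // gaussE !RcM fmorphV /= !mul1r.
  by field.
have iG : cn_integrable G.
  have := cintegrableZl ((2 * pi) ^+ n)%:C bi.
  by apply: eq_cintegrable => p; rewrite GE.
have h : cint G = ((2 * pi / r^-1) ^+ n)%:C * f (r%:C *: z).
  apply: gauss_reproducing; [by rewrite invr_gt0|exact: ff.1|].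
  have [_] := iG; congr (_ < _)%E; apply: eq_integral => p _.
  by rewrite normcM normcR ger0_norm // expR_ge0.
apply: (mulfI c0); rewrite -(cintegralZl ((2 * pi) ^+ n)%:C bi).
transitivity (cint G); first by apply: eq_cintegral => p; rewrite GE.
by rewrite h invrK exprMn RcM mulrA.
Qed.

Variables (K : nat) (al rho : 'I_K -> R).
Hypothesis rho_in : forall k, 0 < rho k < 1.

Definition gsym_real w : R := \sum_k al k * rho k ^- n * gfactor (rho k) w.
Definition gsym w : C := (gsym_real w)%:C.

Let gbound : R := \sum_k `|al k * rho k ^- n|.

Lemma gfactor_le1 k w : gfactor (rho k) w <= 1.
Proof.
have /andP[r0 r1] := rho_in k.
rewrite -expR0 ler_expR oppr_le0 divr_ge0 // mulr_ge0 ?sqnorm_ge0 // subr_ge0.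
by rewrite invf_ge1 // ltW.
Qed.

Lemma borel_gsym : borel gsym.
Proof.
apply: borelR; apply: measurable_sum => k.
by apply: measurable_funM; [exact: measurable_cst|exact: rborel_gfactor].
Qed.

Lemma gbound_ge0 : 0 <= gbound. Proof. by apply: sumr_ge0. Qed.

Lemma gsym_le w : normc (gsym w) <= gbound.
Proof.
rewrite normcR (le_trans (ler_norm_sum _ _ _)) //; apply: ler_sum => k _.
by rewrite normrM ler_piMr // ger0_norm ?expR_ge0 // gfactor_le1.
Qed.

Definition dilation_sum f z : C := \sum_k (al k)%:C * f ((rho k)%:C *: z).

Lemma toeplitz_gsym f : fock f -> toeplitz_op gsym f = dilation_sum f.
Proof.
move=> ff; apply/funext => z; rewrite (toeplitz_opE borel_gsym gbound_ge0 gsym_le) //.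
have b1 k : bL2 (fun w => (gfactor (rho k) w)%:C * f w).
  apply: (bL2_bounded_mul _ ler01 _ (fock_bL2 ff)).
    by apply: borelR; exact: rborel_gfactor.
  by move=> w; rewrite normcR ger0_norm ?expR_ge0 // gfactor_le1.
have b2 k : bL2 (fun w => (al k * rho k ^- n)%:C * ((gfactor (rho k) w)%:C * f w)).
  exact: bL2Z.
have -> : (fun w => gsym w * f w) =
    (fun w => \sum_k (al k * rho k ^- n)%:C * ((gfactor (rho k) w)%:C * f w)).
  apply/funext => w; rewrite /gsym /gsym_real rmorph_sum mulr_suml; apply: eq_bigr => k _.
  by rewrite mulrA -RcM.
rewrite (L2inner_suml _ (kern_bL2 z) b2); apply: eq_bigr => k _.
have /andP[r0 _] := rho_in k.
rewrite (L2innerZl _ (b1 k) (kern_bL2 z)) L2inner_gfactor // mulrA -RcM.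
by rewrite mulfVK // expf_neq0 // lt0r_neq0.
Qed.

Lemma heat_gsym (t : R) : 0 < t ->
  heat t gsym 0 = (\sum_k al k * (2 * t - (2 * t - 1) * rho k) ^- n)%:C.
Proof.
(* The parameter of the Gaussian obtained from the k-th symbol times the heat kernel centred at 0;
   [2 * t - (2 * t - 1) * rho k] equals [rho k * be k * (2 * t)]. *)
move=> t0; pose be k : R := (rho k)^-1 - 1 + (2 * t)^-1.
have b0 k : 0 < be k.
  have /andP[r0 r1] := rho_in k.
  by rewrite ltr_wpDl ?invr_gt0 ?mulr_gt0 // subr_ge0 invf_ge1 // ltW.
pose F k w : C := (expR (- (be k * sqnorm w / 2)))%:C.
have iF k : cn_integrable (F k).
  apply: (@cintegrable_dom _ _ _ _ _ (fun p : Tn => expR (- (be k * sqnorm (of_coords p) / 2)))).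
  - by apply: cmeasR; exact: rborel_gauss.
  - exact: rborel_gauss.
  - by move=> p; rewrite normcR ger0_norm // expR_ge0.
  - have := @nnint_gauss _ n _ (b0 k); rewrite /nnint /fint => ->; exact: ltry.
have cF k : cint (F k) = ((2 * pi / be k) ^+ n)%:C.
  rewrite -[LHS]/(cintegral leb (fun p => (expR (- (be k * sqnorm (of_coords p) / 2)))%:C)).
  rewrite cintegralR; last by move=> p; exact: expR_ge0.
  by have := @nnint_gauss _ n _ (b0 k); rewrite /nnint /fint => ->.
rewrite /heat.
have -> : cint (heat_integrand t gsym 0) =
    cintegral leb (fun p => \sum_k (al k * rho k ^- n)%:C * F k (of_coords p)).
  apply: eq_cintegral => p; rewrite /heat_integrand /gsym /gsym_real -RcM mulr_suml rmorph_sum.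
  apply: eq_bigr => k _; rewrite -RcM /= -mulrA -expRD subr0; congr (_ * expR _)%:C.
  by rewrite /be; field; rewrite (lt0r_neq0 t0); case/andP: (rho_in k) => /lt0r_neq0 ->.
rewrite cintegral_sum; last by move=> k; exact: cintegrableZl (iF k).
rewrite mulr_sumr rmorph_sum; apply: eq_bigr => k _.
rewrite (cintegralZl _ (iF k)) -[cintegral _ _]/(cint (F k)) cF -!RcM /=.
congr _%:C; rewrite mulrCA -!mulrA; congr (_ * _); rewrite -!exprVn -!exprMn; congr (_ ^+ _).
have /andP[r0 r1] := rho_in k.
have : pi != 0 :> R := lt0r_neq0 (pi_gt0 R).
have h : 2 * t - (2 * t - 1) * rho k = rho k * be k * (2 * t).
  by rewrite /be; field; rewrite (lt0r_neq0 t0) (lt0r_neq0 r0).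
rewrite h; move: (pi : R) (be k) (b0 k) => x y y0 x0; field.
by rewrite x0 (lt0r_neq0 t0) (lt0r_neq0 r0) (lt0r_neq0 y0).
Qed.

Lemma heat_small (t eta : R) g : 0 < t -> borel g -> (forall w, normc (g w) <= eta) ->
  cn_integrable (heat_integrand t g 0) /\ normc (heat t g 0) <= eta.
Proof.
move=> t0 bg ge; have e0 : 0 <= eta by rewrite (le_trans _ (ge 0)) // normc_ge0.
pose G w : R := expR (- ((2 * t)^-1 * sqnorm w / 2)).
have t2 : 0 < (2 * t)^-1 by rewrite invr_gt0 mulr_gt0.
have GE w : heat_integrand t g 0 w = g w * (G w)%:C.
  by rewrite /heat_integrand subr0; congr (_ * (expR _)%:C); field; rewrite lt0r_neq0.
have bG : rborel G by exact: rborel_gauss.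
have nG : nnint (fun w => eta * G w) = (eta * (4 * pi * t) ^+ n)%:E.
  rewrite nnintZl // ?nnint_gauss //; last by move=> w; exact: expR_ge0.
  by rewrite -EFinM; congr (_ * _ ^+ _)%:E; move: (pi : R) => x; field; rewrite lt0r_neq0.
have hle w : normc (heat_integrand t g 0 w) <= eta * G w.
  by rewrite GE normcM normcR (ger0_norm (expR_ge0 _)) ler_wpM2r ?expR_ge0.
have meG : rborel (fun w => eta * G w) by apply: measurable_funM => //; exact: measurable_cst.
have bh : borel (heat_integrand t g 0).
  rewrite (_ : heat_integrand t g 0 = fun w => g w * (G w)%:C); last by apply/funext.
  by apply: borelM bg _; exact: borelR.
have ih : cn_integrable (heat_integrand t g 0).
  apply: (@cintegrable_dom _ _ _ _ _ (fun p : Tn => eta * G (of_coords p))) => //.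
  by have := nG; rewrite /nnint /fint => ->; exact: ltry.
split => //.
have p0 : 0 < (4 * pi * t) ^+ n by rewrite exprn_gt0 // !mulr_gt0 // pi_gt0.
rewrite /heat normcM normcR ger0_norm; last by rewrite invr_ge0 ltW.
rewrite mulrC ler_pdivrMr //; apply: (normc_cintegral_bound ih).
rewrite -nG; apply: le_fint => //.
- exact: measurable_normc ih.1.
- by move=> p; exact: normc_ge0.
Qed.

Variables (chi : Cn -> R) (eta : R).
Hypotheses (bchi : rborel chi) (eta_ge0 : 0 <= eta)
  (chi_close : forall w, normc ((chi w)%:C * gsym w - gsym w) <= eta).

Definition tsym w : C := (chi w)%:C * gsym w.

Let rest w : C := tsym w - gsym w.

Let borel_tsym : borel tsym.
Proof. by apply: borelM; [exact: borelR|exact: borel_gsym]. Qed.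

Let borel_rest : borel rest.
Proof. by apply: cmeasB; [exact: borel_tsym|exact: borel_gsym]. Qed.

Lemma toeplitz_tsym_norm f : (forall f, fock f -> L2norm (dilation_sum f) <= L2norm f) ->
  fock f -> L2norm (toeplitz_op tsym f) <= (1 + eta) * L2norm f.
Proof.
move=> S1 ff.
have -> : tsym = (fun w => gsym w + rest w).
  by apply/funext => w; rewrite /rest addrC subrK.
rewrite (toeplitz_opD borel_gsym borel_rest gbound_ge0 eta_ge0 gsym_le chi_close ff).
have fr := toeplitz_op_fock borel_rest eta_ge0 chi_close ff.
have fg := toeplitz_op_fock borel_gsym gbound_ge0 gsym_le ff.
apply: le_trans (L2norm_triangle (fock_bL2 fg) (fock_bL2 fr)) _.
rewrite mulrDl mul1r lerD //; first by rewrite toeplitz_gsym // S1.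
exact: toeplitz_op_bound borel_rest eta_ge0 chi_close _ ff.
Qed.

Lemma heat_tsym_ge (t : R) : 0 < t ->
  \sum_k al k * (2 * t - (2 * t - 1) * rho k) ^- n - eta <= normc (heat t tsym 0).
Proof.
move=> t0; have [i1 h1] := heat_small t0 borel_rest chi_close.
have [i2 _] := heat_small t0 borel_gsym gsym_le.
have E : heat t tsym 0 = heat t gsym 0 + heat t rest 0.
  rewrite /heat -mulrDr; congr (_ * _).
  transitivity (cintegral leb (fun p => heat_integrand t gsym 0 (of_coords p) +
      heat_integrand t rest 0 (of_coords p))); last exact: cintegralD.
  by apply: eq_cintegral => p; rewrite /heat_integrand /rest; ring.
set s := \sum_k _; have -> : s = complex.Re (heat t gsym 0) by rewrite heat_gsym.
have := le_trans (ler_norm _) (Re_le_normc (heat t tsym 0)).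
have := le_trans (ler_norm _) (Re_le_normc (- heat t rest 0)).
rewrite E normc_opp ReN ReD => h2 h3; lra.
Qed.

End gaussian_symbols.

(** * Contractivity of sums of dilations *)

Section circle_polynomials.
Context {R : realType}.
Local Notation C := R[i].
Local Notation circ := (@circ R).
Implicit Types (c : nat -> C) (M k : nat).

(** Monomials are viewed as entire functions on C^1, so that [entire_circle_mean] yields their
    vanishing averages and with them orthogonality on the circle. *)
Lemma entire_monomial k : entire (fun v : 'rV[C]_1 => v 0 0 ^+ k).
Proof.
have l1 : entire (fun v : 'rV[C]_1 => v 0 0).
  have -> : (fun v : 'rV[C]_1 => v 0 0) = (fun v => \sum_j v 0 j * 1).
    by apply/funext => v; rewrite big_ord1 mulr1.
  by move=> z; exact: differentiable_linear_form.
elim: k => [|k IH]; first exact: entire_cst.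
rewrite (_ : (fun v => _) = fun v : 'rV[C]_1 => v 0 0 * v 0 0 ^+ k).
  exact: entireM.
by apply/funext => v; rewrite exprS.
Qed.

Lemma ccont_unitX k : ccont (fun t : R => unit_c t ^+ k).
Proof.
have := entire_circle_ccont (const_mx 1) (entire_monomial k).
by under eq_fun do rewrite !mxE mulr1.
Qed.

Lemma circle_monomial k : (0 < k)%N -> cintegral circ (fun t => unit_c t ^+ k) = 0.
Proof.
move=> k0; transitivity ((0 : 'rV[C]_1) 0 0 ^+ k); last by rewrite mxE expr0n; case: k k0.
rewrite -(entire_circle_mean (const_mx 1) (entire_monomial k)).
by apply: eq_cintegral => t; rewrite !mxE mulr1.
Qed.

Lemma unit_cK (t : R) : unit_c t * conjc (unit_c t) = 1.
Proof. by rewrite mul_conj normc_unit_c expr1n. Qed.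

Lemma conjcX (z : C) (m : nat) : conjc (z ^+ m) = conjc z ^+ m.
Proof. exact: rmorphXn. Qed.

Lemma fint_circ_cst (x : R) : fint circ (fun=> x) = x%:E.
Proof. rewrite /fint integral_cst // [X in (_ * X)%E](_ : _ = 1%E) ?mule1 //.
exact: probability_setT circ. Qed.

Lemma cintegrable_circ_bounded (F : measurableTypeR R -> C) (B : R) :
  cmeas F -> (forall t, normc (F t) <= B) -> cintegrable circ F.
Proof.
move=> mF FB; apply: (@cintegrable_dom _ _ _ _ _ (fun=> B)) => //.
by rewrite fint_circ_cst ltry.
Qed.

Lemma cmeas_unitX (k : nat) : cmeas (fun t : measurableTypeR R => unit_c t ^+ k).
Proof. by apply: ccont_cmeas; exact: ccont_unitX. Qed.

Lemma circle_monomial_integrable (m l : nat) :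
  cintegrable circ (fun t => unit_c t ^+ m * conjc (unit_c t ^+ l)).
Proof.
apply: (@cintegrable_circ_bounded _ 1).
  by apply: cmeasM; [|apply: cmeas_conj]; exact: cmeas_unitX.
by move=> t; rewrite normcM normc_conj !normcX normc_unit_c !expr1n mulr1.
Qed.

Lemma circle_orthogonal (m l : nat) :
  cintegral circ (fun t => unit_c t ^+ m * conjc (unit_c t ^+ l)) = (m == l)%:R.
Proof.
wlog lm : m l / (l <= m)%N => [h|].
  have [|lm] := leqP l m; first exact: h.
  rewrite eq_sym -[RHS](conjc_nat) -h ?(ltnW lm) // -cintegral_conj.
    by apply: eq_cintegral => t; rewrite conjcM conjcK mulrC.
  exact: circle_monomial_integrable.
have E (t : R) : unit_c t ^+ m * conjc (unit_c t ^+ l) = unit_c t ^+ (m - l).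
  by rewrite conjcX -{1}(subnK lm) exprD -mulrA -exprMn unit_cK expr1n mulr1.
rewrite (eq_cintegral circ E) eqn_leq lm andbT; have [ml|ml] := leqP m l.
  by rewrite (_ : (m - l)%N = 0%N) ?cintegral_circ_cst //; apply/eqP.
by rewrite circle_monomial // subn_gt0.
Qed.

Definition cpoly c M (z : C) : C := \sum_(m < M) c m * z ^+ m.

Lemma cmeas_cpoly c M : cmeas (fun t : measurableTypeR R => cpoly c M (unit_c t)).
Proof.
apply: cmeas_sum => m; apply: cmeasM; first exact: cmeas_cst.
by apply: ccont_cmeas; exact: ccont_unitX.
Qed.

Lemma circle_parseval c M :
  fint circ (fun t => normc (cpoly c M (unit_c t)) ^+ 2) = (\sum_(m < M) normc (c m) ^+ 2)%:E.
Proof.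
pose p t := cpoly c M (unit_c t).
have E (t : R) : (normc (p t) ^+ 2)%:C = \sum_(m < M) \sum_(l < M)
    (c m * conjc (c l)) * (unit_c t ^+ m * conjc (unit_c t ^+ l)).
  rewrite -mul_conj /p /cpoly (big_morph (@conjc R) (@conjcD R) (conjc0 R)) mulr_suml.
  apply: eq_bigr => m _; rewrite mulr_sumr; apply: eq_bigr => l _.
  by rewrite conjcM mulrACA.
have im (m l : 'I_M) := cintegrableZl (c m * conjc (c l)) (circle_monomial_integrable m l).
have mp : measurable_fun setT (fun t : measurableTypeR R => normc (p t) ^+ 2).
  by apply: measurable_funX; exact: measurable_normc (cmeas_cpoly c M).
have p0 t : 0 <= normc (p t) ^+ 2 by rewrite exprn_ge0 // normc_ge0.
have pb t : normc (p t) ^+ 2 <= (\sum_(m < M) normc (c m)) ^+ 2.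
  rewrite lerXn2r ?nnegrE ?normc_ge0 //; first by apply: sumr_ge0 => m _; exact: normc_ge0.
  rewrite (le_trans (normc_sum _ _ _)) //; apply: ler_sum => m _.
  by rewrite normcM normcX normc_unit_c expr1n mulr1.
have ff : fint circ (fun t => normc (p t) ^+ 2) \is a fin_num.
  rewrite ge0_fin_numE; last exact: fint_ge0.
  apply: (@le_lt_trans _ _ (fint circ (fun=> (\sum_(m < M) normc (c m)) ^+ 2))).
    by apply: le_fint => //; exact: measurable_cst.
  by rewrite fint_circ_cst ltry.
rewrite -/p -(fineK ff); congr EFin; apply: complexI.
rewrite -[LHS](cintegralR circ p0) (eq_cintegral circ E).
rewrite cintegral_sum; last by move=> m; apply: cintegrable_sum => l; exact: im.
rewrite rmorph_sum; apply: eq_bigr => m _; rewrite cintegral_sum; last exact: im.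
rewrite (bigD1 m) //= big1 => [|l lm]; rewrite cintegralZl; try exact: circle_monomial_integrable.
  by rewrite circle_orthogonal eqxx mulr1 addr0 mul_conj.
by rewrite circle_orthogonal eq_sym (negbTE (lm : (val l != val m))) mulr0.
Qed.

End circle_polynomials.

(** * Taylor expansion on circles and the contraction estimate *)

Section dilation_contraction.
Context {R : realType} {n : nat}.
Local Notation C := R[i].
Local Notation Cn := 'rV[R[i]]_n.
Local Notation R2 := (measurableTypeR R * measurableTypeR R)%type.
Local Notation Tn := (n.-tuple R2).
Local Notation leb := (@lebC R n).
Local Notation circ := (@circ R).
Implicit Types (a b z w u : Cn) (f g h : Cn -> C).

Lemma exp_term_le (x : R) m : 0 <= x -> (m`!%:R)^-1 * x ^+ m <= expR x.
Proof.
move=> x0; case: m => [|m].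
  by rewrite fact0 expr0 invr1 mulr1 -expR0 ler_expR.
have := expR_ge1Dxn m x0; rewrite mulrC => h; apply: le_trans h; by rewrite lerDr.
Qed.

Definition half_dot z w : C := hdot z w / 2.

(** Of the exponent 3, one unit pays for the factor e^|x| in the Taylor remainder of the
    exponential, and two units give |x|^M / M! <= 2^-M e^(2|x|), hence a geometric rate. *)
Definition envelope z w : C := (expR (3 * normc (half_dot z w)))%:C.

Let borel_half_dot z : borel (half_dot z).
Proof.
apply: cmeasM; last exact: cmeas_cst.
by apply: cmeas_hdot; [exact: vmeas_cst|exact: vmeas_of_coords].
Qed.

Let envelope_bL2 z : bL2 (envelope z).
Proof.
apply: (@bL2_growth _ _ _ (expR (9 / 2 * sqnorm z))).
  apply: borelR; apply: measurableT_comp => //; apply: measurable_funM; first exact: measurable_cst.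
  exact: borel_normc.
move=> w; rewrite normcR ger0_norm ?expR_ge0 // -expRD ler_expR.
have n2 : normc (2^-1 : C) = 2^-1.
  rewrite (_ : 2^-1 = (2^-1)%:C); first by rewrite normcR ger0_norm ?invr_ge0.
  by rewrite fmorphV /= rmorph_nat.
have h6 : 0 < 6 :> R by rewrite ltr0n.
have := normc_hdot_le z w h6; rewrite /half_dot normcM n2; lra.
Qed.

(** For f in F^2, the m-homogeneous part of f at z, that is, the coefficient of c^m in f (c z),
    obtained by expanding the reproducing kernel. *)
Definition taylor f z m : C :=
  cint (fun w => f w * ((half_dot z w) ^+ m * ((m`!%:R)^-1)%:C) * (gauss w)%:C).

Let taylor_integrable f z m : bL2 f ->
  cn_integrable (fun w => f w * ((half_dot z w) ^+ m * ((m`!%:R)^-1)%:C) * (gauss w)%:C).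
Proof.
move=> bf; have [b1 b2] := inner_integrable bf (envelope_bL2 z).
apply: (@cintegrable_dom _ _ _ _ _ (fun p => normc (f (of_coords p) *
  conjc (envelope z (of_coords p)) * (gauss (of_coords p))%:C))) => //.
- apply: cmeasM; last by apply: borelR; exact: rborel_gauss1.
  apply: cmeasM; first exact: bf.1.
  by apply: cmeasM; [apply: cmeasX; exact: borel_half_dot|exact: cmeas_cst].
- exact: measurable_normc.
- move=> p; rewrite ![normc (_ * (gauss _)%:C)]normcM ler_wpM2r ?normc_ge0 //.
  rewrite ![normc (f _ * _)]normcM ler_wpM2l ?normc_ge0 // normc_conj normcM normcX !normcR.
  rewrite ger0_norm ?invr_ge0 // ger0_norm ?expR_ge0 // mulrC.
  rewrite (le_trans (exp_term_le _ (normc_ge0 _))) // ler_expR.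
  by have := normc_ge0 (half_dot z (of_coords p)); lra.
Qed.

(** The exponential series of the kernel is truncated under the integral; the constant is the
    integral of |f| against [envelope]. Uniformity on the closed unit disc covers the circle through
    z and its dilates. *)
Lemma taylor_remainder f z : fock f -> exists2 B : R, 0 <= B & forall (c : C) M, normc c <= 1 ->
  normc (f (c *: z) - cpoly (taylor f z) M c) <= B * 2 ^- M.
Proof.
move=> ff; have bf := fock_bL2 ff; have ie := inner_integrable bf (envelope_bL2 z).
pose N := nnint (fun w => normc (f w * conjc (envelope z w) * (gauss w)%:C)).
have N0 : (0 <= N)%E by apply: nnint_ge0 => w; exact: normc_ge0.
have Nf : N \is a fin_num by rewrite ge0_fin_numE //; exact: ie.2.
exists (fine N); first exact: fine_ge0.
move=> c M c1.
have it m := taylor_integrable z m bf.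
have E1 : f (c *: z) = cint (fun w => f w * cexp (c * half_dot z w) * (gauss w)%:C).
  rewrite (fock_reproducing _ ff); apply: eq_cintegral => p.
  by rewrite conjc_kern /kern hdotZl mulrA.
have i1 : cn_integrable (fun w => f w * cexp (c * half_dot z w) * (gauss w)%:C).
  have := inner_integrable bf (kern_bL2 (c *: z)).
  by apply: eq_cintegrable => p; rewrite conjc_kern /kern hdotZl mulrA.
have i2 : cn_integrable (fun w => f w * cexp_sum M (c * half_dot z w) * (gauss w)%:C).
  have := cintegrable_sum (index_enum 'I_M) (fun m : 'I_M => cintegrableZl (c ^+ m) (it m)).
  apply: eq_cintegrable => p; rewrite /cexp_sum mulr_sumr mulr_suml; apply: eq_bigr => m _.
  by rewrite [(c * _) ^+ _]exprMn; ring.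
have E2 : cpoly (taylor f z) M c = cint (fun w => f w * cexp_sum M (c * half_dot z w) * (gauss w)%:C).
  transitivity (\sum_(m < M) c ^+ m * taylor f z m).
    by apply: eq_bigr => m _; rewrite mulrC.
  under eq_bigr do rewrite /taylor -(cintegralZl _ (it _)).
  rewrite -(cintegral_sum _ (fun m : 'I_M => cintegrableZl (c ^+ m) (it m))).
  apply: eq_cintegral => p; rewrite /cexp_sum mulr_sumr mulr_suml; apply: eq_bigr => m _.
  by rewrite [(c * _) ^+ _]exprMn; ring.
rewrite E1 E2 -(cintegralB i1 i2); apply: (normc_cintegral_bound (cintegrableB i1 i2)).
rewrite mulrC EFinM fineK // -nnintZl; last 3 first.
- by apply: borel_normc; exact: ie.1.
- by move=> w; exact: normc_ge0.
- by rewrite invr_ge0 exprn_ge0.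
apply: le_fint.
- exact: measurable_normc (cintegrableB i1 i2).1.
- by apply: measurable_funM; [exact: measurable_cst|exact: measurable_normc ie.1].
- by move=> p; exact: normc_ge0.
move=> p; rewrite -mulrBl -mulrBr.
set x := half_dot z (of_coords p).
rewrite ![normc (_ * (gauss _)%:C)]normcM [2 ^- M * _]mulrA ler_wpM2r ?normc_ge0 //.
rewrite ![normc (f _ * _)]normcM [2 ^- M * _]mulrCA ler_wpM2l ?normc_ge0 // normc_conj normcR.
rewrite (ger0_norm (expR_ge0 _)) (le_trans (cexp_remainder _ _)) //.
have x0 := normc_ge0 x; have cx : normc (c * x) <= normc x by rewrite normcM ler_piMl.
have cx0 := normc_ge0 (c * x).
apply: (@le_trans _ _ (expR (normc x) * ((M`!%:R)^-1 * normc x ^+ M))).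
  apply: ler_pM; rewrite ?expR_ge0 ?ler_expR // ?mulr_ge0 ?invr_ge0 ?exprn_ge0 //.
  by rewrite ler_wpM2l ?invr_ge0 // lerXn2r ?nnegrE.
have x2 : 0 <= 2 * normc x by rewrite mulr_ge0.
have := exp_term_le M x2; rewrite exprMn => h.
have -> : expR (3 * normc x) = expR (normc x) * expR (2 * normc x) by rewrite -expRD; congr expR; ring.
rewrite [2 ^- M * _]mulrCA ler_wpM2l ?expR_ge0 // [leRHS]mulrC.
by rewrite ler_pdivlMr ?exprn_gt0 // -mulrA [_ ^+ M * 2 ^+ M]mulrC.
Qed.

Lemma vmeas_circle z : vmeas (fun t : measurableTypeR R => unit_c t *: z).
Proof. by apply: vmeasZ; [exact: cmeas_unitX 1%N|exact: vmeas_cst]. Qed.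

Lemma sq_perturb (x y d b : R) : 0 <= x -> 0 <= y -> `|x - y| <= d -> d <= b -> y <= b ->
  x ^+ 2 <= y ^+ 2 + 3 * b * d.
Proof.
move=> x0 y0 xy db yb; have : x <= y + d by move: xy; rewrite ler_norml => /andP[]; lra.
move=> h; have d0 : 0 <= d := le_trans (normr_ge0 _) xy.
have : x * x <= (y + d) * (y + d) by exact: ler_pM.
have : y * d <= b * d by rewrite ler_wpM2r.
have : d * d <= b * d by rewrite ler_wpM2r.
nra.
Qed.

Lemma normc_sub_le (v w : C) (d : R) : normc (v - w) <= d -> `|normc v - normc w| <= d.
Proof.
move=> h; rewrite ler_norml; have h1 := normcD (v - w) w; have h2 := normcD (w - v) v.
by move: h1 h2; rewrite !subrK (normcBC w v) => h1 h2; apply/andP; split; lra.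
Qed.

Variables (K : nat) (al rho : 'I_K -> R).
Hypothesis rho_in : forall k, 0 < rho k < 1.
Hypothesis moment_le1 : forall m, `|\sum_k al k * rho k ^+ m| <= 1.

Let gam m : R := \sum_k al k * rho k ^+ m.

(* On the circle through z the dilation sum multiplies the m-th Fourier coefficient of f
   by the m-th moment, so Parseval applies to the Taylor polynomials. *)
Lemma dilation_sum_circle f z : fock f ->
  (fint circ (fun t => (normc (dilation_sum al rho f (unit_c t *: z)) ^+ 2)%R) <=
   fint circ (fun t => (normc (f (unit_c t *: z)) ^+ 2)%R))%E.
Proof.
move=> ff; have [B B0 HB] := taylor_remainder z ff.
pose d := taylor f z; pose L := \sum_k `|al k|; have L0 : 0 <= L by apply: sumr_ge0.
pose phi (t : measurableTypeR R) := f (unit_c t *: z).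
pose psi (t : measurableTypeR R) := dilation_sum al rho f (unit_c t *: z).
pose phiM M (t : measurableTypeR R) := cpoly d M (unit_c t).
pose psiM M (t : measurableTypeR R) := cpoly (fun m => (gam m)%:C * d m) M (unit_c t).
have hphi M t : normc (phi t - phiM M t) <= B * 2 ^- M by apply: HB; rewrite normc_unit_c.
have hpsi M t : normc (psi t - psiM M t) <= L * B * 2 ^- M.
  have -> : psiM M t = \sum_k (al k)%:C * cpoly d M ((rho k)%:C * unit_c t).
    rewrite /psiM /cpoly; under [RHS]eq_bigr do rewrite mulr_sumr.
    rewrite exchange_big; apply: eq_bigr => m _.
    rewrite /gam rmorph_sum /= !mulr_suml; apply: eq_bigr => k _.
    by rewrite RcM exprMn rmorphXn /=; ring.
  rewrite /psi /dilation_sum -sumrB (le_trans (normc_sum _ _ _)) // /L !mulr_suml.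
  apply: ler_sum => k _; rewrite -mulrBr normcM normcR -mulrA ler_wpM2l // scalerA.
  have /andP[r0 r1] := rho_in k.
  apply: HB; rewrite normcM normcR normc_unit_c mulr1 ger0_norm ltW //.
(* At M = 0 the approximating polynomial is zero, so the remainder estimates become bounds on [phi]
   and [psi] themselves. *)
have cpoly0 (c : nat -> C) (v : C) : cpoly c 0 v = 0 by rewrite /cpoly big_ord0.
have bphi t : normc (phi t) <= B.
  by have := hphi 0%N t; rewrite /phiM cpoly0 subr0 expr0 invr1 mulr1.
have bpsi t : normc (psi t) <= L * B.
  by have := hpsi 0%N t; rewrite /psiM cpoly0 subr0 expr0 invr1 mulr1.
have LB0 : 0 <= L * B by rewrite mulr_ge0.
have pw M : 0 < 2 ^- M :> R by rewrite invr_gt0 exprn_gt0.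
have pw1 M : 2 ^- M <= 1 :> R by rewrite invf_le1 ?exprn_gt0 // exprn_ege1 // ler1n.
have msq (F : measurableTypeR R -> C) : cmeas F -> measurable_fun setT (fun t => normc (F t) ^+ 2).
  by move=> mF; apply: measurable_funX; exact: measurable_normc.
have mphi : cmeas phi by apply: (borel_comp (fock_bL2 ff).1); exact: vmeas_circle.
have mpsi : cmeas psi.
  apply: cmeas_sum => k; apply: cmeasM; first exact: cmeas_cst.
  apply: (borel_comp (fock_bL2 ff).1 (F := fun t => (rho k)%:C *: (unit_c t *: z))).
  by apply: vmeasZ; [exact: cmeas_cst|exact: vmeas_circle].
have n2 (F : measurableTypeR R -> C) t : 0 <= normc (F t) ^+ 2 by rewrite exprn_ge0 // normc_ge0.
pose c := 3 * (2 * (L * B)) * (L * B) + 3 * B * B.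
have c0 : 0 <= c by rewrite addr_ge0 // !mulr_ge0.
(* From [psi] to its polynomial, by Parseval with moments at most 1 to the polynomial of [phi], and
   back to [phi]: each approximation costs a multiple of 2^-M. *)
have step M : (fint circ (fun t => (normc (psi t) ^+ 2)%R) <=
    fint circ (fun t => (normc (phi t) ^+ 2)%R) + (c * 2 ^- M)%:E)%E.
  have e1 : (fint circ (fun t => (normc (psi t) ^+ 2)%R) <=
      fint circ (fun t => (normc (psiM M t) ^+ 2)%R) + (3 * (2 * (L * B)) * (L * B) * 2 ^- M)%:E)%E.
    rewrite -fint_circ_cst -fintD //; try exact: msq; try exact: msq (cmeas_cpoly _ _); last first.
      by move=> _; rewrite !mulr_ge0 // ltW.
    apply: le_fint; [exact: msq| |by []|].
      by apply: measurable_funD; [exact: msq (cmeas_cpoly _ _)|exact: measurable_cst].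
    move=> t; rewrite -[3 * _ * (L * B) * _]mulrA.
    have h := hpsi M t; have hb : L * B * 2 ^- M <= L * B by rewrite ler_piMr.
    apply: sq_perturb; rewrite ?normc_ge0 //; first exact: normc_sub_le.
      by rewrite (le_trans hb) // ler_peMl // ler1n.
    have := normcD (psiM M t - psi t) (psi t); rewrite subrK normcBC => h2.
    by have := bpsi t; move: h2 h hb; lra.
  have e2 : (fint circ (fun t => (normc (phiM M t) ^+ 2)%R) <=
      fint circ (fun t => (normc (phi t) ^+ 2)%R) + (3 * B * B * 2 ^- M)%:E)%E.
    rewrite -fint_circ_cst -fintD //; try exact: msq; last first.
      by move=> _; rewrite !mulr_ge0 // ltW.
    apply: le_fint; [exact: msq (cmeas_cpoly _ _)| |by []|].
      by apply: measurable_funD; [exact: msq|exact: measurable_cst].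
    move=> t; rewrite -[3 * B * B * _]mulrA.
    have h := hphi M t; have hb : B * 2 ^- M <= B by rewrite ler_piMr.
    apply: sq_perturb; rewrite ?normc_ge0 //.
    by apply: normc_sub_le; rewrite normcBC.
  apply: le_trans e1 _.
  have -> : c * 2 ^- M = 3 * B * B * 2 ^- M + 3 * (2 * (L * B)) * (L * B) * 2 ^- M.
    by rewrite /c [LHS]mulrDl addrC.
  rewrite EFinD addeA.
  rewrite leeD2r // (le_trans _ e2) // /psiM /phiM !circle_parseval lee_fin.
  apply: ler_sum => m _; rewrite normcM normcR exprMn ler_piMl ?exprn_ge0 ?normc_ge0 //.
  by apply: exprn_ile1 => //; exact: moment_le1.
apply/lee_addgt0Pr => e e0.
pose M := Num.bound (c / e).
apply: le_trans (step M) _; rewrite leeD2l // lee_fin ler_pdivrMr ?exprn_gt0 //.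
rewrite mulrC -ler_pdivrMr //.
have h : c / e < M%:R by apply: archi_boundP; rewrite divr_ge0 // ltW.
rewrite (le_trans (ltW h)) // -natrX ler_nat ltnW //; exact: ltn_expl.
Qed.

Lemma measurable_circle_average (u : Cn -> R) : rborel u -> (forall z, 0 <= u z) ->
  measurable_fun setT (fun p : Tn => fint circ (fun t => u (unit_c t *: of_coords p))).
Proof.
move=> bu u0; apply: (@measurable_fun_fubini_tonelli_G _ _ _ _ _ circ
  (fun q : measurableTypeR R * Tn => (u (unit_c q.1 *: of_coords q.2))%:E)).
- by apply/measurable_EFinP; apply: (rborel_comp bu); exact: vmeas_rot.
- by move=> q; rewrite lee_fin.
Qed.

Lemma gauss_circle (t : R) z : gauss (unit_c t *: z) = gauss z.
Proof. by rewrite !gaussE sqnormZ normc_unit_c expr1n mul1r. Qed.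

(** Averaging over rotations stands in for the orthogonality of homogeneous parts of different
    degree: the inequality on each circle, weighted by the constant value of the density there,
    integrates to the inequality of norms. *)
Lemma dilation_sum_contraction f : fock f -> L2norm (dilation_sum al rho f) <= L2norm f.
Proof.
move=> ff; have bf := fock_bL2 ff.
have fS : fock (dilation_sum al rho f).
  rewrite -(toeplitz_gsym al rho_in ff).
  exact: (toeplitz_op_fock (borel_gsym _ _) (gbound_ge0 _ _) (gsym_le _ rho_in) ff).
have bS := fock_bL2 fS.
apply: (L2norm_le bS (L2norm_ge0 f)); rewrite L2norm_sq bL2_fineK //.
have n0 h z : 0 <= normc (h z) ^+ 2 * gauss z by exact: sq_gauss_ge0.
rewrite /sqL2norm (rotation_average (rborel_sq bS.1) (n0 _)) (rotation_average (rborel_sq bf.1) (n0 _)).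
apply: ge0_le_integral => //.
- by move=> p _; apply: fint_ge0 => t; exact: n0.
- exact: measurable_circle_average (rborel_sq bS.1) (n0 _).
- exact: measurable_circle_average (rborel_sq bf.1) (n0 _).
move=> p _; have E h : fock h ->
    fint circ (fun t => normc (h (unit_c t *: of_coords p)) ^+ 2 * gauss (unit_c t *: of_coords p)) =
    ((gauss (of_coords p))%:E * fint circ (fun t => (normc (h (unit_c t *: of_coords p)) ^+ 2)%R))%E.
  move=> fh; rewrite -fintZl.
  - by apply: eq_integral => t _; rewrite gauss_circle mulrC.
  - apply: measurable_funX; apply: measurable_normc.
    by apply: (borel_comp (fock_bL2 fh).1); exact: vmeas_circle.
  - by move=> t; rewrite exprn_ge0 // normc_ge0.
  - exact: gauss_ge0.
rewrite (E _ fS) (E _ ff) lee_wpmul2l ?lee_fin ?gauss_ge0 //.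
exact: dilation_sum_circle.
Qed.

End dilation_contraction.

(** * Choice of the coefficients *)

Section coefficients.
Context {R : realType}.
Implicit Types (x q r eta : R) (n m M N : nat).

(* The Taylor coefficients of (1 - x)^-n at 0. *)
Fixpoint negbin n m : R :=
  if n is n'.+1 then \sum_(i < m.+1) negbin n' i else (m == 0%N)%:R.

Definition negbin_sum n M x : R := \sum_(m < M) negbin n m * x ^+ m.

Lemma negbin_ge0 n m : 0 <= negbin n m.
Proof. by elim: n m => [|n IH] m; [exact: ler0n|apply: sumr_ge0]. Qed.

Lemma negbin_sum_recr n M x :
  negbin_sum n M.+1 x = negbin_sum n M x + negbin n M * x ^+ M.
Proof. exact: big_ord_recr. Qed.

(** Summation by parts: the factor 1 - x undoes one partial summation of the coefficients, up to a
    boundary term that [negbin_tail] sends to 0. *)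
Lemma negbin_sumS n M x : (1 - x) * negbin_sum n.+1 M x =
  negbin_sum n M x - x ^+ M * \sum_(i < M) negbin n i.
Proof.
elim: M => [|M IH]; first by rewrite /negbin_sum !big_ord0 !mulr0 subrr.
by rewrite !negbin_sum_recr mulrDr IH /= big_ord_recr /= exprS; ring.
Qed.

Lemma negbin_sum_le n M r : 0 <= r < 1 -> negbin_sum n M r <= (1 - r) ^- n.
Proof.
move=> /andP[r0 r1]; have d0 : 0 < 1 - r by rewrite subr_gt0.
elim: n => [|n IH].
  rewrite expr0 invr1 /negbin_sum; case: M => [|M]; first by rewrite big_ord0.
  by rewrite big_ord_recl big1 /= ?addr0 ?mul1r ?expr0 // => i _; rewrite mul0r.
rewrite exprS invfM mulrC ler_pdivlMr // mulrC negbin_sumS (le_trans _ IH) // gerBl.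
by rewrite mulr_ge0 ?exprn_ge0 //; apply: sumr_ge0 => i _; exact: negbin_ge0.
Qed.

(** For r midway between |x| and 1, r^M times the sum of the coefficients is at most the partial sum
    at r, hence at most (1 - r)^-n. The term is then bounded by a multiple of (|x| / r)^M. *)
Lemma negbin_tail n x : `|x| < 1 -> (x ^+ M * \sum_(i < M) negbin n i) @[M --> \oo] --> (0 : R).
Proof.
move=> x1; pose r := (1 + `|x|) / 2.
have x0 := normr_ge0 x; have r0 : 0 < r by rewrite /r; lra.
have r1 : r < 1 by rewrite /r; lra.
have xr : `|x| < r by rewrite /r; lra.
apply/norm_cvg0P.
have r01 : 0 <= r < 1 by rewrite ltW.
have bnd M : `|x ^+ M * \sum_(i < M) negbin n i| <= (1 - r) ^- n * (`|x| / r) ^+ M.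
  have s0 : 0 <= \sum_(i < M) negbin n i by apply: sumr_ge0 => i _; exact: negbin_ge0.
  rewrite normrM normrX (ger0_norm s0) expr_div_n [leRHS]mulrCA ler_wpM2l ?exprn_ge0 //.
  rewrite ler_pdivlMr ?exprn_gt0 // (le_trans _ (@negbin_sum_le n M r r01)) //.
  rewrite mulr_suml; apply: ler_sum => i _; rewrite ler_wpM2l ?negbin_ge0 //.
  by apply: (ler_wiXn2l (ltW r0) (ltW r1)); exact: ltnW.
have c0 : (1 - r) ^- n * (`|x| / r) ^+ M @[M --> \oo] --> (0 : R).
  rewrite -[X in _ --> X](mulr0 ((1 - r) ^- n)); apply: cvgMl_tmp.
  by apply: cvg_expr; rewrite ger0_norm ?divr_ge0 ?(ltW r0) // ltr_pdivrMr // mul1r.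
apply: (squeeze_cvgr _ (cvg_cst 0) c0).
by near=> M; rewrite normr_ge0 bnd.
Unshelve. all: by end_near.
Qed.

Lemma negbin_cvg n x : `|x| < 1 -> negbin_sum n M x @[M --> \oo] --> (1 - x) ^- n.
Proof.
move=> x1; have d0 : 1 - x != 0.
  by rewrite lt0r_neq0 // subr_gt0 (le_lt_trans (ler_norm x)).
elim: n => [|n IH].
  rewrite expr0 invr1 -cvg_shiftS /=.
  have -> : (fun M => negbin_sum 0 M.+1 x) = fun=> 1; last exact: cvg_cst.
  apply/funext => M; rewrite /negbin_sum big_ord_recl big1 /= ?addr0 ?mul1r ?expr0 // => i _.
  by rewrite mul0r.
have -> : (fun M => negbin_sum n.+1 M x) =
    (fun M => (1 - x)^-1 * (negbin_sum n M x - x ^+ M * \sum_(i < M) negbin n i)).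
  by apply/funext => M; rewrite -negbin_sumS mulKf.
rewrite exprS invfM -[X in _ * X]subr0; apply: cvgMl_tmp.
by apply: cvgB => //; exact: negbin_tail.
Qed.

(* Nodes rho_k = h x_k with x_k fixed and h small: the solution of the Vandermonde
   system grows like h^(1 - N), while the moments of order >= N carry h^N. *)
Lemma alternating_moments N : exists al rho : 'I_N -> R,
  [/\ forall k, 0 < rho k < 1,
      forall m, (m < N)%N -> \sum_k al k * rho k ^+ m = (-1) ^+ m
    & forall m, `|\sum_k al k * rho k ^+ m| <= 1].
Proof.
pose x (k : 'I_N) : R := k.+1%:R / N.+1%:R.
have x01 k : 0 < x k < 1.
  by rewrite divr_gt0 ?ltr0n //= ltr_pdivrMr ?ltr0n // mul1r ltr_nat ltnS.
pose V := Vandermonde N (\row_k x k).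
have uV : V \in unitmx.
  rewrite unitmxE det_Vandermonde unitfE; apply/prodf_neq0 => i _; apply/prodf_neq0 => j ij.
  rewrite !mxE subr_eq0 /x (inj_eq (mulIf _)) ?invr_eq0 ?pnatr_eq0 //.
  by rewrite eqr_nat eqSS gtn_eqF.
pose c := invmx V.
have Vc (m j : 'I_N) : \sum_k x k ^+ m * c k j = (m == j)%:R.
  have := congr1 (fun A : 'M[R]_N => A m j) (mulmxV uV); rewrite !mxE => <-.
  by apply: eq_bigr => k _; rewrite !mxE.
pose S : R := \sum_k \sum_j `|c k j|.
have S0 : 0 <= S by apply: sumr_ge0 => k _; apply: sumr_ge0.
(* The moments of order at least N are bounded by S h, which has to be at most 1; the summand 2
   makes h < 1, so that the nodes stay in (0, 1). *)
pose h : R := (2 + S)^-1.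
have h0 : 0 < h by rewrite invr_gt0; lra.
have h1 : h < 1 by rewrite invf_lt1; lra.
have hS : S * h <= 1 by rewrite ler_pdivrMr ?mul1r; lra.
pose rho k := h * x k; pose al k := \sum_j c k j * ((-1) ^+ j * h ^- j).
have momE m : \sum_k al k * rho k ^+ m =
    \sum_(j < N) ((-1) ^+ j * h ^- j * h ^+ m) * \sum_k x k ^+ m * c k j.
  under eq_bigr do rewrite mulr_suml.
  rewrite exchange_big; apply: eq_bigr => j _; rewrite mulr_sumr; apply: eq_bigr => k _.
  by rewrite /rho exprMn; ring.
have mom m : (m < N)%N -> \sum_k al k * rho k ^+ m = (-1) ^+ m.
  move=> mN; rewrite momE.
  have Vm j : \sum_k x k ^+ m * c k j = (Ordinal mN == j)%:R := Vc (Ordinal mN) j.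
  rewrite (bigD1 (Ordinal mN)) //= [X in _ + X]big1 => [|j jm].
    by rewrite Vm eqxx mulr1 addr0 mulfVK // expf_neq0 // lt0r_neq0.
  by rewrite Vm eq_sym (negbTE jm) mulr0.
exists al, rho; split => //.
  by move=> k; have /andP[a b] := x01 k; rewrite mulr_gt0 //= mulr_ilt1 // ltW.
move=> m; have [mN|Nm] := ltnP m N; first by rewrite mom // normrX normrN1 expr1n.
rewrite momE (le_trans (ler_norm_sum _ _ _)) // (le_trans _ hS) // /S exchange_big mulr_suml.
apply: ler_sum => j _; rewrite normrM mulr_suml.
have hj : `|(-1) ^+ j * h ^- j * h ^+ m| <= h.
  rewrite !normrM normrX normrN1 expr1n mul1r !ger0_norm ?invr_ge0 ?exprn_ge0 ?(ltW h0) //.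
  have jm : (j < m)%N by exact: leq_trans Nm.
  rewrite -(subnK (ltnW jm)) exprD mulrCA mulVf ?expf_neq0 ?lt0r_neq0 // mulr1.
  by rewrite -[leRHS]expr1 ler_wiXn2l ?(ltW h0) ?(ltW h1) // subn_gt0.
apply: (@le_trans _ _ (h * \sum_k `|c k j|)).
  apply: ler_pM => //; rewrite (le_trans (ler_norm_sum _ _ _)) //; apply: ler_sum => k _.
  have /andP[a b] := x01 k.
  by rewrite normrM ler_piMl // normrX ger0_norm ?exprn_ile1 // ltW.
by rewrite mulr_sumr le_eqVlt; apply/orP; left; apply/eqP; apply: eq_bigr => k _; rewrite mulrC.
Qed.

Lemma bernoulli n x : 0 <= x <= 1 -> 1 - n%:R * x <= (1 - x) ^+ n.
Proof.
move=> /andP[x0 x1]; elim: n => [|n IH]; first by rewrite mul0r subr0 expr0.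
have d : 0 <= 1 - x by rewrite subr_ge0.
rewrite exprS; apply: le_trans (ler_wpM2l d IH).
by rewrite -natr1; have := mulr_ge0 (ler0n R n) (mulr_ge0 x0 x0); nra.
Qed.

Lemma cvg_sumr (I : Type) (s : seq I) (F : I -> nat -> R) (l : I -> R) :
  (forall i, F i m @[m --> \oo] --> l i) ->
  (\sum_(i <- s) F i m) @[m --> \oo] --> \sum_(i <- s) l i.
Proof.
move=> Fl; elim: s => [|i s IH].
  by rewrite big_nil; under eq_fun do rewrite big_nil; exact: cvg_cst.
by rewrite big_cons; under eq_fun do rewrite big_cons; exact: cvgD.
Qed.

Lemma heat_coefficients n (t eta : R) : 1 / 4 < t -> t <= 1 -> 0 < eta ->
  exists K, exists al rho : 'I_K -> R,
  [/\ forall k, 0 < rho k < 1,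
      forall m, `|\sum_k al k * rho k ^+ m| <= 1
    & kappa n t - eta <= \sum_k al k * (2 * t - (2 * t - 1) * rho k) ^- n].
Proof.
move=> t4 t1 eta0; have [t2|t2] := leP 2^-1 t.
  have -> : kappa n t = 1.
    by apply/max_idPl; rewrite invf_le1 ?exprn_gt0 ?exprn_ege1 //; lra.
  (* For the single node 1 - s the value is (1 + (2t - 1) s)^-n, which is at least (1 - s)^n because
     2t - 1 <= 1, and by Bernoulli at least 1 - n s. *)
  pose s : R := Num.min 2^-1 (eta / n.+1%:R).
  have n0 : 0 < n.+1%:R :> R by rewrite ltr0n.
  have s0 : 0 < s by rewrite lt_min invr_gt0 ltr0n divr_gt0.
  have s1 : s <= 2^-1 by rewrite ge_min lexx.
  have sn : n%:R * s <= eta.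
    have : s <= eta / n.+1%:R by rewrite ge_min lexx orbT.
    rewrite ler_pdivlMr // -natr1 => h; have := ltW s0; nra.
  exists 1%N, (fun=> 1), (fun=> 1 - s); split.
  - by move=> _; apply/andP; split; lra.
  - move=> m; rewrite big_ord1 mul1r ger0_norm ?exprn_ge0 ?exprn_ile1 //; lra.
  - rewrite big_ord1 mul1r.
    set b := 2 * t - _; have b0 : 0 < b by rewrite /b; nra.
    have bs : (1 - s) * b <= 1 by rewrite /b; nra.
    have s01 : 0 <= s <= 1 by apply/andP; split; lra.
    apply: (@le_trans _ _ ((1 - s) ^+ n)).
      by apply: le_trans (@bernoulli n _ s01); lra.
    rewrite -[leRHS]mul1r ler_pdivlMr ?exprn_gt0 // -exprMn exprn_ile1 //.
    by rewrite mulr_ge0 ?(ltW b0) //; lra.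
(* With this q one has 2t - (2t - 1) rho = 2t (1 + q rho) and 4t - 1 = 2t (1 - q); q < 1 is the
   condition t > 1/4. *)
pose q := (1 - 2 * t) / (2 * t).
have t0 : 0 < 2 * t by lra.
have q0 : 0 < q by rewrite divr_gt0 //; lra.
have q1 : q < 1 by rewrite ltr_pdivrMr //; lra.
have qa : `|q| < 1 by rewrite ger0_norm // ltW.
have q01 : 0 <= q < 1 by rewrite ltW.
have tn0 : 0 < (2 * t) ^+ n by rewrite exprn_gt0.
have kap : kappa n t = (2 * t) ^- n * (1 - q) ^- n.
  rewrite -!exprVn -exprMn -invfM (_ : 2 * t * (1 - q) = 4 * t - 1).
    rewrite exprVn; apply/max_idPr; rewrite invf_ge1 ?exprn_gt0 ?exprn_ile1 //; lra.
  by rewrite /q; field; lra.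
pose T := (1 - q) ^- n; pose e := eta * (2 * t) ^+ n / 2.
have e0 : 0 < e by rewrite !mulr_gt0.
have [N HN] : exists N, T - e <= negbin_sum n N q.
  have /cvgrPdist_le /(_ _ e0) [N _ HN] := @negbin_cvg n _ qa.
  by exists N; have := HN N (leqnn N); rewrite ler_norml => /andP[_]; rewrite -/T; lra.
have [al [rho [r01 mom mom1]]] := alternating_moments N.
exists N, al, rho; split => //.
pose G M := \sum_k al k * negbin_sum n M (- (q * rho k)).
have GE M : G M = \sum_(m < M) negbin n m * (- q) ^+ m * \sum_k al k * rho k ^+ m.
  rewrite /G /negbin_sum; under eq_bigr do rewrite mulr_sumr.
  rewrite exchange_big; apply: eq_bigr => m _; rewrite mulr_sumr; apply: eq_bigr => k _.
  by rewrite -mulNr exprMn; ring.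
(* The first N moments (-1)^m turn (-q)^m into q^m, and each later term is at least minus its
   majorant. In the limit the lower bound is twice the N-th partial sum minus T, hence at least T -
   2 e. *)
have G1 M : 2 * negbin_sum n N q - negbin_sum n (N + M) q <= G (N + M)%N.
  elim: M => [|M IH].
    rewrite addn0 GE /negbin_sum (_ : \sum_(m < N) negbin n m * (- q) ^+ m * _ =
      \sum_(m < N) negbin n m * q ^+ m); first by rewrite mulr_natl mulr2n addrK.
    by apply: eq_bigr => m _; rewrite mom // -mulrA -exprMn mulrN1 opprK.
  rewrite addnS GE /negbin_sum !big_ord_recr /= -GE -/(negbin_sum n (N + M) q).
  rewrite opprD addrA; apply: lerD => //.
  set g := \sum_k _; have : `|negbin n (N + M) * (- q) ^+ (N + M) * g| <=
      negbin n (N + M) * q ^+ (N + M).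
    rewrite !normrM normrX normrN (ger0_norm (negbin_ge0 _ _)) (ger0_norm (ltW q0)).
    by rewrite ler_piMr ?mulr_ge0 ?negbin_ge0 ?exprn_ge0 ?(ltW q0) // mom1.
  by rewrite ler_norml => /andP[].
have GT : G M @[M --> \oo] --> \sum_k al k * (1 + q * rho k) ^- n.
  apply: cvg_sumr => k; apply: cvgMl_tmp; have := @negbin_cvg n (- (q * rho k)).
  rewrite opprK; apply; have /andP[a b] := r01 k.
  have qr : 0 <= q * rho k := mulr_ge0 (ltW q0) (ltW a).
  rewrite normrN (ger0_norm qr); exact: (mulr_ilt1 (ltW q0) (ltW a) q1 b).
have lim_ge : T - 2 * e <= \sum_k al k * (1 + q * rho k) ^- n.
  rewrite -(cvg_lim _ GT) //; apply: limr_ge; first by apply/cvg_ex; eexists; exact: GT.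
  exists N => // M /= NM; have := G1 (M - N)%N; rewrite subnKC //.
  by have := @negbin_sum_le n M _ q01; rewrite -/T; lra.
have -> : \sum_k al k * (2 * t - (2 * t - 1) * rho k) ^- n =
    (2 * t) ^- n * \sum_k al k * (1 + q * rho k) ^- n.
  rewrite mulr_sumr; apply: eq_bigr => k _; rewrite mulrCA; congr (_ * _).
  rewrite -!exprVn -exprMn -invfM; congr (_^-1 ^+ _).
  by rewrite /q; field; lra.
rewrite kap -/T.
have -> : (2 * t) ^- n * T - eta = (2 * t) ^- n * (T - 2 * e).
  by rewrite /e; move: ((2 * t) ^+ n) tn0 => y /lt0r_neq0 y0; field.
by rewrite ler_wpM2l // invr_ge0 ltW.
Qed.

End coefficients.

(** * Smooth cut-offs *)

Section flat_function.
Context {R : realType}.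
Implicit Types (s x : R) (k : nat).

(** The function s^-k e^(-1/s) extended by 0. The powers s^-k make the family closed under
    differentiation up to linear combinations. *)
Definition flat k s : R := if 0 < s then s^-1 ^+ k * expR (- s^-1) else 0.

(** The exponential series gives e^(1/s) >= s^-(k+2) / (k+2)!. Two spare powers of s make the
    difference quotient at the origin tend to 0. *)
Lemma flat_le k s : `|flat k s| <= k.+2`!%:R * `|s| ^+ 2.
Proof.
rewrite /flat; case: ifPn => [s0|_]; last first.
  by rewrite normr0 mulr_ge0 ?exprn_ge0.
have i0 : 0 < s^-1 by rewrite invr_gt0.
rewrite (ger0_norm (ltW s0)) (ger0_norm (mulr_ge0 (exprn_ge0 k (ltW i0)) (expR_ge0 _))).
have h := expR_ge1Dxn k.+1 (ltW i0); rewrite expRN ler_pdivrMr ?expR_gt0 //.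
have f0 : 0 < k.+2`!%:R :> R by rewrite ltr0n fact_gt0.
have : k.+2`!%:R * (s^-1 ^+ k.+2 / k.+2`!%:R) <= k.+2`!%:R * expR s^-1.
  by rewrite ler_pM2l // (le_trans _ h) // lerDr.
rewrite mulrCA divff ?lt0r_neq0 // mulr1 => h2.
rewrite mulrAC (le_trans _ (ler_wpM2r (exprn_ge0 2 (ltW s0)) h2)) //.
rewrite -addn2 exprD -mulrA -exprMn mulVf ?lt0r_neq0 // expr1n mulr1 //.
Qed.

Lemma is_derive_flat k s :
  is_derive s 1 (flat k) (flat k.+2 s - k%:R * flat k.+1 s).
Proof.
case: (ltgtP s 0) => [s0|s0|->].
- rewrite /flat !ifF ?mulr0 ?subr0; try by apply/negbTE; rewrite -leNgt ltW.
  apply: (@near_eq_is_derive _ _ _ (cst 0)).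
  near=> y; rewrite /flat ifF //; apply/negbTE; rewrite -leNgt ltW //.
  by near: y; exact: lt_nbhsl.
- apply: (@near_eq_is_derive _ _ _ (fun x => x^-1 ^+ k * expR (- x^-1))).
    near=> y; rewrite /flat ifT //.
    by near: y; exact: lt_nbhsr.
  rewrite /flat s0.
  have sn0 : s != 0 by rewrite lt0r_neq0.
  have dv : is_derive s (1 : R) (fun x : R => x^-1) (- s ^- 2).
    have d1 := @derivable_id R R s 1.
    apply: DeriveDef; first exact: (derivableV (f := id)).
    by rewrite (deriveV (f := id)) // derive_id /GRing.scale /= mulr1.
  have dN : is_derive s (1 : R) (fun x : R => - x^-1) (s ^- 2).
    by apply: is_derive_eq; rewrite opprK.
  have dE : is_derive s (1 : R) (fun x : R => expR (- x^-1)) (s ^- 2 *: expR (- s^-1)).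
    apply: (is_derive_eq (is_derive1_comp (f := expR) (g := fun x : R => - x^-1) _ dN)).
    by rewrite /GRing.scale /= mulrC.
  have dX : is_derive s (1 : R) (fun x : R => x^-1 ^+ k) ((k%:R * s^-1 ^+ k.-1) *: - s ^- 2).
    rewrite (_ : (fun x => _) = (fun x : R => x^-1) ^+ k); first exact: is_deriveX.
    by apply/funext => x; rewrite exprfctE.
  apply: (is_derive_eq (is_deriveM dX dE)).
  by rewrite -exprVn; case: k {dX} => [|k]; rewrite /GRing.scale /= !exprS; ring.
- have f0 l : flat l 0 = 0 by rewrite /flat ltxx.
  rewrite !f0 mulr0 subr0.
  suff h : (fun h => h^-1 *: ((flat k \o shift 0) (h *: 1) - flat k 0)) @ 0^' --> (0 : R).
    by apply: DeriveDef; [apply/cvg_ex; exists 0|exact: cvg_lim h].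
  apply/norm_cvg0P.
  have c0 : (fun h : R => k.+2`!%:R * `|h|) @ 0^' --> k.+2`!%:R * `|0 : R|.
    by apply: cvg_within_filter; apply: cvgMl_tmp; apply: cvg_norm; exact: cvg_id.
  rewrite normr0 mulr0 in c0.
  apply: (squeeze_cvgr _ (cvg_cst 0) c0); near=> h.
  have h0 : h != 0 by near: h; exact: nbhs_dnbhs_neq.
  have hp : 0 < `|h| by rewrite normr_gt0.
  rewrite normr_ge0 /= addr0 f0 subr0 /GRing.scale /= mulr1 normrM normfV mulrC ler_pdivrMr //.
  by rewrite -mulrA -expr2 flat_le.
Unshelve. all: by end_near. Qed.

End flat_function.

(** * A class of smooth functions closed under partial derivatives *)

Section test_functions.
Context {R : realType} {m : nat}.
Local Notation V := 'rV[R]_m.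
Implicit Types (u : V -> R) (v x : V).

(* A class of functions stable under partial derivatives and containing the
   smooth cut-offs. *)
Inductive elementary : (V -> R) -> Prop :=
| elem_coord j : elementary (fun x => x 0 j)
| elem_cst c : elementary (fun=> c)
| elem_add u w : elementary u -> elementary w -> elementary (fun x => u x + w x)
| elem_mul u w : elementary u -> elementary w -> elementary (fun x => u x * w x)
| elem_exp u : elementary u -> elementary (fun x => expR (u x))
| elem_flat k u : elementary u -> elementary (fun x => flat k (u x)).

Lemma derive_comp1 (phi : R -> R) (d : R) u x v : is_derive (u x) 1 phi d ->
  differentiable u x ->
  differentiable (fun y => phi (u y)) x /\ 'D_v (fun y => phi (u y)) x = d * 'D_v u x.
Proof.
move=> pd du; have dp : differentiable phi (u x) by apply/derivable1_diffP; exact: (@ex_derive _ _ _ _ _ _ _ pd).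
have dc : differentiable (phi \o u) x by exact: differentiable_comp.
split => //; rewrite (deriveE _ (dc : differentiable (fun y => phi (u y)) x)) (diff_comp du dp) /=.
rewrite deriveE // -[X in 'd phi _ X]mulr1 -[X in 'd phi _ X]/(_ *: _) linearZ /= -deriveE //.
by rewrite -(deriveE _ dp) (@derive_val _ _ _ _ _ _ _ pd) mulrC.
Qed.

Lemma elementary_differentiable u : elementary u -> forall x, differentiable u x.
Proof.
elim=> [j|c|u1 u2 _ h1 _ h2|u1 u2 _ h1 _ h2|u1 _ h1|k u1 _ h1] x.
- exact: differentiable_coord.
- exact: differentiable_cst.
- exact: differentiableD.
- exact: differentiableM.
- exact: (derive_comp1 0 (is_derive_expR _) (h1 x)).1.
- exact: (derive_comp1 0 (is_derive_flat _ _) (h1 x)).1.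
Qed.

Lemma elementary_derive u v : elementary u -> elementary (fun x => 'D_v u x).
Proof.
have eqe (w w' : V -> R) : (forall x, w x = w' x) -> elementary w' -> elementary w.
  by move=> /funext ->.
elim=> [j|c|u1 u2 e1 h1 e2 h2|u1 u2 e1 h1 e2 h2|u1 e1 h1|k u1 e1 h1].
- apply: (eqe _ (fun=> v 0 j)) => [x|]; last exact: elem_cst.
  apply: cvg_lim => //; apply: cvg_near_cst; near=> h; rewrite /= !mxE addrK scalerA.
  by rewrite mulVf ?scale1r //; near: h; exact: nbhs_dnbhs_neq.
- apply: (eqe _ (fun=> 0)) => [x|]; last exact: elem_cst.
  exact: derive_cst.
- apply: (eqe _ (fun x => 'D_v u1 x + 'D_v u2 x)) => [x|]; last exact: elem_add.
  apply: (deriveD (f := u1) (g := u2));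
    apply: diff_derivable; exact: elementary_differentiable.
- apply: (eqe _ (fun x => u1 x * 'D_v u2 x + u2 x * 'D_v u1 x)) => [x|]; last first.
    by apply: elem_add; exact: elem_mul.
  apply: (deriveM (f := u1) (g := u2));
    apply: diff_derivable; exact: elementary_differentiable.
- apply: (eqe _ (fun x => expR (u1 x) * 'D_v u1 x)) => [x|]; last first.
    by apply: elem_mul => //; exact: elem_exp.
  exact: (derive_comp1 v (is_derive_expR _) (elementary_differentiable e1 x)).2.
- apply: (eqe _ (fun x => (flat k.+2 (u1 x) + (- k%:R) * flat k.+1 (u1 x)) * 'D_v u1 x)) => [x|]; last first.
    apply: elem_mul => //; apply: elem_add; first exact: elem_flat.
    by apply: elem_mul; [exact: elem_cst|exact: elem_flat].
  rewrite mulNr.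
  exact: (derive_comp1 v (is_derive_flat _ _) (elementary_differentiable e1 x)).2.
Unshelve. all: by end_near. Qed.

Lemma elementary_smooth u : elementary u -> smooth u.
Proof.
move=> eu k; elim: k u eu => [|k IH] u eu; split => //.
- by move=> x; exact/differentiable_continuous/elementary_differentiable.
- by move=> x; exact/differentiable_continuous/elementary_differentiable.
- move=> j; split; first by move=> x; exact/diff_derivable/elementary_differentiable.
  by apply: IH; exact: elementary_derive.
Qed.

End test_functions.

(** * Compactly supported cut-offs and test symbols *)

Section cutoff.
Context {R : realType} {n : nat}.
Local Notation C := R[i].
Local Notation Cn := 'rV[R[i]]_n.
Local Notation R2 := (measurableTypeR R * measurableTypeR R)%type.
Local Notation Tn := (n.-tuple R2).
Implicit Types (z w : Cn) (r : R) (q : 'rV[R]_(n + n)).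

Lemma sqnorm_of_real q : sqnorm (of_real q) = \sum_(j < n + n) q 0 j ^+ 2.
Proof.
rewrite big_split_ord /= -big_split /=; apply: eq_bigr => j _.
by rewrite mxE normc_sqr /= !mxE.
Qed.

Lemma elem_sum m (I : Type) (s : seq I) (F : I -> 'rV[R]_m -> R) :
  (forall i, elementary (F i)) -> elementary (fun x => \sum_(i <- s) F i x).
Proof.
move=> eF; elim: s => [|i s IH].
  rewrite (_ : (fun x => _) = fun=> 0); first exact: elem_cst.
  by apply/funext => x; rewrite big_nil.
rewrite (_ : (fun x => _) = fun x => F i x + \sum_(i <- s) F i x); first exact: elem_add.
by apply/funext => x; rewrite big_cons.
Qed.

Lemma elem_sqnorm : elementary (fun q : 'rV[R]_(n + n) => sqnorm (of_real q)).
Proof.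
rewrite (_ : (fun q => _) = fun q => \sum_(j < n + n) (q 0 j * q 0 j)).
  by apply: elem_sum => j; apply: elem_mul; exact: elem_coord.
by apply/funext => q; rewrite sqnorm_of_real; apply: eq_bigr => j _; rewrite expr2.
Qed.

(** The factor e normalises the value at 0 to 1. The parameter r is the square of the radius of the
    support. *)
Definition cutoff r w : R := expR 1 * flat 0 (1 - sqnorm w / r).

Lemma elem_cutoff r : elementary (fun q => cutoff r (of_real q)).
Proof.
apply: elem_mul; first exact: elem_cst.
apply: elem_flat.
rewrite (_ : (fun q => _) = fun q : 'rV[R]_(n + n) => 1 + sqnorm (of_real q) * - r^-1).
  apply: elem_add; first exact: elem_cst.
  by apply: elem_mul; [exact: elem_sqnorm|exact: elem_cst].
by apply/funext => q; rewrite mulrN.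
Qed.

Lemma measurable_flat0 : measurable_fun setT (flat 0 : R -> R).
Proof.
apply: continuous_measurable_fun => s; apply/differentiable_continuous/derivable1_diffP.
exact: (@ex_derive _ _ _ _ _ _ _ (is_derive_flat 0 s)).
Qed.

Lemma rborel_cutoff r : rborel (cutoff r).
Proof.
apply: measurable_funM; first exact: measurable_cst.
apply: (measurableT_comp measurable_flat0); apply: measurable_funB; first exact: measurable_cst.
by apply: measurable_funM; [exact: rborel_sqnorm|exact: measurable_cst].
Qed.

(** With x = |w|^2 / r: for x <= 1/2 the exponent 1 - 1/(1-x) is at least -2x, and for larger x the
    bound 2x exceeds 1, while the cut-off stays between 0 and 1. *)
Lemma cutoff_close r w : 0 < r -> `|cutoff r w - 1| <= 2 * sqnorm w / r.
Proof.
move=> r0; rewrite /cutoff /flat -mulrA; set x := sqnorm w / r.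
have x0 : 0 <= x by rewrite divr_ge0 ?sqnorm_ge0 // ltW.
case: ifPn => [d0|]; last first.
  by rewrite subr_gt0 -leNgt => x1; rewrite mulr0 sub0r normrN1; lra.
rewrite expr0 mul1r -expRD.
have i0 : 0 < (1 - x)^-1 by rewrite invr_gt0.
have e1 : 1 - (1 - x)^-1 <= 0 by rewrite subr_le0 invf_ge1 //; lra.
have e2 : expR (1 - (1 - x)^-1) <= 1 by rewrite -[leRHS]expR0 ler_expR.
have e3 := expR_gt0 (1 - (1 - x)^-1).
rewrite ler0_norm ?subr_le0 // opprB.
have [x2|x2] := leP x 2^-1; last by lra.
have := expR_ge1Dx (1 - (1 - x)^-1).
have : (1 - x)^-1 <= 1 + 2 * x.
  by rewrite -[leLHS]mul1r ler_pdivrMr //; nra.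
lra.
Qed.

Lemma cutoff_support r w : 0 < r -> cutoff r w != 0 -> sqnorm w < r.
Proof.
rewrite /cutoff /flat => r0; case: ifPn => [|_]; last by rewrite mulr0 eqxx.
by rewrite subr_gt0 ltr_pdivrMr // mul1r.
Qed.

Lemma Cc_smooth_real (u : Cn -> R) r : 0 < r ->
  elementary (fun q => u (of_real q)) -> (forall w, u w != 0 -> sqnorm w < r) ->
  Cc_smooth (fun w => (u w)%:C).
Proof.
move=> r0 eu su; split.
- exact: elementary_smooth.
- by apply: elementary_smooth; exact: (elem_cst 0).
(* A coordinate with square less than r has modulus at most 1 + r. *)
pose c := 1 + r.
pose B := [set v : 'rV[R]_(n + n) | forall i, `[- c, c]%classic (v ord0 i)].
have cB : compact B.
  by apply: (@rV_compact R _ (fun=> `[- c, c]%classic)) => i; exact: segment_compact.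
apply: (subclosed_compact _ cB); first exact: closed_closure.
have clB : closed B by apply: compact_closed cB; exact: norm_hausdorff.
rewrite (closure_id B).1 //; apply: closureS => q /= uq i.
have : sqnorm (of_real q) < r.
  by apply: su; apply: contra_neq uq => ->.
rewrite sqnorm_of_real (bigD1 i) //= => h.
have : 0 <= \sum_(j < n + n | j != i) q 0 j ^+ 2.
  by apply: sumr_ge0 => j _; exact: sqr_ge0.
move=> h2; have h3 : q 0 i ^+ 2 < r by lra.
rewrite in_itv /= /c; apply/andP; split; nra.
Qed.

Definition to_real z : 'rV[R]_(n + n) :=
  row_mx (\row_j complex.Re (z 0 j)) (\row_j complex.Im (z 0 j)).

Lemma to_realK z : of_real (to_real z) = z.
Proof.
by apply/rowP => j; rewrite mxE row_mxKl row_mxKr !mxE; case: (z 0 j).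
Qed.

Lemma to_real_ball z w (d : R) : (forall j, normc (w 0 j - z 0 j) < d) -> 0 < d ->
  ball (to_real z) d (to_real w).
Proof.
move=> h d0; split => // i j; rewrite (ord1 i); case: (split_ordP j) => k ->.
  rewrite !row_mxEl !mxE; apply: le_lt_trans (h k); rewrite normcBC -ReB.
  exact: Re_le_normc.
rewrite !row_mxEr !mxE; apply: le_lt_trans (h k); rewrite normcBC -ImB.
exact: Im_le_normc.
Qed.

Lemma Cc_smooth_borel (g : Cn -> C) : Cc_smooth g -> borel g.
Proof.
move=> [s1 s2 _]; have c1 := (s1 0%N).1; have c2 := (s2 0%N).1.
apply: borel_of_continuous => z e e0.
have e2 : 0 < e / 2 by rewrite divr_gt0.
have /cvgrPdist_lt /(_ _ e2) /nbhs_ballP[d1 /= d10 h1] := c1 (to_real z).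
have /cvgrPdist_lt /(_ _ e2) /nbhs_ballP[d2 /= d20 h2] := c2 (to_real z).
have d0 : 0 < Num.min d1 d2 by rewrite lt_min d10.
exists (Num.min d1 d2) => // w hw.
have m1 : Num.min d1 d2 <= d1 by rewrite ge_min lexx.
have m2 : Num.min d1 d2 <= d2 by rewrite ge_min lexx orbT.
have := h1 (to_real w); have := h2 (to_real w); rewrite !to_realK => H2 H1.
have {}H1 := H1 (to_real_ball (fun j => lt_le_trans (hw j) m1) d10).
have {}H2 := H2 (to_real_ball (fun j => lt_le_trans (hw j) m2) d20).
rewrite normcBC (le_lt_trans (normc_le_ReIm _)) // ReB ImB; move: H1 H2; lra.
Qed.

Lemma Cc_smooth_bounded (g : Cn -> C) : Cc_smooth g ->
  exists2 B : R, 0 <= B & forall z, normc (g z) <= B.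
Proof.
move=> [s1 s2 cK]; have c1 := (s1 0%N).1; have c2 := (s2 0%N).1.
have bnd (u : 'rV[R]_(n + n) -> R) : continuous u -> exists2 B, 0 <= B &
    forall q, g (of_real q) != 0 -> `|u q| <= B.
  move=> cu; have := continuous_compact (continuous_subspaceT cu) cK.
  move=> /compact_bounded [M [_ HM]]; exists (`|M| + 1); first by rewrite addr_ge0.
  move=> q gq; apply: (HM (`|M| + 1)).
    by have := ler_norm M; lra.
  by exists q => //; exact: subset_closure.
have [B1 B10 h1] := bnd _ c1; have [B2 B20 h2] := bnd _ c2.
exists (B1 + B2) => [|z]; first exact: addr_ge0.
have [->|gz] := eqVneq (g z) 0; first by rewrite normc0 addr_ge0.
have gq : g (of_real (to_real z)) != 0 by rewrite to_realK.
have := h1 _ gq; have := h2 _ gq; rewrite to_realK => k2 k1.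
by rewrite (le_trans (normc_le_ReIm _)) // lerD.
Qed.

End cutoff.

(** * The supremum *)

Section truncation.
Context {R : realType} {n : nat}.
Local Notation C := R[i].
Local Notation Cn := 'rV[R[i]]_n.
Variables (K : nat) (al rho : 'I_K -> R).
Hypothesis rho_in : forall k, 0 < rho k < 1.
Implicit Types (w : Cn) (r eta : R).

Lemma sqnorm_gfactor_le k w : sqnorm w * gfactor (rho k) w <= 2 / ((rho k)^-1 - 1).
Proof.
have /andP[r0 r1] := rho_in k; set c := (rho k)^-1 - 1.
have c0 : 0 < c by rewrite subr_gt0 invf_gt1.
have := expR_ge1Dx (c * sqnorm w / 2); rewrite /gfactor -/c expRN.
rewrite ler_pdivrMr ?expR_gt0 // [2 / c * _]mulrAC ler_pdivlMr // => h; lra.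
Qed.

(** The cut-off error grows like |w|^2 / r, but the symbol decays like a Gaussian; their product is
    uniformly at most D / r, and r is taken large accordingly. The 1 added to D keeps r positive. *)
Lemma truncation_close eta : 0 < eta -> exists2 r, 0 < r &
  forall w, normc ((cutoff r w)%:C * gsym al rho w - gsym al rho w) <= eta.
Proof.
move=> e0; pose D := \sum_k `|al k * rho k ^- n| * (4 / ((rho k)^-1 - 1)).
have D0 : 0 <= D.
  apply: sumr_ge0 => k _; have /andP[r0 r1] := rho_in k.
  by rewrite mulr_ge0 // divr_ge0 // subr_ge0 invf_ge1 // ltW.
exists ((D + 1) / eta) => [|w]; first by rewrite divr_gt0 // ltr_wpDl.
set r := (D + 1) / eta; have r0 : 0 < r by rewrite divr_gt0 // ltr_wpDl.
rewrite (_ : _ - _ = (cutoff r w - 1)%:C * gsym al rho w); last by rewrite rmorphB /= mulrBl mul1r.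
rewrite normcM !normcR.
apply: (@le_trans _ _ (2 * sqnorm w / r * `|gsym_real al rho w|)).
  by rewrite ler_wpM2r // cutoff_close.
apply: (@le_trans _ _ (D / r)); last first.
  by rewrite ler_pdivrMr // /r mulrCA divff ?lt0r_neq0 // mulr1 lerDl.
rewrite mulrAC ler_pM2r ?invr_gt0 //.
apply: (@le_trans _ _ (2 * sqnorm w * \sum_k `|al k * rho k ^- n| * gfactor (rho k) w)).
  rewrite ler_wpM2l ?mulr_ge0 ?sqnorm_ge0 // (le_trans (ler_norm_sum _ _ _)) //.
  by apply: ler_sum => k _; rewrite normrM (ger0_norm (expR_ge0 _)).
rewrite mulr_sumr; apply: ler_sum => k _; rewrite mulrCA ler_wpM2l //.
by have := sqnorm_gfactor_le k w; rewrite -mulrA; lra.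
Qed.

Lemma tsym_Cc_smooth r : 0 < r -> @Cc_smooth R n (tsym al rho (cutoff r)).
Proof.
move=> r0; pose u w := cutoff r w * gsym_real al rho w.
rewrite (_ : tsym _ _ _ = fun w => (u w)%:C); last by apply/funext => w; rewrite RcM.
apply: (Cc_smooth_real r0) => [|w]; last first.
  by rewrite mulf_eq0 negb_or => /andP[h _]; exact: cutoff_support h.
apply: elem_mul; first exact: elem_cutoff.
apply: elem_sum => k; apply: elem_mul; first exact: elem_cst.
apply: elem_exp.
rewrite (_ : (fun q => _) = fun q => (- ((rho k)^-1 - 1) / 2) * sqnorm (of_real q)).
  by apply: elem_mul; [exact: elem_cst|exact: elem_sqnorm].
by apply/funext => q; field; case/andP: (rho_in k) => /lt0r_neq0.
Qed.

End truncation.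

(** * Attaining the constant in the limit *)

Section sharpness.
Context {R : realType} (n : nat) (t : R).
Hypotheses (t_gt : 1 / 4 < t) (t_le1 : t <= 1).
Local Notation C := R[i].
Local Notation Cn := 'rV[R[i]]_n.
Implicit Types (g f : Cn -> C) (eta : R).

Let kap := kappa n t.

Let kap_ge1 : 1 <= kap. Proof. by rewrite /kap /kappa le_max lexx. Qed.

Lemma test_opnorm g f : Cc_smooth g -> fock f -> toeplitz g f <> (fun=> 0) ->
  exists2 N : R, 0 < N & opnorm (toeplitz g) = N%:E.
Proof.
move=> sg ff gf; have bg := Cc_smooth_borel sg; have [B B0 gB] := Cc_smooth_bounded sg.
have := opnorm_gt0 bg B0 gB ff gf.
have := opnorm_le bg B0 gB (toeplitz_op_bound bg B0 gB) B0.
by case: (opnorm _) => [N _ N0|//|//]; exists N.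
Qed.

Lemma ratio_le g f : Cc_smooth g -> fock f -> toeplitz g f <> (fun=> 0) ->
  (supnorm (heat t g) / opnorm (toeplitz g) <= kap%:E)%E.
Proof.
move=> sg ff gf; have [N N0 EN] := test_opnorm sg ff gf.
have bg := Cc_smooth_borel sg; have [B B0 gB] := Cc_smooth_bounded sg.
have [_] := heat_toeplitz_bound t_gt t_le1 (bounded_admissible bg B0 gB)
  (bounded_toeplitz_bounded bg B0 gB).
by rewrite EN inver (gt_eqF N0) lee_pdivrMr.
Qed.

Lemma ratio_ge eta : 0 < eta -> 2 * eta < 1 -> exists2 g : Cn -> C,
  Cc_smooth g /\ (exists2 f, fock f & toeplitz g f <> (fun=> 0)) &
  (((kap - 2 * eta) / (1 + eta))%:E <= supnorm (heat t g) / opnorm (toeplitz g))%E.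
Proof.
move=> e0 e1; have t0 : 0 < t by apply: lt_trans t_gt; rewrite divr_gt0.
have [K [al [rho [r01 mom hk]]]] := heat_coefficients n t_gt t_le1 e0.
have [r r0 close] := @truncation_close R n K al rho r01 eta e0.
pose g : Cn -> C := tsym al rho (cutoff r).
have sg : Cc_smooth g by exact: tsym_Cc_smooth.
have bg := Cc_smooth_borel sg; have [B B0 gB] := Cc_smooth_bounded sg.
(* One eta is lost in the choice of coefficients and one in the cut-off. *)
have h0 : kap - 2 * eta <= normc (heat t g 0).
  have hh := heat_tsym_ge r01 (rborel_cutoff r) close t0.
  apply: (le_trans _ hh); move: hk; rewrite -/kap => hk'; lra.
have k0 : 0 < kap - 2 * eta by have := kap_ge1; lra.
have sup0 : ((normc (heat t g 0))%:E <= supnorm (heat t g))%E.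
  by apply: ereal_sup_ubound; exists 0.
have gN : (opnorm (toeplitz g) <= (1 + eta)%:E)%E.
  apply: (opnorm_le bg B0 gB); last by rewrite addr_ge0 // ltW.
  move=> f ff; apply: (toeplitz_tsym_norm r01 (rborel_cutoff r) (ltW e0) close) => // h fh.
  exact: dilation_sum_contraction.
(* If the operator vanished, the upper bound already proved would force the heat transform to
   vanish, against its lower bound at 0. *)
have [f ff gf] : exists2 f, fock f & toeplitz g f <> (fun=> 0).
  apply: contrapT => h.
  have g0 f : fock f -> toeplitz g f = fun=> 0.
    by move=> ff; apply: contrapT => gf; apply: h; exists f.
  have o0 : (opnorm (toeplitz g) <= 0)%E.
    apply: ge_ereal_sup => _ [f [ff f1] <-]; rewrite (g0 f ff) lee_fin.
    by rewrite /L2norm /sqL2norm /nnint; under eq_integral do rewrite normc0 expr0n mul0r;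
       rewrite integral0 sqrtr0.
  have [_ hb] := heat_toeplitz_bound t_gt t_le1 (bounded_admissible bg B0 gB)
    (bounded_toeplitz_bounded bg B0 gB).
  have o1 : opnorm (toeplitz g) = 0%E by apply/eqP; rewrite eq_le o0 opnorm_ge0.
  have := le_trans sup0 hb; rewrite o1 mule0 lee_fin leNgt => /negP; apply.
  exact: lt_le_trans k0 h0.
exists g; first by split => //; exists f.
have [N N0 EN] := test_opnorm sg ff gf; rewrite EN in gN *.
rewrite lee_fin in gN.
rewrite inver (gt_eqF N0) lee_pdivlMr // -EFinM; apply: (le_trans _ sup0); rewrite lee_fin (le_trans _ h0) //.
by rewrite mulrAC ler_pdivrMr ?ltr_wpDl // ?(ltW e0) // ler_pM2l.
Qed.

Lemma sup_ratio :
  ereal_sup [set (supnorm (heat t g) / opnorm (toeplitz g))%E |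
     g in [set g : Cn -> C | Cc_smooth g /\ exists2 f, fock f & toeplitz g f <> (fun=> 0)]]
  = kap%:E.
Proof.
apply/eqP; rewrite eq_le; apply/andP; split.
  by apply: ge_ereal_sup => _ [g [sg [f ff gf]] <-]; exact: ratio_le ff gf.
apply/lee_addgt0Pr => e e0.
(* The gap kap - (kap - 2 eta) / (1 + eta) equals eta (2 + kap) / (1 + eta), hence is at most e; the
   bound 1/4 secures 2 eta < 1. *)
pose eta := Num.min 4^-1 (e / (2 + kap)).
have k2 : 0 < 2 + kap by have := kap_ge1; lra.
have h0 : 0 < eta by rewrite lt_min invr_gt0 ltr0n divr_gt0.
have h1 : 2 * eta < 1.
  have : eta <= 4^-1 by rewrite ge_min lexx.
  lra.
have h2 : eta * (2 + kap) <= e by rewrite -ler_pdivlMr // ge_min lexx orbT.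
have [g gP hg] := ratio_ge h0 h1.
apply: (@le_trans _ _ (((kap - 2 * eta) / (1 + eta))%:E + e%:E)%E).
  rewrite -EFinD lee_fin -lerBlDr ler_pdivlMr ?addr_gt0 //.
  have := mulr_ge0 (ltW e0) (ltW h0); nra.
by rewrite leeD2r // (le_trans hg) //; apply: ereal_sup_ubound; exists g.
Qed.

End sharpness.

Theorem proposition4p1 (R : realType) (n : nat) (t : R)
    (n_ge1 : (1 <= n)%N) (t_gt : 1 / 4 < t) (t_le1 : t <= 1) :
  (forall g : 'rV[R[i]]_n -> R[i],
     admissible g -> toeplitz_bounded g ->
     (forall a, heat_converges t g a) /\
     (supnorm (heat t g) <= (kappa n t)%:E * opnorm (toeplitz g))%E) /\
  ereal_sup [set (supnorm (heat t g) / opnorm (toeplitz g))%E |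
               g in [set g : 'rV[R[i]]_n -> R[i] |
                       Cc_smooth g /\
                       exists2 f, fock f & toeplitz g f <> (fun=> 0)]]
  = (kappa n t)%:E.
Proof.
split; first by move=> g; exact: heat_toeplitz_bound.
exact: sup_ratio.
Qed.
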